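(* There exist absolute constants $C,c_1,c_2>0$ such that the following holds. Let $(\mathcal S,\mathcal A,H,\mathbb P,r,f_1,\dots,f_I,s_1)$ be an episodic PCMDP (as described in the context) that satisfies the boundedness, non-negativity and feasibility assumptions, with $|\mathcal S|=S$, $|\mathcal A|=A>1$. Let $p\in(0,1)$, $\phi\in(0,\tfrac12)$, $T=KH$, $\ell=\log(SAT/p)$. Run the Constrained Q-Learning Algorithm for $K$ episodes with parameters $\xi=0$ and $\eta=T^{\phi}$ and bonus constants $c_1,c_2$, and let $\pi^k$ be the (deterministic) policy it uses in episode $k$. Then for all sufficiently large $K$ (equivalently $T$), with probability at least $1-p$, the total regret and the total constraint violation are bounded as $$\sum_{k=1}^{K}\big[V_1^*(s_1)-V_1^{\pi^k}(s_1)\big]\le C\,T^{\frac12+\phi}\sqrt{H^3SA\,\ell},$$ $$\sum_{k=1}^{K}\sum_{h=1}^{H}\sum_{i=1}^{I}\mathbf E\big|g_i^-(s_h^k,\pi_h^k(s_h^k))\big|\le C\,I\,T^{1-\phi},$$ where $g_i=f_i^-$ (so $g_i^-=f_i^-$).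
   Context: **PCMDP.** $\mathcal S$, $\mathcal A$ are finite state and action sets, $H$ is the number of epochs per episode, $[n]=\{1,\dots,n\}$, $\mathbb P_h(\cdot\mid s,a)$ is the distribution of the next state from $(s,a)$ at epoch $h$, $r:\mathcal S\times\mathcal A\to\mathbb R$ is a deterministic reward, $f_i:\mathcal S\times\mathcal A\to\mathbb R$ ($i\in[I]$) are peak constraint functions, and $s_1$ is a fixed initial state of every episode. $\mathbb P$, $r$, $f_i$ are unknown to the agent, but $r(s,a)$ and $f_i(s,a)$ are measured when $(s,a)$ is observed. A policy $\pi=(\pi_h)_{h\in[H]}$ assigns to each epoch $h$ and state $s$ a probability distribution over actions; $\pi_h(s)$ denotes the random action so drawn. $\mathbf E$ is over the randomness of the policy and of the transitions, with trajectories started at $s_1$; in the regret and violation sums the expectation for index $k$ is over a trajectory $(s_h^k)_h$ generated by the given policy $\pi^k$. Write $x^-=\min\{x,0\}$. **Assumptions.** (Boundedness) $|r|$ and $|f_i|$ are strictly bounded by $1$. (Non-negativity) $0\le r(s,a)\le1$ for all $(s,a)$. (Feasibility) There is a policy $\pi$ with $\mathbf E[f_i^-(s_h,\pi_h(s_h))]\ge0$ for all $h\in[H]$, $i\in[I]$. **Values.** $V_1^{\pi}(s_1)=\mathbf E\big[\sum_{h=1}^H r(s_h,\pi_h(s_h))\big]$ and $V_1^*(s_1)=\sup_{\pi\in\Pi}V_1^\pi(s_1)$, where $\Pi$ is the set of policies with $\mathbf E[f_i^-(s_h,\pi_h(s_h))]\ge0$ for all $h,i$. **Modified reward.** For $\xi\ge0$,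 $g_{i,\xi}(s,a)=f_i^-(s,a)+\xi$ (written $g_i$ when $\xi=0$), $g_{i,\xi}^-=\min\{g_{i,\xi},0\}$, and $$R_\xi(s,a)=r(s,a)+\frac{\eta}{I}\sum_{i=1}^I g_{i,\xi}^-(s,a).$$ **Constrained Q-Learning Algorithm** (with parameters $\xi,\eta$). Let $\alpha_t=\frac{H+1}{H+t}$. Initialize, for all $(s,a,h)$, $Q_h(s,a)\leftarrow\eta H$, $W_h(s)\leftarrow\eta H$ for $h\in[H]$, $W_{H+1}\equiv0$, and $N_h(s,a),\mu_h(s,a),\sigma_h(s,a),\beta_0(s,a,h)\leftarrow0$. For each episode $k=1,\dots,K$, start at $s_1$ and for $h=1,\dots,H$: 1. take $a_h\in\arg\max_{a'}Q_h(s_h,a')$ and observe $s_{h+1}$; 2. $t=N_h(s_h,a_h)\leftarrow N_h(s_h,a_h)+1$; 3. $\mu_h(s_h,a_h)\leftarrow\mu_h(s_h,a_h)+W_{h+1}(s_{h+1})$; 4. $\sigma_h(s_h,a_h)\leftarrow\sigma_h(s_h,a_h)+(W_{h+1}(s_{h+1}))^2$; 5. $\beta_t(s_h,a_h,h)\leftarrow\min\Big\{c_1\Big(\sqrt{\tfrac{H}{t}\big(\tfrac{\sigma_h(s_h,a_h)}{t}-\big(\tfrac{\mu_h(s_h,a_h)}{t}\big)^2+\eta H\big)\ell}+\eta\tfrac{\sqrt{H^7SA}\,\ell}{t}\Big),\ c_2\eta\sqrt{\tfrac{H^3\ell}{t}}\Big\}$; 6. $b_t\leftarrow\frac{\beta_t(s_h,a_h,h)-(1-\alpha_t)\beta_{t-1}(s_h,a_h,h)}{2\alpha_t}$;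 7. $Q_h(s_h,a_h)\leftarrow(1-\alpha_t)Q_h(s_h,a_h)+\alpha_t[R_\xi(s_h,a_h)+W_{h+1}(s_{h+1})+b_t]$; 8. $W_h(s_h)\leftarrow\min\{\eta H,\max_{a'}Q_h(s_h,a')\}$. The policy $\pi^k$ of episode $k$ is the deterministic greedy policy: $\pi_h^k$ puts probability $1$ on $\arg\max_{a'}Q_h^k(s,a')$, where $Q_h^k$ is the table at the start of episode $k$. The probability $1-p$ is over the run of the algorithm. ''Sufficiently large $K$'' means larger than a threshold that may depend on $S,A,H,I,p,\phi$. *)

(* Defs.v *)
From mathcomp Require Import all_boot all_order all_algebra.
From mathcomp Require Import boolp classical_sets reals exp.

Set Implicit Arguments.
Unset Strict Implicit.
Unset Printing Implicit Defensive.

Import Order.TTheory GRing.Theory Num.Theory.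
Local Open Scope classical_set_scope.
Local Open Scope ring_scope.

(* Epochs are numbered from 0: [h : 'I_H] is epoch [h + 1]. *)

Definition is_dist (R : realType) (T : finType) (q : T -> R) : Prop :=
  (forall x, 0 <= q x) /\ \sum_x q x = 1.

Definition negpart (R : realType) (x : R) : R := Num.min x 0.

Record pcmdp (R : realType) (S A : finType) (H I : nat) := PCMDP {
  trans : 'I_H -> S -> A -> S -> R;
  reward : S -> A -> R;
  constr : 'I_I -> S -> A -> R;
  start : S;
  transP : forall h s a, is_dist (trans h s a) }.

Section Model.
Variables (R : realType) (S A : finType) (H I : nat).
Variable M : pcmdp R S A H I.

(* [o h] is the state observed after epoch [h]; the last one is s_{H+1}. *)
Definition obs := {ffun 'I_H -> S}.

Definition state_at (o : obs) (h : 'I_H) : S :=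
  if (h : nat) == 0%N then start M else o (ord_pred h).

Definition policy := 'I_H -> S -> A -> R.

Definition is_policy (pi : policy) : Prop := forall h s, is_dist (pi h s).

Definition det_policy (d : 'I_H -> S -> A) : policy :=
  fun h s a => (a == d h s)%:R.

(* A trajectory consists of the successive actions and successor states. *)
Definition traj := ({ffun 'I_H -> A} * obs)%type.

Definition traj_prob (pi : policy) (w : traj) : R :=
  \prod_(h < H) (pi h (state_at w.2 h) (w.1 h) *
                 trans M h (state_at w.2 h) (w.1 h) (w.2 h)).

Definition Etraj (pi : policy) (X : traj -> R) : R :=
  \sum_(w : traj) traj_prob pi w * X w.

(* The value of [u] at the state and action of epoch [h]. *)
Definition at_epoch (u : S -> A -> R) (h : 'I_H) (w : traj) : R :=
  u (state_at w.2 h) (w.1 h).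

Definition value (pi : policy) : R :=
  Etraj pi (fun w => \sum_(h < H) at_epoch (reward M) h w).

Definition feasible_policies : set policy :=
  [set pi | is_policy pi /\
    forall (h : 'I_H) (i : 'I_I),
      0 <= Etraj pi (at_epoch (fun s a => negpart (constr M i s a)) h)].

Definition opt_value : R := sup [set value pi | pi in feasible_policies].

Definition bounded_pcmdp : Prop :=
  (forall s a, `|reward M s a| < 1) /\
  (forall i s a, `|constr M i s a| < 1).

Definition nonneg_reward : Prop := forall s a, 0 <= reward M s a <= 1.

Definition feasible_pcmdp : Prop := exists pi, feasible_policies pi.

Definition gfun (xi : R) (i : 'I_I) (s : S) (a : A) : R :=
  negpart (constr M i s a) + xi.

Definition mod_reward (xi eta : R) (s : S) (a : A) : R :=
  reward M s a + eta / I%:R * \sum_(i < I) negpart (gfun xi i s a).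

(* [tabW] is also indexed by epoch H + 1, which is [ord_max].
   [tabbeta h s a t] is beta_t(s,a,h). *)
Record tables := Tables {
  tabQ : 'I_H -> S -> A -> R;
  tabW : 'I_H.+1 -> S -> R;
  tabN : 'I_H -> S -> A -> nat;
  tabmu : 'I_H -> S -> A -> R;
  tabsigma : 'I_H -> S -> A -> R;
  tabbeta : 'I_H -> S -> A -> nat -> R }.

Definition upd {V : Type} (F : 'I_H -> S -> A -> V) h s a (v : V) :=
  fun h' s' a' => if (h', s', a') == (h, s, a) then v else F h' s' a'.

Definition updW (W : 'I_H.+1 -> S -> R) j s (v : R) :=
  fun j' s' => if (j', s') == (j, s) then v else W j' s'.

Definition this_epoch (h : 'I_H) : 'I_H.+1 := widen_ord (leqnSn H) h.
Definition next_epoch (h : 'I_H) : 'I_H.+1 := lift ord0 h.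

Definition learning_rate (t : nat) : R := H.+1%:R / (H + t)%:R.

Section Algorithm.
Variables (xi eta ell c1 c2 : R).

Definition init_tables : tables :=
  {| tabQ := fun _ _ _ => eta * H%:R;
     tabW := fun j _ => if j == ord_max then 0 else eta * H%:R;
     tabN := fun _ _ _ => 0%N;
     tabmu := fun _ _ _ => 0;
     tabsigma := fun _ _ _ => 0;
     tabbeta := fun _ _ _ _ => 0 |}.

Definition bonus_beta (t : nat) (mu sigma : R) : R :=
  Num.min
    (c1 * (Num.sqrt (H%:R / t%:R *
                     (sigma / t%:R - (mu / t%:R) ^+ 2 + eta * H%:R) * ell)
           + eta * (Num.sqrt (H%:R ^+ 7 * #|S|%:R * #|A|%:R) * ell / t%:R)))
    (c2 * eta * Num.sqrt (H%:R ^+ 3 * ell / t%:R)).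

(* Update of the tables at epoch [h] after taking action [a] in state [s] and
   observing the next state [s']. The maximum over the actions is seeded with
   the value at [a], so that no bottom element of R is needed. *)
Definition step_update (D : tables) (h : 'I_H) (s : S) (a : A) (s' : S) :
    tables :=
  let w := tabW D (next_epoch h) s' in
  let t := (tabN D h s a).+1 in
  let mu := tabmu D h s a + w in
  let sigma := tabsigma D h s a + w ^+ 2 in
  let beta := bonus_beta t mu sigma in
  let alpha := learning_rate t in
  let b := (beta - (1 - alpha) * tabbeta D h s a t.-1) / (2 * alpha) in
  let q := (1 - alpha) * tabQ D h s a
           + alpha * (mod_reward xi eta s a + w + b) in
  let Q := upd (tabQ D) h s a q in
  let v := Num.min (eta * H%:R) (\big[Num.max/Q h s a]_(a' : A) Q h s a') in
  {| tabQ := Q;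
     tabW := updW (tabW D) (this_epoch h) s v;
     tabN := upd (tabN D) h s a t;
     tabmu := upd (tabmu D) h s a mu;
     tabsigma := upd (tabsigma D) h s a sigma;
     tabbeta := upd (tabbeta D) h s a
                  (fun t' => if t' == t then beta else tabbeta D h s a t') |}.

(* The rows of [tabQ] for epoch [h] are unchanged by the updates of the earlier
   epochs of the episode, so the action [d h (state_at o h)], with [d] greedy
   for the tables at the start of the episode, is also greedy for the tables
   that are current at epoch [h]. *)
Definition episode_update (d : 'I_H -> S -> A) (D : tables) (o : obs) :
    tables :=
  foldl (fun D' h =>
           step_update D' h (state_at o h) (d h (state_at o h)) (o h))
    D (enum 'I_H).

(* An argmax rule: [tie past h s q] maximizes [q]; ties may be broken depending
   on the past episodes, the epoch and the state. *)
Definition argmax_rule (tie : seq obs -> 'I_H -> S -> (A -> R) -> A) : Prop :=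
  forall past h s q a, q a <= q (tie past h s q).

Variable tie : seq obs -> 'I_H -> S -> (A -> R) -> A.

(* [past] lists the observations of the past episodes, most recent first. *)
Fixpoint tables_after (past : seq obs) : tables :=
  if past is o :: past' then
    let D := tables_after past' in
    episode_update (fun h s => tie past' h s (tabQ D h s)) D o
  else init_tables.

Definition greedy (past : seq obs) : 'I_H -> S -> A :=
  fun h s => tie past h s (tabQ (tables_after past) h s).

(* A run of K episodes is identified with its observations, in chronological
   order. [greedy_at w k] is the policy of episode [k + 1]. *)
Definition greedy_at (K : nat) (w : K.-tuple obs) (k : 'I_K) :
    'I_H -> S -> A :=
  greedy (rev (take k w)).

Definition run_prob (K : nat) (w : K.-tuple obs) : R :=
  \prod_(k < K) \prod_(h < H)
    let s := state_at (tnth w k) h in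
    trans M h s (greedy_at w k h s) (tnth w k h).

Definition Prun (K : nat) (E : pred (K.-tuple obs)) : R :=
  \sum_(w : K.-tuple obs | E w) run_prob w.

End Algorithm.
End Model.

(* Main.v *)
(** A feasible policy never pays the penalty eta / I, and any policy loses
    eta / I times its violation in the penalized value. Hence a bound on the
    regret for the penalized reward, whose values lie in [-eta, 1], bounds the
    regret, and also (eta / I) times the violation up to an additive T.

    Optimism: let W be the table values, V and Q the optimal values for the
    penalized reward, and expand a table entry at its visits as
    Q + (average of V(s') - E V) + (average of W(s') - V(s')) + bonus / 2, the
    averages being weighted by the learning rates. A self-normalized
    exponential supermartingale, used over a dyadic grid of scales, bounds the
    noise average by the averaged square of V(s') - E V at a cost of only
    u = sqrt ell per event, while the bonus carries ell; for large T this
    absorbs every factor depending on H. That averaged square is at most the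
    empirical variance of W plus a multiple of the average of W(s') - V(s'),
    and the latter, nonnegative by induction over the episodes, also enters the
    table entry, with the right sign. So no a priori bound on W - V is needed.

    Regret: the gaps V - Q along the played actions telescope against W - V,
    which leaves the sum of the bonuses. A first bound through their Hoeffding
    part shows that W - V is small on average, so that up to lower order terms
    the empirical variances can be replaced by the variances of V. These add up
    to at most 2 (eta H)^2 per episode, again by telescoping. *)

Require Import Defs.
From mathcomp Require Import all_boot all_order all_algebra.
From mathcomp Require Import boolp classical_sets reals exp.
From mathcomp Require Import sequences ring lra.

Set Implicit Arguments.
Unset Strict Implicit.
Unset Printing Implicit Defensive.

Import Order.TTheory GRing.Theory Num.Theory.
Local Open Scope ring_scope.

(** * Self-normalized concentration *)

(** The bonus constants are absolute (both are taken to be 1), but the learning rate is only bounded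
    by [2 * H / t], so the noise bound carries H^2 under its root where the bonus has H. What closes
    the gap is the count of the bad events: about H S A ell^2, from a grid of about ell^2 scales.
    With p fixed, ell^2 exp(- sqrt ell) tends to 0 as T grows, so [u = sqrt ell] survives the union
    bound and ell / u eventually exceeds 256^2 H^2. The grid is forced by the changing weights of
    the averages. Factoring each weight into a decay depending on the present count and a weight
    fixed at the visit gives a martingale, but the best scale for it depends on the count and on the
    empirical variance, which are both random. In [C = 8 e^3 + 10], e^3 comes from the weights of
    the telescoping over epochs; 8 is 7 for the leading term (2 sqrt 10 <= 7) plus 1 for everything
    of lower order in T; 10 pays for passing from the gaps along the observed trajectories to their
    expectations. The assumption phi < 1/2 makes the regret divided by eta, of order sqrt T, smaller
    than T^(1 - phi). *)

Lemma expR_sub_sqr_le (R : realType) (y : R) :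
  `|y| <= 4^-1 -> expR (y - y ^+ 2) <= 1 + y.
Proof.
rewrite ler_norml => /andP[y1 y2].
have y10 : 0 < 1 + y by lra.
rewrite -[y - _]opprK expRN invf_ple ?posrE ?expR_gt0 //.
rewrite -[leLHS]mul1r ler_pdivrMr //.
(* Halving the exponent before using [1 + x <= expR x], then squaring, keeps a term of second order.
   The direct bound would leave [1 + y ^+ 3], which is below 1 for negative [y]. *)
have e2 : expR (- (y - y ^+ 2)) = expR (- (y - y ^+ 2) / 2) ^+ 2.
  by rewrite -expRM_natl; congr expR; field.
have h1 : 1 + (- (y - y ^+ 2) / 2) <= expR (- (y - y ^+ 2) / 2) by exact: expR_ge1Dx.
have h0 : 0 <= 1 + (- (y - y ^+ 2) / 2) by nra.
have h2 : (1 + (- (y - y ^+ 2) / 2)) ^+ 2 <= expR (- (y - y ^+ 2) / 2) ^+ 2.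
  by rewrite ler_sqr ?nnegrE // expR_ge0.
rewrite e2; apply: le_trans (_ : (1 + (- (y - y ^+ 2) / 2)) ^+ 2 * (1 + y) <= _); last first.
  by rewrite ler_pM2r.
have -> : (1 + (- (y - y ^+ 2) / 2)) ^+ 2 * (1 + y) =
  1 + y ^+ 2 * ((1 + y) * (1 - y) ^+ 2 / 4 + y) by field.
rewrite lerDl mulr_ge0 ?sqr_ge0 //.
case: (lerP 0 y) => [y0|y0]; first by rewrite addr_ge0 // divr_ge0 // mulr_ge0 ?sqr_ge0 // addr_ge0.
nra.
Qed.

Section TreeProcess.
Variables (R : realType) (O : finType) (ker : seq O -> O -> R).
Hypothesis kerP : forall p, is_dist (ker p).

(** Histories list the most recent outcome first, and [ker p] is the law of the next outcome. With
    this recursion, conditioning on a history is just starting from it. *)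
Fixpoint run_mean n (p : seq O) (f : seq O -> R) : R :=
  if n is n'.+1 then \sum_o ker p o * run_mean n' (o :: p) f else f p.

Fixpoint hit (bad : pred (seq O)) (p : seq O) : bool :=
  bad p || (if p is _ :: q then hit bad q else false).

Fixpoint psum (X : seq O -> O -> R) (p : seq O) : R :=
  if p is o :: q then psum X q + X q o else 0.

Lemma run_mean_le n p f g : (forall q, f q <= g q) ->
  run_mean n p f <= run_mean n p g.
Proof.
move=> fg; elim: n p => [|n IH] p //=.
by apply: ler_sum => o _; rewrite ler_wpM2l // (kerP p).1.
Qed.

Lemma run_mean_cst n p c : run_mean n p (fun=> c) = c.
Proof.
elim: n p => [|n IH] p //=.
under eq_bigr do rewrite IH.
by rewrite -mulr_suml (kerP p).2 mul1r.
Qed.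

Lemma run_mean_sum n p (J : finType) (f : J -> seq O -> R) :
  run_mean n p (fun q => \sum_j f j q) = \sum_j run_mean n p (f j).
Proof.
elim: n p => [|n IH] p //=.
under eq_bigr do rewrite IH mulr_sumr.
by rewrite exchange_big.
Qed.

Lemma run_mean_sub n p f g :
  run_mean n p (fun q => f q - g q) = run_mean n p f - run_mean n p g.
Proof.
elim: n p => [|n IH] p //=.
by rewrite -sumrB; apply: eq_bigr => o _; rewrite IH mulrBr.
Qed.

(** Ville's maximal inequality. By induction on the remaining steps, from a history not yet hit the
    chance of a later hit is at most [Z p], because [Z] is at least 1 at the first hit. *)
Lemma run_mean_hit_le (bad : pred (seq O)) (Z : seq O -> R) n :
  (forall p, 0 <= Z p) ->
  (forall p, \sum_o ker p o * Z (o :: p) <= Z p) ->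
  (forall p, bad p -> 1 <= Z p) ->
  run_mean n [::] (fun p => (hit bad p)%:R) <= Z [::].
Proof.
move=> Z0 Zs Zb.
have le1 m p : run_mean m p (fun p => (hit bad p)%:R) <= 1.
  by rewrite -[leRHS](run_mean_cst m p); apply: run_mean_le => q; rewrite lern1 leq_b1.
have key m p : ~~ hit bad p -> run_mean m p (fun p => (hit bad p)%:R) <= Z p.
  elim: m p => [|m IH] p hp /=; first by rewrite (negbTE hp).
  apply: le_trans (Zs p); apply: ler_sum => o _; rewrite ler_wpM2l ?(kerP p).1 //.
  case: (boolP (hit bad (o :: p))) => [|/IH//].
  by rewrite /= (negbTE hp) orbF => /Zb; apply: le_trans.
case: (boolP (hit bad [::])) => [|/key//].
by rewrite /= orbF => /Zb; apply: le_trans.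
Qed.

(** The exponential of the difference of the two sums is a supermartingale: [expR_sub_sqr_le] bounds
    its growth factor by [1 + X], which has mean 1. The squares are the observed ones, so that
    empirical variances can come in without any prior bound on conditional variances. *)
Lemma self_normalized_tail (X : seq O -> O -> R) (u : R) n :
  (forall p, \sum_o ker p o * X p o = 0) ->
  (forall p o, `|X p o| <= 4^-1) ->
  run_mean n [::] (fun p =>
    (hit (fun q => u <= psum X q - psum (fun q o => X q o ^+ 2) q) p)%:R)
  <= expR (- u).
Proof.
move=> X0 X1.
pose Z p := expR (psum X p - psum (fun q o => X q o ^+ 2) p - u).
have -> : expR (- u) = Z [::] by rewrite /Z /= subrr sub0r.
apply: run_mean_hit_le => p.
- exact: expR_ge0.
- have -> : Z p = Z p * \sum_o ker p o * (1 + X p o).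
    under eq_bigr do rewrite mulrDr mulr1.
    by rewrite big_split /= X0 addr0 (kerP p).2 mulr1.
  rewrite mulr_sumr; apply: ler_sum => o _; rewrite mulrCA.
  rewrite ler_wpM2l ?(kerP p).1 //.
  have -> : Z (o :: p) = Z p * expR (X p o - X p o ^+ 2).
    by rewrite /Z /= -expRD; congr expR; ring.
  by rewrite ler_wpM2l ?expR_ge0 // expR_sub_sqr_le.
- by move=> h; rewrite /Z -expR0 ler_expR; lra.
Qed.

Lemma union_hit_le (J : finType) (bad : J -> pred (seq O)) (e : R) n :
  (forall j, run_mean n [::] (fun p => (hit (bad j) p)%:R) <= e) ->
  1 - #|J|%:R * e <=
    run_mean n [::] (fun p => [forall j, ~~ hit (bad j) p]%:R).
Proof.
move=> be.
have h : run_mean n [::] (fun p => 1 - \sum_j (hit (bad j) p)%:R) <=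
  run_mean n [::] (fun p => [forall j, ~~ hit (bad j) p]%:R).
  apply: run_mean_le => p; case: (boolP [forall j, _]) => [_|].
    by rewrite gerBl sumr_ge0.
  rewrite negb_forall => /existsP[j]; rewrite negbK => hj.
  by rewrite subr_le0 (bigD1 j) //= hj lerDl sumr_ge0.
apply: le_trans h; rewrite run_mean_sub run_mean_cst run_mean_sum lerB //.
apply: le_trans (_ : \sum_(j : J) e <= _); first by apply: ler_sum => j _.
by rewrite sumr_const mulr_natl.
Qed.

(** Passes from chronological tuples, on which [run_prob] lives, to the reversed histories on which
    the maximal inequality is proved. *)
Lemma run_mean_tuple n p (f : seq O -> R) :
  \sum_(w : n.-tuple O)
     (\prod_(k < n) ker (rev (take k w) ++ p) (tnth w k)) * f (rev w ++ p)
  = run_mean n p f.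
Proof.
elim: n p => [|n IH] p /=.
  rewrite (big_pred1 [tuple]) => [|w]; last by apply/esym/eqP; exact: tuple0.
  by rewrite big_ord0 mul1r.
under [RHS]eq_bigr do rewrite -IH mulr_sumr.
rewrite pair_big /= (reindex (fun x : O * n.-tuple O => [tuple of x.1 :: x.2])) /=.
  apply: eq_bigr => -[o w] _ /=.
  rewrite big_ord_recl /= mulrA [tnth _ ord0]tnth0.
  congr (_ * _ * _); last by rewrite rev_cons cat_rcons.
  apply: eq_bigr => k _; rewrite rev_cons cat_rcons; congr ker.
  by rewrite tnthS.
exists (fun w => (thead w, [tuple of behead w])) => [[o w] _|w _] /=.
  by rewrite theadE; congr pair; apply: val_inj.
by rewrite [RHS]tuple_eta.
Qed.

End TreeProcess.

(** * Laws of trajectories *)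

Section Chain.
Variables (R : realType) (S : finType).

Definition path_state n (s0 : S) (o : {ffun 'I_n -> S}) (h : 'I_n) : S :=
  if (h : nat) == 0%N then s0 else o (ord_pred h).

(** The kernels may be signed or unnormalized: a function of one transition is multiplied into the
    kernel of its epoch, so that its expectation is again a chain. *)
Fixpoint chain n : ('I_n -> S -> S -> R) -> S -> R :=
  if n is n'.+1 then
    fun k s => \sum_s' k ord0 s s' * chain (fun h => k (lift ord0 h)) s'
  else fun _ _ => 1.

Lemma chainE n (k : 'I_n -> S -> S -> R) s0 :
  \sum_(o : {ffun 'I_n -> S}) \prod_(h < n) k h (path_state s0 o h) (o h) =
  chain k s0.
Proof.
elim: n k s0 => [|n IH] k s0 /=.
  under eq_bigr do rewrite big_ord0.
  by rewrite sumr_const card_ffun card_ord expn0.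
under [RHS]eq_bigr do rewrite -IH mulr_sumr.
rewrite pair_big /=.
pose f (x : S * {ffun 'I_n -> S}) : {ffun 'I_n.+1 -> S} :=
  [ffun h => if unlift ord0 h is Some h' then x.2 h' else x.1].
rewrite (reindex f) /=.
  apply: eq_bigr => -[s o] _; rewrite big_ord_recl /=.
  congr (_ * _); first by rewrite /path_state /= ffunE unlift_none.
  apply: eq_bigr => h _; rewrite [f _ _]ffunE liftK /=; congr (k _ _ _).
  rewrite /path_state /=.
  have -> : ord_pred (lift ord0 h) = widen_ord (leqnSn n) h.
    apply: val_inj; rewrite /= add0n.
    by rewrite modnDr modn_small // ltnS ltnW.
  rewrite ffunE; case: ifPn => [/eqP h0|h0].
    by rewrite (_ : widen_ord _ _ = ord0) ?unlift_none //; apply: val_inj.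
  have -> : widen_ord (leqnSn n) h = lift ord0 (ord_pred h).
    apply: val_inj.
    case: h h0 => [[//|m]] /= mn _; rewrite /bump /= add1n.
    by rewrite modnDr modn_small // ltnW.
  by rewrite liftK.
exists (fun o => (o ord0, [ffun h => o (lift ord0 h)])) => [[s o] _|o _] /=.
  rewrite /f ffunE unlift_none /=; congr pair; apply/ffunP => h.
  by rewrite !ffunE liftK.
apply/ffunP => h; rewrite /f ffunE /=.
by case: unliftP => [h' ->|->]; rewrite ?ffunE.
Qed.

Lemma chain1 n (k : 'I_n -> S -> S -> R) s0 :
  (forall h s, \sum_s' k h s s' = 1) -> chain k s0 = 1.
Proof.
elim: n k s0 => [|n IH] k s0 k1 //=.
under eq_bigr do rewrite IH ?mulr1 //.
exact: k1.
Qed.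

(** The kernels after [h0] integrate to 1, the row sums at [h0] are then nonpositive, and the
    kernels before [h0] only take nonnegative combinations of them. *)
Lemma chain_le0 n (k : 'I_n -> S -> S -> R) (h0 : 'I_n) s0 :
  (forall h s s', h != h0 -> 0 <= k h s s') ->
  (forall h s, h != h0 -> \sum_s' k h s s' = 1) ->
  (forall s, \sum_s' k h0 s s' <= 0) -> chain k s0 <= 0.
Proof.
elim: n k h0 s0 => [|n IH] k h0 s0 k0 k1 kh /=; first by case: h0 k0 k1 kh.
case: (unliftP ord0 h0) => [h1 h0E|h0E].
  apply: sumr_le0 => s' _; rewrite mulr_ge0_le0 //.
    by apply: k0; rewrite h0E neq_lift.
  apply: (IH _ h1) => [h s s2 hh|h s hh|s].
  - by apply: k0; rewrite h0E (inj_eq lift_inj).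
  - by apply: k1; rewrite h0E (inj_eq lift_inj).
  - by rewrite -h0E.
rewrite (eq_bigr (fun s' => k ord0 s0 s')) => [|s' _]; first by rewrite -h0E.
by rewrite chain1 ?mulr1 // => h s; apply: k1; rewrite h0E eq_sym neq_lift.
Qed.

End Chain.

Section Trajectories.
Variables (R : realType) (S A : finType) (H I : nat) (M : pcmdp R S A H I).

Definition ep_prob (d : 'I_H -> S -> A) (o : obs S H) : R :=
  \prod_(h < H) trans M h (state_at M o h) (d h (state_at M o h)) (o h).

Lemma ep_prob_dist d : is_dist (ep_prob d).
Proof.
split=> [o|]; first by apply: prodr_ge0 => h _; apply: (transP _ _ _ _).1.
rewrite (chainE (fun h s s' => trans M h s (d h s) s') (start M)).
by apply: chain1 => h s; apply: (transP _ _ _ _).2.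
Qed.

Lemma ep_mean_le0 d (h0 : 'I_H) (c : S -> S -> R) :
  (forall s, \sum_s' trans M h0 s (d h0 s) s' * c s s' <= 0) ->
  \sum_o ep_prob d o * c (state_at M o h0) (o h0) <= 0.
Proof.
move=> c0.
pose k h s s' := trans M h s (d h s) s' * (if h == h0 then c s s' else 1).
have -> : \sum_o ep_prob d o * c (state_at M o h0) (o h0) =
    \sum_o \prod_(h < H) k h (path_state (start M) o h) (o h).
  apply: eq_bigr => o _; rewrite big_split /=; congr (_ * _).
  rewrite (bigD1 h0) //= eqxx big1 ?mulr1 // => h /negbTE -> //.
rewrite chainE; apply: (chain_le0 (h0 := h0)) => [h s s'|h s|s]; rewrite /k.
- by move/negbTE->; rewrite mulr1; apply: (transP _ _ _ _).1.
- by move/negbTE->; under eq_bigr do rewrite mulr1; apply: (transP _ _ _ _).2.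
- by rewrite eqxx.
Qed.

Lemma ep_mean_eq0 d (h0 : 'I_H) (c : S -> S -> R) :
  (forall s, \sum_s' trans M h0 s (d h0 s) s' * c s s' = 0) ->
  \sum_o ep_prob d o * c (state_at M o h0) (o h0) = 0.
Proof.
move=> c0; apply/eqP; rewrite eq_le; apply/andP; split.
  by apply: ep_mean_le0 => s; rewrite c0.
rewrite -oppr_le0 -sumrN; under eq_bigr do rewrite -mulrN.
apply: (ep_mean_le0 (c := fun s s' => - c s s')) => s.
by under eq_bigr do rewrite mulrN; rewrite sumrN c0 oppr0.
Qed.

(** Once the states are fixed, the weight of a trajectory is a product over epochs of functions of
    one action each, so the sum over action vectors distributes and leaves a chain on states. *)
Lemma Etraj_step pi (h0 : 'I_H) (c : S -> A -> S -> R) :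
  Etraj M pi (fun w => c (state_at M w.2 h0) (w.1 h0) (w.2 h0)) =
  \sum_(o : obs S H) \prod_(h < H) \sum_a
     pi h (state_at M o h) a * trans M h (state_at M o h) a (o h) *
     (if h == h0 then c (state_at M o h) a (o h) else 1).
Proof.
rewrite /Etraj /traj_prob -(pair_big xpredT xpredT (fun (x : {ffun 'I_H -> A}) (o : obs S H) =>
  (\prod_(h < H) (pi h (state_at M o h) (x h) *
     trans M h (state_at M o h) (x h) (o h))) *
  c (state_at M o h0) (x h0) (o h0))) exchange_big /=.
apply: eq_bigr => o _; rewrite bigA_distr_bigA /=; apply: eq_bigr => x _.
rewrite [RHS]big_split /=; congr (_ * _).
rewrite (bigD1 h0) //= eqxx big1 ?mulr1 // => h /negbTE -> //.
Qed.

Lemma Etraj_le0 pi (h0 : 'I_H) (c : S -> A -> S -> R) : is_policy pi ->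
  (forall s a, \sum_s' trans M h0 s a s' * c s a s' <= 0) ->
  Etraj M pi (fun w => c (state_at M w.2 h0) (w.1 h0) (w.2 h0)) <= 0.
Proof.
move=> piP c0; rewrite Etraj_step.
rewrite (chainE (fun h s s' => \sum_a pi h s a * trans M h s a s' *
  (if h == h0 then c s a s' else 1)) (start M)).
apply: (chain_le0 (h0 := h0)) => [h s s'|h s|s].
- move/negbTE->; apply: sumr_ge0 => a _.
  by rewrite mulr1 mulr_ge0 ?(piP _ _).1 // (transP _ _ _ _).1.
- move/negbTE->; rewrite exchange_big /=.
  rewrite -[RHS](piP h s).2; apply: eq_bigr => a _.
  under eq_bigr do rewrite mulr1.
  by rewrite -mulr_sumr (transP _ _ _ _).2 mulr1.
- rewrite eqxx exchange_big /=; apply: sumr_le0 => a _.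
  under eq_bigr do rewrite -mulrA.
  by rewrite -mulr_sumr mulr_ge0_le0 // (piP _ _).1.
Qed.

Lemma Etraj_cst pi c : is_policy pi -> Etraj M pi (fun=> c) = c.
Proof.
move=> piP; rewrite /Etraj -mulr_suml -[RHS]mul1r; congr (_ * _).
rewrite /traj_prob -(pair_big xpredT xpredT (fun (x : {ffun 'I_H -> A}) (o : obs S H) =>
  \prod_(h < H) (pi h (state_at M o h) (x h) *
     trans M h (state_at M o h) (x h) (o h)))) exchange_big /=.
under eq_bigr do rewrite -(bigA_distr_bigA (fun h a => _ h _ a * _ h _ a _)) /=.
rewrite (chainE (fun h s s' => \sum_a pi h s a * trans M h s a s') (start M)).
apply: chain1 => h s; rewrite exchange_big /= -[RHS](piP h s).2.
by apply: eq_bigr => a _; rewrite -mulr_sumr (transP _ _ _ _).2 mulr1.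
Qed.

Lemma Etraj_sum pi (J : finType) (X : J -> traj S A H -> R) :
  Etraj M pi (fun w => \sum_j X j w) = \sum_j Etraj M pi (X j).
Proof.
rewrite /Etraj exchange_big /=; apply: eq_bigr => w _.
by rewrite mulr_sumr.
Qed.

Lemma Etraj_scale pi c (X : traj S A H -> R) :
  Etraj M pi (fun w => c * X w) = c * Etraj M pi X.
Proof. by rewrite /Etraj mulr_sumr; apply: eq_bigr => w _; rewrite mulrCA. Qed.

Lemma EtrajD pi (X Y : traj S A H -> R) :
  Etraj M pi (fun w => X w + Y w) = Etraj M pi X + Etraj M pi Y.
Proof. by rewrite /Etraj -big_split; apply: eq_bigr => w _; rewrite mulrDr. Qed.

Lemma Etraj_le pi (X Y : traj S A H -> R) : is_policy pi ->
  (forall w, X w <= Y w) -> Etraj M pi X <= Etraj M pi Y.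
Proof.
move=> piP XY; apply: ler_sum => w _; rewrite ler_wpM2l //.
by apply: prodr_ge0 => h _; rewrite mulr_ge0 ?(piP _ _).1 ?(transP _ _ _ _).1.
Qed.

Lemma det_policyP d : is_policy (det_policy R d : policy R S A H).
Proof.
move=> h s; split=> [a|]; first by rewrite /det_policy ler0n.
rewrite (bigD1 (d h s)) //= /det_policy eqxx big1 ?addr0 // => a /negbTE -> //.
Qed.

Lemma Etraj_det d (h0 : 'I_H) (u : S -> A -> R) :
  Etraj M (det_policy R d) (at_epoch M u h0) =
  \sum_o ep_prob d o * u (state_at M o h0) (d h0 (state_at M o h0)).
Proof.
rewrite (Etraj_step _ h0 (fun s a _ => u s a)).
apply: eq_bigr => o _.
transitivity (\prod_(h < H) (trans M h (state_at M o h) (d h (state_at M o h)) (o h) *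
    (if h == h0 then u (state_at M o h) (d h (state_at M o h)) else 1))).
  apply: eq_bigr => h _; rewrite (bigD1 (d h (state_at M o h))) //=.
  rewrite {1}/det_policy eqxx mul1r big1 ?addr0 // => a /negbTE ad.
  by rewrite /det_policy ad !mul0r.
rewrite big_split /=; congr (_ * _).
rewrite (bigD1 h0) //= eqxx big1 ?mulr1 // => h /negbTE -> //.
Qed.

End Trajectories.

(** * Averages weighted by the learning rates *)

Section LearningRate.
Variables (R : realType) (H : nat).
Hypothesis H_gt0 : (0 < H)%N.

Local Notation alpha := (learning_rate R H).

Lemma learning_rateE t : alpha t = (H%:R + 1) / (H%:R + t%:R).
Proof. by rewrite /learning_rate natrD -natr1. Qed.

Let HR0 : 0 < H%:R :> R. Proof. by rewrite ltr0n. Qed.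
Let HR1 : 1 <= H%:R :> R. Proof. by rewrite ler1n. Qed.

Lemma learning_rate1 : alpha 1 = 1.
Proof. by rewrite learning_rateE divff // gt_eqF // addr_gt0. Qed.

Lemma learning_rate_gt0 t : 0 < alpha t.
Proof. by rewrite learning_rateE divr_gt0 // ltr_wpDr. Qed.

Lemma learning_rate_le1 t : alpha t.+1 <= 1.
Proof.
rewrite learning_rateE ler_pdivrMr ?ltr_wpDr ?ler0n //.
by rewrite mul1r lerD2l ler1n.
Qed.

Lemma learning_rate_le t : (0 < t)%N -> alpha t <= 2 * H%:R / t%:R.
Proof.
move=> t0; have tR : 0 < t%:R :> R by rewrite ltr0n.
rewrite learning_rateE ler_pdivrMr ?addr_gt0 // mulrAC ler_pdivlMr //.
have h1 : 0 <= (H%:R - 1) * t%:R :> R by rewrite mulr_ge0 ?subr_ge0.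
have h2 : 0 <= H%:R * H%:R :> R by rewrite mulr_ge0.
by have := HR0; have := HR1; lra.
Qed.

Lemma learning_rate_step t : (0 < t)%N ->
  (1 - alpha t.+1) * alpha t <= alpha t.+1.
Proof.
move=> t0; have tR : 0 < t%:R :> R by rewrite ltr0n.
rewrite !learning_rateE -natr1.
have h1 : 0 < H%:R + (t%:R + 1) :> R by rewrite !addr_gt0.
have -> : 1 - (H%:R + 1) / (H%:R + (t%:R + 1)) = t%:R / (H%:R + (t%:R + 1)) :> R.
  by field; rewrite gt_eqF.
have E (a b c d : R) : a / b * (c / d) = c / b * (a / d) by ring.
rewrite E ler_piMr ?divr_ge0 ?addr_ge0 // ler_pdivrMr ?addr_gt0 //; by have := HR0; have := HR1; lra.
Qed.

(** The product of [1 - alpha i] over 2 <= i <= t. The factor for i = 1 is 0 and is left out, so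
    that [decay] can be divided by. *)
Fixpoint decay t : R :=
  if t is t'.+1 then if t' is 0%N then 1 else decay t' * (1 - alpha t) else 1.

(** An element of index i enters an average over t visits with the weight [decay t * weight i]. The
    second factor is known at its visit and never changes, which makes the weighted noise a
    martingale. *)
Definition weight t := alpha t / decay t.

Lemma decayS t : (0 < t)%N -> decay t.+1 = decay t * (t%:R / (H%:R + t%:R + 1)).
Proof.
case: t => // t _; rewrite [LHS]/= -/(decay t.+1) learning_rateE; congr (_ * _).
rewrite -[t.+2%:R]natr1; field.
by rewrite gt_eqF //; have := HR0; have := ler0n R t; lra.
Qed.

Lemma decay_gt0 t : 0 < decay t.
Proof.
elim: t => [|[|t] IH] //; rewrite decayS // mulr_gt0 // divr_gt0 ?ltr0n //.
by rewrite !addr_gt0 ?ltr0n.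
Qed.

Lemma decay_le t : (0 < t)%N -> decay t <= t%:R^-1.
Proof.
elim: t => [|[|t] IH] // _; first by rewrite invr1.
rewrite decayS //; have tR : 0 < t.+1%:R :> R by rewrite ltr0n.
apply: le_trans (_ : t.+1%:R^-1 * (t.+1%:R / (H%:R + t.+1%:R + 1)) <= _).
  by rewrite ler_pM2r ?IH // divr_gt0 // !addr_gt0.
rewrite mulrA mulVf ?gt_eqF // mul1r lef_pV2 ?posrE ?addr_gt0 ?ltr0n //.
by rewrite -[t.+2%:R]natr1; have := HR0; have := HR1; lra.
Qed.

(** The decay is only polynomial, so the scales to be tested span a polynomial range and a number of
    dyadic scales logarithmic in it covers them. The induction step is Bernoulli's inequality for (1
    + 1/t)^(H+1). *)
Lemma decay_ge t : (0 < t)%N -> (t%:R ^+ H.+1)^-1 <= decay t.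
Proof.
elim: t => [|[|t] IH] // _; first by rewrite expr1n invr1.
rewrite decayS //; have tR : 0 < t.+1%:R :> R by rewrite ltr0n.
have t2R : 0 < t.+2%:R :> R by rewrite ltr0n.
apply: le_trans (_ : (t.+1%:R ^+ H.+1)^-1 * (t.+1%:R / (H%:R + t.+1%:R + 1)) <= _); last first.
  by rewrite ler_pM2r ?IH // divr_gt0 // !addr_gt0.
have bern n (x : R) : 0 <= x -> 1 + n%:R * x <= (1 + x) ^+ n.
  move=> x0; elim: n => [|n IHn]; first by rewrite mul0r addr0 expr0.
  rewrite exprS -natr1; apply: le_trans (_ : (1 + x) * (1 + n%:R * x) <= _).
    by have := mulr_ge0 x0 (mulr_ge0 (ler0n R n) x0); have := HR0; have := HR1; lra.
  by rewrite ler_wpM2l // addr_ge0.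
have /(bern H.+1) h : 0 <= t.+1%:R^-1 :> R by rewrite invr_ge0 ltW.
have t2E : t.+2%:R = t.+1%:R * (1 + t.+1%:R^-1) :> R.
  by rewrite mulrDr mulr1 mulfV ?gt_eqF // -natr1.
rewrite t2E exprMn invfM ler_pM2l ?invr_gt0 ?exprn_gt0 //.
have -> : t.+1%:R / (H%:R + t.+1%:R + 1) = (1 + H.+1%:R * t.+1%:R^-1)^-1 :> R.
  have -> : H.+1%:R = H%:R + 1 :> R by rewrite natr1.
  move: tR; move: (t.+1%:R) => x /lt0r_neq0 x0.
  by rewrite -[LHS]invrK invf_div; congr (_^-1); field.
by rewrite lef_pV2 ?posrE ?exprn_gt0 ?addr_gt0 ?mulr_gt0 ?invr_gt0 ?ltr0n.
Qed.

Lemma weight_gt0 t : 0 < weight t.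
Proof. by rewrite divr_gt0 ?learning_rate_gt0 ?decay_gt0. Qed.

Lemma weightS t : (0 < t)%N -> weight t <= weight t.+1.
Proof.
move=> t0; have tR : 0 < t%:R :> R by rewrite ltr0n.
rewrite /weight decayS // invfM (mulrC (decay t)^-1) mulrA.
rewrite ler_pM2r ?invr_gt0 ?decay_gt0 // !learning_rateE invf_div -natr1.
have -> : (H%:R + 1) / (H%:R + (t%:R + 1)) * ((H%:R + t%:R + 1) / t%:R) = (H%:R + 1) / t%:R :> R.
  field; rewrite gt_eqF //= gt_eqF //; have := HR0; lra.
by rewrite ler_pM2l ?addr_gt0 // lef_pV2 ?posrE ?addr_gt0 //; have := HR0; lra.
Qed.

Lemma weight_le t n : (0 < t)%N -> (t <= n)%N -> weight t <= weight n.
Proof.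
move=> t0 /subnK <-; elim: (n - t)%N => [|m IH] //.
by apply: le_trans IH _; rewrite addSn weightS // addn_gt0 t0 orbT.
Qed.

Section Avg.
Variable T : eqType.
Implicit Types (f g : T -> R) (xs : seq T).

(* Lists hold the most recent element first: the head of [xs] has index
   [size xs]. *)
Fixpoint avg f xs : R :=
  if xs is x :: xs' then
    (1 - alpha (size xs)) * avg f xs' + alpha (size xs) * f x
  else 0.

Fixpoint isum (F : nat -> T -> R) xs : R :=
  if xs is x :: xs' then isum F xs' + F (size xs) x else 0.

(** At each visit the algorithm acts on the statistics of the earlier visits, which form a proper
    tail of the list; hence the sum over tails. *)
Fixpoint tsum (F : seq T -> R) xs : R :=
  if xs is x :: xs' then tsum F xs' + F xs' else 0.

Let rate_ge0 t : 0 <= 1 - alpha t.+1.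
Proof. by rewrite subr_ge0 learning_rate_le1. Qed.

Lemma avg_cons f x xs : avg f (x :: xs) =
  (1 - alpha (size xs).+1) * avg f xs + alpha (size xs).+1 * f x.
Proof. by []. Qed.

Lemma avgD f g xs : avg (fun x => f x + g x) xs = avg f xs + avg g xs.
Proof.
elim: xs => [|x xs IH]; rewrite [LHS]/= ?addr0 // IH [in RHS]/=; ring.
Qed.

Lemma avgZ c f xs : avg (fun x => c * f x) xs = c * avg f xs.
Proof.
elim: xs => [|x xs IH]; rewrite [LHS]/= ?mulr0 // IH [in RHS]/=; ring.
Qed.

Lemma avg_cst c xs : (0 < size xs)%N -> avg (fun=> c) xs = c.
Proof.
case: xs => // x xs _; elim: xs x => [|y xs IH] x; first by rewrite /= learning_rate1; ring.
by rewrite avg_cons IH; ring.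
Qed.

Lemma avg_le f g xs : {in xs, forall x, f x <= g x} -> avg f xs <= avg g xs.
Proof.
elim: xs => [|x xs IH] //= fg; apply: lerD.
  by rewrite ler_wpM2l // IH // => y yx; rewrite fg // inE yx orbT.
by rewrite ler_wpM2l ?(ltW (learning_rate_gt0 _)) // fg // inE eqxx.
Qed.

Lemma avg_eq f g xs : {in xs, f =1 g} -> avg f xs = avg g xs.
Proof.
by move=> fg; apply: le_anti; rewrite !avg_le // => x /fg ->.
Qed.

Lemma avg_ge0 f xs : {in xs, forall x, 0 <= f x} -> 0 <= avg f xs.
Proof.
move=> f0; have <- : avg (fun=> 0) xs = 0 by elim: xs {f0} => //= x xs ->; ring.
exact: avg_le.
Qed.

(** The newest element has the largest weight: by [learning_rate_step], a weight at most [alpha t]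
    is discounted to one at most [alpha t.+1]. *)
Lemma avg_le_sum f xs : {in xs, forall x, 0 <= f x} ->
  avg f xs <= alpha (size xs) * \sum_(x <- xs) f x.
Proof.
elim: xs => [|x xs IH] f0; first by rewrite big_nil mulr0.
have f0' : {in xs, forall x, 0 <= f x} by move=> y yx; rewrite f0 // inE yx orbT.
rewrite big_cons mulrDr addrC [avg _ _]/= lerD2r.
have s0 : 0 <= \sum_(y <- xs) f y by rewrite big_seq sumr_ge0.
case: xs IH f0 f0' s0 => [|y xs] IH f0 f0' s0; first by rewrite big_nil !mulr0.
apply: le_trans (_ : (1 - alpha (size (x :: y :: xs))) *
   (alpha (size (y :: xs)) * \sum_(j <- y :: xs) f j) <= _).
  by rewrite ler_wpM2l // IH.
by rewrite mulrA ler_wpM2r // learning_rate_step.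
Qed.

Lemma avg_weight f xs :
  avg f xs = decay (size xs) * isum (fun t x => weight t * f x) xs.
Proof.
elim: xs => [|x xs IH]; first by rewrite mulr0.
rewrite avg_cons IH [isum _ (_ :: _)]/= mulrDr; congr (_ + _); last first.
  by rewrite mulrA /weight mulrCA mulfV ?mulr1 // gt_eqF // decay_gt0.
case: xs {IH} => [|y xs]; first by rewrite !mulr0.
set n := size (y :: xs).
have -> : decay (size (x :: y :: xs)) = decay n * (1 - alpha n.+1) by [].
by ring.
Qed.

(** Each squared weight is at most the largest weight times itself. The quadratic term of the tail
    bound thereby becomes an ordinary average with a factor of order H/t. *)
Lemma decay_sqr_isum_le f xs : {in xs, forall x, 0 <= f x} ->
  decay (size xs) ^+ 2 * isum (fun t x => weight t ^+ 2 * f x) xs <=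
  alpha (size xs) * avg f xs.
Proof.
elim: xs => [|x xs IH] f0; first by rewrite !mulr0.
have f0' : {in xs, forall x, 0 <= f x} by move=> y yx; rewrite f0 // inE yx orbT.
rewrite [isum _ (_ :: _)]/= avg_cons !mulrDr; apply: lerD; last first.
  rewrite mulrA -exprMn /weight [decay _ * _]mulrC divfK ?gt_eqF ?decay_gt0 //.
  by rewrite expr2 mulrA.
have a0 := avg_ge0 f0'.
case: xs IH f0 f0' a0 => [|y xs] IH f0 f0' a0; first by rewrite !mulr0.
have {IH} := IH f0'; set n := size (y :: xs).
have -> : decay (size (x :: y :: xs)) = decay n * (1 - alpha n.+1) by [].
have -> : size (x :: y :: xs) = n.+1 by [].
move: (avg f _) (isum _ _) a0 => a s a0 IH.
apply: le_trans (_ : (1 - alpha n.+1) ^+ 2 * (alpha n * a) <= _).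
  by rewrite exprMn mulrAC mulrC ler_wpM2l ?sqr_ge0.
have -> : (1 - alpha n.+1) ^+ 2 * (alpha n * a) =
  ((1 - alpha n.+1) * a) * ((1 - alpha n.+1) * alpha n) by ring.
rewrite mulrC ler_wpM2r //; first by rewrite mulr_ge0.
exact: learning_rate_step.
Qed.

(* In the limit this says that the weights with which a fixed element enters
   the later averages add up to [1 + 1/H]. *)
Lemma tsum_avg f xs :
  tsum (avg f) xs + (1 + (size xs)%:R / H%:R) * avg f xs =
  (1 + H%:R^-1) * \sum_(x <- xs) f x.
Proof.
elim: xs => [|x xs IH]; first by rewrite big_nil /= !mulr0 addr0.
rewrite big_cons [RHS]mulrDr -IH [tsum _ (_ :: _)]/= avg_cons learning_rateE.
rewrite [size (_ :: _)]/= -natr1; field.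
by rewrite gt_eqF //= gt_eqF //; have := HR0; have := ler0n R (size xs); lra.
Qed.

Lemma tsum_avg_le f xs : {in xs, forall x, 0 <= f x} ->
  tsum (avg f) xs <= (1 + H%:R^-1) * \sum_(x <- xs) f x.
Proof.
move=> f0; rewrite -tsum_avg lerDl mulr_ge0 ?avg_ge0 // addr_ge0 //.
by rewrite divr_ge0.
Qed.

End Avg.
End LearningRate.

(** * The noise of one table entry and the choice of its scale *)

Lemma dyadic_approx (R : realType) (y : R) (m : nat) :
  y <= 1 -> 2^-1 ^+ m <= y ->
  exists2 j, (j <= m)%N & y / 2 <= 2^-1 ^+ j <= y.
Proof.
move=> y1 ym; have ex : exists j, 2^-1 ^+ j <= y by exists m.
case: (ex_minnP ex) => j jy jmin; exists j; first exact: jmin.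
rewrite jy andbT; case: j jy jmin => [|j] jy jmin; first by rewrite expr0; lra.
have : ~~ (2^-1 ^+ j <= y) by apply/negP => /jmin; rewrite ltnn.
by rewrite -ltNge exprS => h; lra.
Qed.

Section Noise.
Variables (R : realType) (H : nat) (T : eqType).
Hypothesis H_gt0 : (0 < H)%N.
(** In use, [xs] lists the visits to one state-action pair, [w] is the table value at the successor,
    [q + x] its optimal value with mean [q], [phi] the excess of the former over the latter, and [B]
    is eta H. *)
Variables (w x phi : T -> R) (q B u : R) (xs : seq T).
Hypothesis xs_gt0 : (0 < size xs)%N.
Hypothesis wE : {in xs, forall z, w z = q + x z + phi z}.
Hypothesis phiB : {in xs, forall z, 0 <= phi z <= 2 * B}.
Hypothesis xB : {in xs, forall z, `|x z| <= 2 * B}.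

Local Notation t := (size xs).
Local Notation avg := (avg H).
Local Notation alpha := (learning_rate R H).

Definition emp_var (f : T -> R) (ys : seq T) : R :=
  (\sum_(z <- ys) f z ^+ 2) / (size ys)%:R -
  ((\sum_(z <- ys) f z) / (size ys)%:R) ^+ 2.

Lemma sum_sqr_sub (f : T -> R) (c : R) ys : (0 < size ys)%N ->
  \sum_(z <- ys) (f z - c) ^+ 2 =
  (size ys)%:R * (emp_var f ys + ((\sum_(z <- ys) f z) / (size ys)%:R - c) ^+ 2).
Proof.
move=> ys0; have n0 : (size ys)%:R != 0 :> R by rewrite pnatr_eq0 -lt0n.
rewrite /emp_var; under eq_bigr do rewrite sqrrB.
rewrite big_split /= sumrB sumrMnl -mulr_suml.
have -> : \sum_(z <- ys) c ^+ 2 = (size ys)%:R * c ^+ 2.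
  by rewrite big_const_seq count_predT iter_addr addr0 mulr_natl.
by field.
Qed.

Lemma emp_var_ge0 (f : T -> R) ys : (0 < size ys)%N -> 0 <= emp_var f ys.
Proof.
move=> ys0; have n0 : 0 < (size ys)%:R :> R by rewrite ltr0n.
rewrite -(pmulr_rge0 _ n0).
have := sum_sqr_sub f ((\sum_(z <- ys) f z) / (size ys)%:R) ys0.
rewrite subrr expr0n addr0 => <-.
by apply: sumr_ge0 => z _; apply: sqr_ge0.
Qed.

Lemma emp_var_le (f : T -> R) (c : R) ys : (0 < size ys)%N ->
  emp_var f ys <= (\sum_(z <- ys) (f z - c) ^+ 2) / (size ys)%:R.
Proof.
move=> ys0; have n0 : 0 < (size ys)%:R :> R by rewrite ltr0n.
by rewrite sum_sqr_sub // mulrAC mulfV ?gt_eqF // mul1r lerDl sqr_ge0.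
Qed.

Let HR0 : 0 < H%:R :> R. Proof. by rewrite ltr0n. Qed.
Let HR1 : 1 <= H%:R :> R. Proof. by rewrite ler1n. Qed.
Let t0 : 0 < t%:R :> R. Proof. by rewrite ltr0n. Qed.

(** With [m] the empirical mean of [w] and [c = m - q], one has [x - c = (w - m) - phi]. The first
    part gives the empirical variance, since no weight exceeds 2H/t; for the second,
    [phi ^+ 2 <= 2 * B * phi] keeps the bound linear in [phi]. Recentring costs at most the square
    of the average of [x]. *)
Lemma avg_sqr_le :
  avg (fun z => x z ^+ 2) xs <= avg x xs ^+ 2 + 4 * H%:R * emp_var w xs +
    4 * B * avg phi xs.
Proof.
pose m := (\sum_(z <- xs) w z) / t%:R.
pose N := avg x xs; pose c := m - q.
have h1 : avg (fun z => x z ^+ 2) xs <= N ^+ 2 + avg (fun z => (x z - c) ^+ 2) xs.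
  have -> : avg (fun z => (x z - c) ^+ 2) xs =
      avg (fun z => x z ^+ 2 + ((- 2 * c) * x z + c ^+ 2)) xs.
    by apply: avg_eq => // z _; ring.
  rewrite avgD avgD avgZ avg_cst // -/N.
  by have := sqr_ge0 (N - c); lra.
have h2 : avg (fun z => (x z - c) ^+ 2) xs <=
    2 * avg (fun z => (w z - m) ^+ 2) xs + 4 * B * avg phi xs.
  rewrite -!avgZ -avgD; apply: avg_le => // z zx.
  have /andP[p0 p1] := phiB zx; rewrite (wE zx).
  have := sqr_ge0 (x z - c + 2 * phi z).
  by have := mulr_ge0 p0 (_ : 0 <= 2 * B - phi z); rewrite subr_ge0 => /(_ p1); rewrite /c; nra.
have h3 : avg (fun z => (w z - m) ^+ 2) xs <= 2 * H%:R * emp_var w xs.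
  apply: le_trans (avg_le_sum H_gt0 _) _; first by move=> z _; apply: sqr_ge0.
  rewrite sum_sqr_sub // subrr expr0n addr0 mulrA ler_wpM2r ?emp_var_ge0 //.
  by rewrite -ler_pdivlMr // learning_rate_le.
by move: h1 h2 h3; rewrite /N; lra.
Qed.

Lemma avg_abs_le : `|avg x xs| <= 2 * B.
Proof.
rewrite ler_norml; apply/andP; split.
  rewrite -(avg_cst H_gt0 (- (2 * B)) xs_gt0); apply: avg_le => // z /xB.
  by rewrite ler_norml => /andP[].
rewrite -(avg_cst H_gt0 (2 * B) xs_gt0); apply: avg_le => // z /xB.
by rewrite ler_norml => /andP[].
Qed.

(* The N^2 that [avg_sqr_le] brings in is at most 2 B N, so the bound on [lam]
   lets the left-hand side take it in. *)
Lemma noise_le (lam : R) :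
  0 < B -> 0 < lam -> 0 <= u -> lam <= t%:R / (16 * B * H%:R ^+ 2) ->
  `|avg x xs| <= u / lam + lam * (alpha t * avg (fun z => x z ^+ 2) xs) ->
  `|avg x xs| <= 2 * u / lam + 12 * H%:R ^+ 2 * lam * (emp_var w xs / t%:R)
    + avg phi xs / H%:R.
Proof.
move=> B0 lam0 u0 lamB hN; have hs := avg_sqr_le; have hB := avg_abs_le.
set N := `|avg x xs| in hN hB *.
have N2 : avg x xs ^+ 2 = N ^+ 2 by rewrite /N real_normK ?num_real.
rewrite {}N2 in hs.
have N0 : 0 <= N by exact: normr_ge0.
have W0 := emp_var_ge0 w xs_gt0.
have p0 : 0 <= avg phi xs by apply: avg_ge0 => // z /phiB /andP[].
move: (emp_var w xs) (avg phi xs) (avg (fun z => x z ^+ 2) xs) W0 p0 hs hN => W P A W0 P0 hs hN.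
have a0 : 0 < alpha t by apply: learning_rate_gt0.
have aH := learning_rate_le R H_gt0 xs_gt0.
have la0 : 0 < lam * alpha t by rewrite mulr_gt0.
have la : lam * alpha t <= (8 * B * H%:R)^-1.
  apply: le_trans (_ : t%:R / (16 * B * H%:R ^+ 2) * (2 * H%:R / t%:R) <= _).
    by rewrite ler_pM // ltW.
  rewrite le_eqVlt; apply/orP; left; apply/eqP; field.
  by rewrite !gt_eqF.
have la1 : lam * alpha t * (8 * B * H%:R) <= 1.
  by rewrite -ler_pdivlMr ?mul1r // !mulr_gt0.
have u1 : 0 <= u / lam by rewrite divr_ge0 // ltW.
have laB : lam * alpha t * (8 * B) <= 1.
  apply: le_trans la1; rewrite ler_pM2l // ler_peMr // ltW // mulr_gt0 //; lra.
have e1 : lam * alpha t * N ^+ 2 <= N / 4.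
  have : lam * alpha t * N ^+ 2 <= lam * alpha t * (2 * B) * N.
    by rewrite expr2 [leLHS]mulrA ler_wpM2r // ler_pM2l.
  have : lam * alpha t * (2 * B) * N <= 1 / 4 * N by rewrite ler_wpM2r //; lra.
  by lra.
have e2 : lam * alpha t * (4 * B * P) <= P / H%:R / 2.
  have : lam * alpha t * (4 * B) <= (2 * H%:R)^-1.
    by rewrite -[leRHS]mul1r ler_pdivlMr ?mulr_gt0 //; lra.
  move/(ler_wpM2r P0); rewrite invfM; lra.
have e3 : lam * alpha t * (4 * H%:R * W) <= 8 * H%:R ^+ 2 * lam * (W / t%:R).
  have -> : 8 * H%:R ^+ 2 * lam * (W / t%:R) = lam * (2 * H%:R / t%:R) * (4 * H%:R * W) by ring.
  by rewrite ler_wpM2r ?mulr_ge0 ?(ltW HR0) // ler_pM2l.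
have e4 : lam * (alpha t * A) <= lam * alpha t * (N ^+ 2 + 4 * H%:R * W + 4 * B * P).
  by rewrite mulrA ler_pM2l.
have e5 : 0 <= 8 * H%:R ^+ 2 * lam * (W / t%:R).
  by rewrite !mulr_ge0 ?exprn_ge0 ?invr_ge0 ?(ltW lam0).
have e6 : 0 <= P / H%:R by rewrite divr_ge0.
lra.
Qed.

(** The scale [s] balances [u / lam] against [lam * H^2 * Wp / t]; both then equal [r]. The cap
    [lmax] keeps to the range of [noise_le] and produces the term of order 1/t. The summand [e],
    which will be the eta H inside the bonus, keeps [Wp] positive, so that [s] makes sense. *)
Lemma noise_bound (m : nat) (e : R) :
  1 <= B -> 1 <= u -> 0 < e -> emp_var w xs + e <= 2 * B ^+ 2 ->
  2^-1 ^+ m <= (t%:R ^+ H.+1)^-1 / (16 * B * H%:R ^+ 2) ->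
  (forall j, (j <= m)%N -> 2^-1 ^+ j * weight R H t * (8 * B) <= 1 ->
    2^-1 ^+ j * `|isum (fun i z => weight R H i * x z) xs| -
    (2^-1 ^+ j) ^+ 2 * isum (fun i z => weight R H i ^+ 2 * x z ^+ 2) xs <= u) ->
  `|avg x xs| <= 16 * Num.sqrt (u * H%:R ^+ 2 * (emp_var w xs + e) / t%:R)
    + 64 * u * B * H%:R ^+ 2 / t%:R + avg phi xs / H%:R.
Proof.
move=> B1 u1 e0 WB hm hgrid.
have B0 : 0 < B by lra.
have u0 : 0 < u by lra.
set W := emp_var w xs in WB *.
have W0 : 0 <= W := emp_var_ge0 w xs_gt0.
set Wp := W + e in WB *; have Wp0 : 0 < Wp by rewrite /Wp; lra.
pose lmax := t%:R / (16 * B * H%:R ^+ 2).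
have BH0 : 0 < 16 * B * H%:R ^+ 2 by rewrite !mulr_gt0 ?exprn_gt0.
have lmax0 : 0 < lmax by rewrite divr_gt0.
pose s := Num.sqrt (u * t%:R / (H%:R ^+ 2 * Wp)).
have s0 : 0 < s by rewrite sqrtr_gt0 divr_gt0 ?mulr_gt0 ?exprn_gt0.
set r := Num.sqrt (u * H%:R ^+ 2 * Wp / t%:R).
have r0 : 0 < r by rewrite sqrtr_gt0 divr_gt0 ?mulr_gt0 ?exprn_gt0.
have sr : s * r = u.
  rewrite -sqrtrM ?divr_ge0 ?mulr_ge0 ?exprn_ge0 ?(ltW u0) ?(ltW Wp0) //.
  have -> : u * t%:R / (H%:R ^+ 2 * Wp) * (u * H%:R ^+ 2 * Wp / t%:R) = u ^+ 2.
    by field; rewrite !gt_eqF.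
  by rewrite sqrtr_sqr ger0_norm // ltW.
have rs : H%:R ^+ 2 * Wp / t%:R = r / s.
  apply: (mulfI (lt0r_neq0 u0)); rewrite -{2}sr.
  have -> : s * r * (r / s) = r ^+ 2 by field; rewrite gt_eqF.
  by rewrite sqr_sqrtr ?divr_ge0 ?mulr_ge0 ?exprn_ge0 ?(ltW u0) ?(ltW Wp0) // !mulrA.
pose lst := Num.min lmax s.
have lst0 : 0 < lst by rewrite lt_min lmax0 s0.
have D0 := decay_gt0 R H_gt0 t.
(* As [Wp] is at most 2 B^2, the target scale has a lower bound that does not depend on the data;
   times the least decay, this is what [m] halvings have to reach. *)
have slow : (16 * B * H%:R ^+ 2)^-1 <= s.
  have -> : (16 * B * H%:R ^+ 2)^-1 = Num.sqrt ((16 * B * H%:R ^+ 2)^-1 ^+ 2).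
    by rewrite sqrtr_sqr ger0_norm // invr_ge0 ltW.
  rewrite ler_wsqrtr // expr2 -invfM -[leLHS]mul1r; apply: ler_pM => //.
  - by rewrite invr_ge0 ltW // mulr_gt0.
  - have : 1 <= t%:R :> R by rewrite ler1n.
    by move=> t1; nra.
  rewrite lef_pV2 ?posrE ?mulr_gt0 ?exprn_gt0 //.
  apply: le_trans (_ : H%:R ^+ 2 * (2 * B ^+ 2) <= _).
    by rewrite ler_pM2l // exprn_gt0.
  have : H%:R ^+ 2 * B ^+ 2 <= H%:R ^+ 2 * B ^+ 2 * H%:R ^+ 2.
    by apply: ler_peMr; [by apply: mulr_ge0; apply: sqr_ge0|exact: exprn_ege1].
  have : 0 <= H%:R ^+ 2 * B ^+ 2 * H%:R ^+ 2.
    by apply: mulr_ge0; [apply: mulr_ge0|]; apply: sqr_ge0.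
  by lra.
have [j jm /andP[jl ju]] : exists2 j, (j <= m)%N &
    lst * decay R H t / 2 <= 2^-1 ^+ j <= lst * decay R H t.
  apply: dyadic_approx.
    apply: le_trans (_ : lmax * t%:R^-1 <= _).
      by apply: ler_pM; rewrite ?(ltW lst0) ?(ltW D0) ?ge_min ?lexx // decay_le.
    rewrite /lmax mulrAC mulfV ?gt_eqF // mul1r invf_le1 //.
    have : 1 <= H%:R ^+ 2 :> R by exact: exprn_ege1.
    by move=> h; nra.
  apply: le_trans hm _; rewrite mulrC; apply: ler_pM.
  - by rewrite invr_ge0 ltW.
  - by rewrite invr_ge0 exprn_ge0.
  - rewrite le_min slow andbT /lmax; apply: ler_peMl; last by rewrite ler1n.
    by rewrite invr_ge0 ltW.
  - by rewrite decay_ge.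
set th := 2^-1 ^+ j in jl ju.
have th0 : 0 < th by rewrite exprn_gt0 // invr_gt0 ltr0n.
pose lam := th / decay R H t.
have lam0 : 0 < lam by rewrite divr_gt0.
have lamu : lam <= lst by rewrite ler_pdivrMr.
have laml : lst / 2 <= lam by rewrite ler_pdivlMr // mulrAC.
have thE : th = lam * decay R H t by rewrite /lam divfK // gt_eqF.
have lam_max : lam <= lmax by apply: le_trans lamu _; rewrite ge_min lexx.
have hN : `|avg x xs| <= u / lam + lam * (alpha t * avg (fun z => x z ^+ 2) xs).
  (* The last weight at scale [th] is [lam * alpha t], and [lmax * (2H/t) * 8B] is 1/H. *)
  have cond : 2^-1 ^+ j * weight R H t * (8 * B) <= 1.
    rewrite -/th thE /weight.
    have -> : lam * decay R H t * (alpha t / decay R H t) * (8 * B) =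
       lam * alpha t * (8 * B) by field; rewrite gt_eqF.
    apply: le_trans (_ : lmax * (2 * H%:R / t%:R) * (8 * B) <= _).
      rewrite ler_wpM2r ?mulr_ge0 ?(ltW B0) //; apply: ler_pM => //.
      - exact: ltW.
      - exact/ltW/learning_rate_gt0.
      - exact: learning_rate_le.
    have -> : lmax * (2 * H%:R / t%:R) * (8 * B) = H%:R^-1.
      by rewrite /lmax; field; rewrite !gt_eqF.
    by rewrite invf_le1.
  have := hgrid j jm cond; rewrite -/th.
  have := decay_sqr_isum_le (xs := xs) H_gt0 (f := fun z => x z ^+ 2) (fun z _ => sqr_ge0 _).
  move=> hQ hL; rewrite (avg_weight H_gt0 x) normrM (ger0_norm (ltW D0)).
  move: hQ hL; set L := `|isum _ _|; set Q := isum _ _; set A := avg _ _ => hQ hL.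
  have -> : decay R H t * L = (th * L) / lam by rewrite thE; field; rewrite gt_eqF.
  apply: le_trans (_ : (u + th ^+ 2 * Q) / lam <= _).
    by rewrite ler_pM2r ?invr_gt0 //; lra.
  rewrite mulrDl lerD2l.
  have -> : th ^+ 2 * Q / lam = lam * (decay R H t ^+ 2 * Q).
    by rewrite thE; field; rewrite gt_eqF.
  by rewrite ler_pM2l.
have := noise_le B0 lam0 (ltW u0) lam_max hN.
(* The dyadic scale may be half the target, which turns 2 into 4. Together with the 12 r of [f4]
   this makes the 16 of the statement, and 4 u / lmax is the term with 64. *)
have f1 : 2 * u / lam <= 4 * u / lmax + 4 * u / s.
  apply: le_trans (_ : 2 * u / (lst / 2) <= _).
    by rewrite ler_wpM2l ?mulr_ge0 ?(ltW u0) // lef_pV2 ?posrE ?divr_gt0.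
  have -> : 2 * u / (lst / 2) = 4 * u / lst by field; rewrite gt_eqF.
  have p1 : 0 <= 4 * u / lmax by rewrite (divr_ge0 _ (ltW lmax0)) // mulr_ge0 ?(ltW u0).
  have p2 : 0 <= 4 * u / s by rewrite (divr_ge0 _ (ltW s0)) // mulr_ge0 ?(ltW u0).
  by rewrite /lst; case: (leP lmax s) => _; lra.
have f2 : 4 * u / s = 4 * r by rewrite -sr; field; rewrite gt_eqF.
have f3 : 4 * u / lmax = 64 * u * B * H%:R ^+ 2 / t%:R.
  by rewrite /lmax; field; rewrite !gt_eqF.
have f4 : 12 * H%:R ^+ 2 * lam * (W / t%:R) <= 12 * r.
  apply: le_trans (_ : 12 * s * (H%:R ^+ 2 * Wp / t%:R) <= _).
    have -> : 12 * H%:R ^+ 2 * lam * (W / t%:R) = 12 * lam * (H%:R ^+ 2 * W / t%:R) by ring.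
    apply: ler_pM.
    - by rewrite mulr_ge0 // ltW.
    - by apply: divr_ge0; rewrite ?ler0n //; apply: mulr_ge0; rewrite ?sqr_ge0.
    - by rewrite ler_pM2l //; apply: le_trans lamu _; rewrite ge_min lexx orbT.
    - by rewrite ler_pM2r ?invr_gt0 // ler_pM2l ?exprn_gt0 // /Wp; lra.
  have -> : 12 * s * (H%:R ^+ 2 * Wp / t%:R) = 12 * r by rewrite rs; field; rewrite gt_eqF.
  exact: lexx.
by rewrite -/W; move: f1 f4; rewrite f2 f3; lra.
Qed.

End Noise.

(** * Tables as functions of the visits *)

Section Tables.
Variables (R : realType) (S A : finType) (H I : nat) (M : pcmdp R S A H I).
Variables (xi eta ell c1 c2 : R).
Variable tie : seq (obs S H) -> 'I_H -> S -> (A -> R) -> A.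

Local Notation step := (step_update M xi eta ell c1 c2).
Local Notation after := (tables_after M xi eta ell c1 c2 tie).
Local Notation grd := (greedy M xi eta ell c1 c2 tie).
Local Notation alpha := (learning_rate R H).
Local Notation next := (@next_epoch H).
Local Notation this := (@this_epoch H).

(** Everything that an update at epoch [h] writes. The only other thing it reads is the row of
    [tabW] for the next epoch. *)
Definition table_row (D : tables R S A H) (h : 'I_H) :=
  (tabQ D h, tabW D (this h), tabN D h, tabmu D h, tabsigma D h, tabbeta D h).

Lemma upd_same V (F : 'I_H -> S -> A -> V) h s a v :
  upd F h s a v h = fun s' a' => if (s', a') == (s, a) then v else F h s' a'.
Proof.
by apply/funext => s'; apply/funext => a'; rewrite /upd !xpair_eqE eqxx.
Qed.

Lemma upd_other V (F : 'I_H -> S -> A -> V) h h' s a v : h' != h ->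
  upd F h s a v h' = F h'.
Proof.
move=> /negbTE hh; apply/funext => s'; apply/funext => a'.
by rewrite /upd !xpair_eqE hh.
Qed.

Lemma step_update_row D D' h s a s' :
  table_row D h = table_row D' h -> tabW D (next h) = tabW D' (next h) ->
  table_row (step D h s a s') h = table_row (step D' h s a s') h.
Proof.
case: D => Q1 W1 N1 m1 g1 b1; case: D' => Q2 W2 N2 m2 g2 b2.
rewrite /table_row /= => -[Qe We Ne me ge be] Wn.
rewrite !upd_same Qe Ne me ge be Wn; congr (_, _, _, _, _, _).
apply/funext => s1; rewrite /updW; congr (if _ then _ else _).
by rewrite We.
Qed.

Lemma step_update_other D h h' s a s' : h' != h ->
  table_row (step D h s a s') h' = table_row D h'.
Proof.
move=> hh; rewrite /table_row /=.
set W := updW _ _ _ _ _; rewrite !upd_other //.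
have -> // : W = tabW D (this h').
apply/funext => s1; rewrite /W /updW xpair_eqE.
by rewrite -(inj_eq val_inj) /= (inj_eq val_inj) (negbTE hh).
Qed.

Lemma step_update_tabW D h j s a s' : j != this h ->
  tabW (step D h s a s') j = tabW D j.
Proof.
by move=> /negbTE jh; apply/funext => s1; rewrite /= /updW xpair_eqE jh.
Qed.

(** Epochs are processed upwards: when [h] is updated, the values of epoch h + 1 are still those of
    the start of the episode, and no other epoch writes row [h]. So an episode acts on each row as a
    single step from the tables at its start. *)
Lemma foldl_step_row (st : 'I_H -> S) (ac : 'I_H -> A) (ns : 'I_H -> S) l D h :
  sorted (fun i j : 'I_H => (i < j)%N) l ->
  table_row (foldl (fun D' h => step D' h (st h) (ac h) (ns h)) D l) h =
  if h \in l then table_row (step D h (st h) (ac h) (ns h)) h else table_row D h.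
Proof.
elim: l D => [|h0 l IH] D //= lS.
have tr : transitive (fun i j : 'I_H => (i < j)%N).
  by move=> i j k; apply: ltn_trans.
have hmin := order_path_min tr lS.
rewrite IH ?(path_sorted lS) // inE; case: (eqVneq h h0) => [->|hh] /=.
  by case: ifPn => // /(allP hmin); rewrite ltnn.
case: ifPn => [hl|_]; last exact: step_update_other.
apply: step_update_row; first exact: step_update_other.
apply: step_update_tabW; rewrite -(inj_eq val_inj) /= /bump /= add1n.
by have /= lt := allP hmin _ hl; rewrite gtn_eqF // ltnS ltnW.
Qed.

Lemma foldl_step_max (st : 'I_H -> S) (ac : 'I_H -> A) (ns : 'I_H -> S) l D :
  tabW (foldl (fun D' h => step D' h (st h) (ac h) (ns h)) D l) ord_max =
  tabW D ord_max.
Proof.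
elim: l D => [|h l IH] D //=; rewrite IH step_update_tabW //.
by rewrite -(inj_eq val_inj) /= gtn_eqF.
Qed.

Lemma sorted_enum_ord n : sorted (fun i j : 'I_n => (i < j)%N) (enum 'I_n).
Proof.
by have := iota_ltn_sorted 0 n; rewrite -val_enum_ord sorted_map.
Qed.

Lemma after_row p o h :
  table_row (after (o :: p)) h =
  table_row (step (after p) h (state_at M o h) (grd p h (state_at M o h)) (o h)) h.
Proof.
have := foldl_step_row (state_at M o) (fun h => grd p h (state_at M o h)) o
  (after p) h (sorted_enum_ord H).
by rewrite mem_enum inE => <-.
Qed.

Lemma after_tabW_max p s : tabW (after p) ord_max s = 0.
Proof.
elim: p => [|o p IH] /=; first by rewrite eqxx.
rewrite -[RHS]IH; apply: (congr1 (fun f => f s)).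
exact: (foldl_step_max (state_at M o) (fun h => grd p h (state_at M o h)) o).
Qed.

Definition visit (p : seq (obs S H)) (o : obs S H) h s a :=
  (state_at M o h == s) && (grd p h s == a).

(** Each visit keeps the history before its episode, because the value fed into the update is read
    from the tables of that time. *)
Fixpoint visits (p : seq (obs S H)) h s a : seq (seq (obs S H) * obs S H) :=
  if p is o :: q then
    if visit q o h s a then (q, o) :: visits q h s a else visits q h s a
  else [::].

Definition next_value h (x : seq (obs S H) * obs S H) : R :=
  tabW (after x.1) (next h) (x.2 h).

Definition bonus p h s a : R := tabbeta (after p) h s a (tabN (after p) h s a).

Lemma visitE p o h s a :
  ((s, a) == (state_at M o h, grd p h (state_at M o h))) = visit p o h s a.
Proof.
rewrite xpair_eqE /visit eq_sym; case: eqP => //= <-.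
by rewrite eq_sym.
Qed.

Lemma table_rowP D D' h : table_row D h = table_row D' h ->
  [/\ forall s a, tabQ D h s a = tabQ D' h s a,
      forall s, tabW D (this h) s = tabW D' (this h) s,
      forall s a, tabN D h s a = tabN D' h s a,
      forall s a, tabmu D h s a = tabmu D' h s a &
      forall s a, tabsigma D h s a = tabsigma D' h s a] /\
  forall s a t, tabbeta D h s a t = tabbeta D' h s a t.
Proof. by case=> -> -> -> -> -> ->. Qed.

Lemma tabN_after p h s a : tabN (after p) h s a = size (visits p h s a).
Proof.
elim: p => [|o p IH] //; have [[_ _ -> _ _] _] := table_rowP (after_row p o h).
rewrite /= upd_same visitE; case: ifP => //= v.
by move: v; rewrite -visitE => /eqP[<- <-]; rewrite IH.
Qed.

Lemma tabmu_after p h s a :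
  tabmu (after p) h s a = \sum_(x <- visits p h s a) next_value h x.
Proof.
elim: p => [|o p IH]; first by rewrite /= big_nil.
have [[_ _ _ -> _] _] := table_rowP (after_row p o h).
rewrite /= upd_same visitE; case: ifP => //= v.
by move: v; rewrite -visitE => /eqP[<- <-]; rewrite IH big_cons addrC.
Qed.

Lemma tabsigma_after p h s a :
  tabsigma (after p) h s a = \sum_(x <- visits p h s a) next_value h x ^+ 2.
Proof.
elim: p => [|o p IH]; first by rewrite /= big_nil.
have [[_ _ _ _ ->] _] := table_rowP (after_row p o h).
rewrite /= upd_same visitE; case: ifP => //= v.
by move: v; rewrite -visitE => /eqP[<- <-]; rewrite IH big_cons addrC.
Qed.

Lemma bonusE p h s a : bonus p h s a =
  if (0 < size (visits p h s a))%N then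
    bonus_beta S A H eta ell c1 c2 (tabN (after p) h s a)
      (tabmu (after p) h s a) (tabsigma (after p) h s a)
  else 0.
Proof.
rewrite /bonus; elim: p => [|o p IH] //.
have [[_ _ EN Em Es] Eb] := table_rowP (after_row p o h).
rewrite Eb EN Em Es /= !upd_same visitE; case: ifP => v //.
by move: v; rewrite -visitE => /eqP[<- <-]; rewrite eqxx.
Qed.

(** The bonus increments are built so that their weighted average is exactly half the current bonus.
    As the first learning rate is 1, the initial value survives only at unvisited pairs. *)
Lemma tabQ_after (H_gt0 : (0 < H)%N) p h s a :
  tabQ (after p) h s a =
  if (0 < size (visits p h s a))%N then
    mod_reward M xi eta s a + avg H (next_value h) (visits p h s a) +
      bonus p h s a / 2
  else eta * H%:R.
Proof.
elim: p => [|o p IH] //.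
have [[EQ _ EN _ _] Eb] := table_rowP (after_row p o h).
rewrite /bonus EQ EN Eb /= !upd_same visitE; case: ifP => v //.
move: v; rewrite -visitE => /eqP[<- <-]; rewrite eqxx IH tabN_after /=.
rewrite -/(bonus_beta _ _ _ _ _ _ _ _ _ _).
set b := bonus_beta _ _ _ _ _ _ _ _ _ _.
have a0 := lt0r_neq0 (learning_rate_gt0 R H_gt0 (size (visits p h s a)).+1).
have -> : tabbeta (after p) h s a (size (visits p h s a)) = bonus p h s a.
  by rewrite /bonus tabN_after.
rewrite /next_value /=; case: ifPn => n0.
  by field.
have -> : visits p h s a = [::] by apply/eqP; rewrite -size_eq0 -leqn0 leqNgt.
by rewrite /= learning_rate1 // bonusE; field.
Qed.

End Tables.

(** * Optimal values for the penalized reward *)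

Section Optimal.
Variables (R : realType) (S A : finType) (H I : nat) (M : pcmdp R S A H I).
Variables (rho : S -> A -> R) (a0 : A).

Local Notation next := (@next_epoch H).
Local Notation this := (@this_epoch H).

Definition backup (V : S -> R) h s a : R :=
  rho s a + \sum_s' trans M h s a s' * V s'.

(* [n] is the number of remaining epochs. *)
Fixpoint opt_rec n (s : S) : R :=
  if n is n'.+1 then
    if (insub n' : option 'I_H) is Some i then
      \big[Num.max/backup (opt_rec n') (rev_ord i) s a0]_a
         backup (opt_rec n') (rev_ord i) s a
    else 0
  else 0.

Definition optV (j : 'I_H.+1) s : R := opt_rec (H - j) s.

Definition meanV (h : 'I_H) s a : R := \sum_s' trans M h s a s' * optV (next h) s'.

Definition optQ h s a : R := rho s a + meanV h s a.

Definition gap h s a : R := optV (this h) s - optQ h s a.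

Lemma optV_max s : optV ord_max s = 0.
Proof. by rewrite /optV /= subnn. Qed.

Lemma optVE h s :
  optV (this h) s = \big[Num.max/optQ h s a0]_a optQ h s a.
Proof.
have nE : (H - this h)%N = (H - h.+1).+1 by rewrite /= subnSK.
rewrite /optV nE /=.
have lt : (H - h.+1 < H)%N by rewrite subnSK // leq_subr.
rewrite (insubT (fun n => (n < H)%N) lt).
have -> : rev_ord (Sub (H - h.+1)%N lt) = h.
  by apply: val_inj; rewrite /= subnSK // subKn // ltnW.
by rewrite /optQ /meanV /backup /optV /= /bump leq0n add1n.
Qed.

Lemma optQ_le h s a : optQ h s a <= optV (this h) s.
Proof. by rewrite optVE; apply: le_bigmax. Qed.

Lemma optV_le h s c : (forall a, optQ h s a <= c) -> optV (this h) s <= c.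
Proof. by move=> hc; rewrite optVE; apply: bigmax_le. Qed.

Lemma gap_ge0 h s a : 0 <= gap h s a.
Proof. by rewrite subr_ge0 optQ_le. Qed.

Section Bounds.
Variable e : R.
Hypothesis rhoB : forall s a, `|rho s a| <= e.

Let e0 : 0 <= e.
Proof. by apply: le_trans (rhoB (start M) a0); apply: normr_ge0. Qed.

Lemma mean_norm_le h s a (V : S -> R) c : (forall s', `|V s'| <= c) ->
  `|\sum_s' trans M h s a s' * V s'| <= c.
Proof.
move=> Vc; apply: le_trans (ler_norm_sum _ _ _) _.
have [P0 P1] := transP M h s a.
rewrite -[leRHS]mul1r -P1 mulr_suml; apply: ler_sum => s' _.
by rewrite normrM ger0_norm // ler_wpM2l.
Qed.

Lemma opt_rec_norm_le n s : `|opt_rec n s| <= e * n%:R.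
Proof.
elim: n s => [|n IH] s /=; first by rewrite normr0 mulr0.
have en : 0 <= e * n.+1%:R by rewrite mulr_ge0.
case: insub => [i|]; last by rewrite normr0.
have bQ a : `|backup (opt_rec n) (rev_ord i) s a| <= e * n.+1%:R.
  apply: le_trans (ler_normD _ _) _; rewrite -natr1 mulrDr mulr1 addrC.
  by apply: lerD; [exact: mean_norm_le|exact: rhoB].
rewrite ler_norml; apply/andP; split.
  apply: le_trans (le_bigmax _ _ a0).
  by have := bQ a0; rewrite ler_norml => /andP[].
have bQ' a : backup (opt_rec n) (rev_ord i) s a <= e * n.+1%:R.
  by have := bQ a; rewrite ler_norml => /andP[].
by apply: bigmax_le => [|a _]; exact: bQ'.
Qed.

Lemma optV_norm_le j s : `|optV j s| <= e * H%:R.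
Proof.
apply: le_trans (opt_rec_norm_le _ _) _.
by rewrite ler_wpM2l // ler_nat leq_subr.
Qed.

Lemma meanV_norm_le h s a : `|meanV h s a| <= e * H%:R.
Proof. by apply: mean_norm_le => s'; exact: optV_norm_le. Qed.

Lemma optQ_norm_le h s a : `|optQ h s a| <= e * H%:R.
Proof.
apply: le_trans (ler_normD _ _) _.
apply: le_trans (_ : e + e * (H - next h)%:R <= _).
  apply: lerD; first exact: rhoB.
  by apply: mean_norm_le => s'; exact: opt_rec_norm_le.
rewrite -[X in X + _]mulr1 -mulrDr ler_wpM2l // -mulrS ler_nat.
by rewrite /= /bump leq0n add1n subnSK // leq_subr.
Qed.

Lemma gap_le h s a : gap h s a <= 2 * (e * H%:R).
Proof.
rewrite /gap; have := optQ_norm_le h s a; have := optV_norm_le (this h) s.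
by rewrite !ler_norml => /andP[_ ?] /andP[? _]; lra.
Qed.

End Bounds.

(** The state at each of the H + 1 times, so that functions on ['I_H.+1] such as [tabW] and [optV]
    can be followed along an episode and telescoped. *)
Definition path_at (o : obs S H) (j : 'I_H.+1) : S :=
  if unlift ord0 j is Some h then o h else start M.

Lemma path_at_next (o : obs S H) h : path_at o (next h) = o h.
Proof. by rewrite /path_at /next_epoch liftK. Qed.

Lemma path_at_this (o : obs S H) h : path_at o (this h) = state_at M o h.
Proof.
rewrite /path_at /state_at; case: ifPn => [/eqP h0|h0].
  by rewrite (_ : this h = ord0) ?unlift_none //; apply: val_inj.
have -> : this h = lift ord0 (ord_pred h).
  apply: val_inj; case: h h0 => [[//|m]] /= mn _; rewrite /bump /= add1n.
  by rewrite modnDr modn_small // ltnW.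
by rewrite liftK.
Qed.

Lemma path_at0 (o : obs S H) : path_at o ord0 = start M.
Proof. by rewrite /path_at unlift_none. Qed.

Lemma telescope_path (f : 'I_H.+1 -> S -> R) (o : obs S H) :
  \sum_(h < H) (f (next h) (o h) - f (this h) (state_at M o h)) =
  f ord_max (path_at o ord_max) - f ord0 (start M).
Proof.
pose g j := f j (path_at o j).
have e1 : \sum_j g j = \sum_(h < H) f (this h) (state_at M o h) + g ord_max.
  rewrite big_ord_recr /=; congr (_ + _).
  by apply: eq_bigr => h _; rewrite /g path_at_this.
have e2 : \sum_j g j = g ord0 + \sum_(h < H) f (next h) (o h).
  rewrite big_ord_recl /=; congr (_ + _).
  by apply: eq_bigr => h _; rewrite /g path_at_next.
have g0 : g ord0 = f ord0 (start M) by rewrite /g path_at0.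
rewrite sumrB; move: e1; rewrite e2 g0 /g; lra.
Qed.

(** The increments of [optV] along a trajectory add up to minus its initial value, and by Bellman's
    inequality reward plus increment has nonpositive conditional mean at every epoch. *)
Lemma Etraj_reward_le pi : is_policy pi ->
  Etraj M pi (fun w => \sum_(h < H) at_epoch M rho h w) <= optV ord0 (start M).
Proof.
move=> piP; rewrite -subr_le0 -[X in _ - X](Etraj_cst M _ piP).
rewrite -mulN1r -Etraj_scale -EtrajD.
rewrite (_ : (fun w => _) = (fun w : traj S A H => \sum_(h < H)
    (rho (state_at M w.2 h) (w.1 h) +
     (optV (next h) (w.2 h) - optV (this h) (state_at M w.2 h))))).
  rewrite Etraj_sum; apply: sumr_le0 => h _.
  apply: (Etraj_le0 (c := fun s a s' => rho s a + (optV (next h) s' - optV (this h) s))) => // s a.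
  have [P0 P1] := transP M h s a.
  under eq_bigr do rewrite addrCA mulrDr.
  rewrite big_split /= -mulr_suml P1 mul1r -/(meanV h s a).
  by have := optQ_le h s a; rewrite /optQ; lra.
apply/funext => w; rewrite [RHS]big_split /= telescope_path optV_max sub0r.
by rewrite mulN1r.
Qed.

(** The performance difference identity: the same telescoping, where the conditional mean of reward
    plus increment is now exactly minus the gap of the action played. *)
Lemma perf_diff d :
  optV ord0 (start M) -
    Etraj M (det_policy R d) (fun w => \sum_(h < H) at_epoch M rho h w) =
  \sum_o ep_prob M d o * \sum_(h < H) gap h (state_at M o h) (d h (state_at M o h)).
Proof.
have [_ ep1] := ep_prob_dist M d.
rewrite Etraj_sum; under eq_bigr do rewrite Etraj_det.
rewrite exchange_big /=.
have -> : optV ord0 (start M) = \sum_o ep_prob M d o * optV ord0 (start M).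
  by rewrite -mulr_suml ep1 mul1r.
rewrite -sumrB; under [X in X = _]eq_bigr => o _ do rewrite -mulr_sumr -mulrBr.
apply/eqP; rewrite -subr_eq0 -sumrB; apply/eqP.
transitivity (\sum_(h < H) \sum_o ep_prob M d o *
    (meanV h (state_at M o h) (d h (state_at M o h)) - optV (next h) (o h))).
  rewrite exchange_big /=; apply: eq_bigr => o _.
  rewrite -mulrBr -mulr_sumr; congr (_ * _).
  have := telescope_path optV o; rewrite optV_max sub0r => /(congr1 -%R); rewrite opprK => <-.
  rewrite -!sumrN -!big_split /=; apply: eq_bigr => h _.
  by rewrite /gap /optQ; ring.
apply: big1 => h _.
apply: (ep_mean_eq0 (c := fun s s' => meanV h s (d h s) - optV (next h) s')) => s.
have [P0 P1] := transP M h s (d h s).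
under eq_bigr do rewrite mulrBr.
by rewrite sumrB -mulr_suml P1 mul1r /meanV subrr.
Qed.

End Optimal.

(** * Greedy actions, and the bonus against the noise *)

Section Greedy.
Variables (R : realType) (S A : finType) (H I : nat) (M : pcmdp R S A H I).
Variables (xi eta ell c1 c2 : R).
Variable tie : seq (obs S H) -> 'I_H -> S -> (A -> R) -> A.
Hypothesis tieP : argmax_rule tie.

Local Notation after := (tables_after M xi eta ell c1 c2 tie).
Local Notation grd := (greedy M xi eta ell c1 c2 tie).

Lemma tabQ_greedy p h s a : tabQ (after p) h s a <= tabQ (after p) h s (grd p h s).
Proof. exact: tieP. Qed.

Lemma tabW_after p h s :
  tabW (after p) (this_epoch h) s =
  Num.min (eta * H%:R) (tabQ (after p) h s (grd p h s)).
Proof.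
(* The induction is on an arbitrary maximizer: ties may be broken differently after each episode, so
   the greedy action can change even where the row of [tabQ] has not. *)
move: (grd p h s) (tabQ_greedy p h s).
elim: p => [|o p IH] a aP.
  by rewrite /= -(inj_eq val_inj) /= ltn_eqF // minxx.
have [[EQ EW _ _ _] _] := table_rowP (after_row M xi eta ell c1 c2 tie p o h).
rewrite EW; case: (eqVneq s (state_at M o h)) => [sE|sN].
  rewrite [LHS]/= /updW -sE eqxx; congr (Num.min _ _).
  have Qrow a' : tabQ (after (o :: p)) h s a' =
     tabQ (step_update M xi eta ell c1 c2 (after p) h s (grd p h s) (o h)) h s a'.
     by rewrite EQ sE.
  apply: le_anti; apply/andP; split.
    by apply: bigmax_le => [|a' _]; [have := aP (grd p h s)|have := aP a'];
      rewrite !Qrow.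
  by rewrite Qrow /=; apply: le_bigmax.
have WE : tabW (step_update M xi eta ell c1 c2 (after p) h (state_at M o h)
  (grd p h (state_at M o h)) (o h)) (this_epoch h) s = tabW (after p) (this_epoch h) s.
  by rewrite /= /updW xpair_eqE (negbTE sN) andbF.
have QE a' : tabQ (after (o :: p)) h s a' = tabQ (after p) h s a'.
  by rewrite EQ /= upd_same xpair_eqE (negbTE sN).
by rewrite WE QE; apply: IH => a'; rewrite -!QE.
Qed.

End Greedy.

(** Half of either term of the minimum must dominate the noise. The hypothesis on [ell] lets its
    surplus over [u] pay for the additional H and for all numerical constants; this is why both
    bonus constants can be 1. *)
Lemma noise_le_bonus (R : realType) (S A : finType) (H t : nat)
    (eta ell u mu sigma N D : R) :
  (0 < H)%N -> (0 < t)%N -> (0 < #|S|)%N -> (0 < #|A|)%N -> 1 <= eta -> 1 <= u ->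
  (256 * 256) * H%:R ^+ 2 * u <= ell -> 0 <= D ->
  0 <= sigma / t%:R - (mu / t%:R) ^+ 2 <= (eta * H%:R) ^+ 2 ->
  N <= 2 * (eta * H%:R) ->
  N <= 16 * Num.sqrt (u * H%:R ^+ 2 *
         (sigma / t%:R - (mu / t%:R) ^+ 2 + eta * H%:R) / t%:R)
    + 64 * u * (eta * H%:R) * H%:R ^+ 2 / t%:R + D ->
  N <= bonus_beta S A H eta ell 1 1 t mu sigma / 2 + D.
Proof.
move=> H0 t0 S0 A0 eta1 u1 ellu D0 /andP[W0 WB] N1 N2.
have HR0 : 0 < H%:R :> R by rewrite ltr0n.
have HR1 : 1 <= H%:R :> R by rewrite ler1n.
have tR : 0 < t%:R :> R by rewrite ltr0n.
have e0 : 0 < eta by lra.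
have u0 : 0 < u by lra.
set W := sigma / _ - _ in W0 WB N2 *.
have H21 : 1 <= H%:R ^+ 2 :> R by exact: exprn_ege1.
have Hu0 : 0 <= H%:R ^+ 2 * u by rewrite mulr_ge0 ?sqr_ge0 // ltW.
have HH : H%:R <= H%:R ^+ 2 :> R by rewrite expr2 ler_peMr // ltW.
have Hu1 : H%:R * u <= H%:R ^+ 2 * u by rewrite ler_pM2r.
have Hu2 : u <= H%:R ^+ 2 * u by rewrite ler_peMl // ltW.
have ell0 : 0 < ell by lra.
have Wp0 : 0 < W + eta * H%:R by rewrite ltr_wpDl // mulr_gt0.
rewrite /bonus_beta -/W !mul1r.
suff [h1 h2] : N <= (Num.sqrt (H%:R / t%:R * (W + eta * H%:R) * ell) +
     eta * (Num.sqrt (H%:R ^+ 7 * #|S|%:R * #|A|%:R) * ell / t%:R)) / 2 + D /\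
   N <= eta * Num.sqrt (H%:R ^+ 3 * ell / t%:R) / 2 + D.
  by case: (leP (Num.sqrt _ + _)).
split.
  apply: le_trans N2 _; rewrite lerD2r [leRHS]mulrDl; apply: lerD.
    have -> : 16 * Num.sqrt (u * H%:R ^+ 2 * (W + eta * H%:R) / t%:R) =
        Num.sqrt ((32 * 32) * (u * H%:R ^+ 2 * (W + eta * H%:R) / t%:R)) / 2.
      rewrite [in RHS]sqrtrM ?mulr_ge0 // -expr2.
      by rewrite sqrtr_sqr ger0_norm //; field.
    rewrite ler_pM2r ?invr_gt0 // ler_wsqrtr //.
    have -> : (32 * 32) * (u * H%:R ^+ 2 * (W + eta * H%:R) / t%:R) =
      (H%:R / t%:R * (W + eta * H%:R)) * ((32 * 32) * (H%:R * u)) by ring.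
    rewrite ler_wpM2l //; last by lra.
    by apply: mulr_ge0; [apply: divr_ge0; apply: ltW|apply: ltW].
  have hs : H%:R ^+ 3 <= Num.sqrt (H%:R ^+ 7 * #|S|%:R * #|A|%:R) :> R.
    have -> : H%:R ^+ 3 = Num.sqrt ((H%:R ^+ 3) ^+ 2) :> R.
      by rewrite sqrtr_sqr ger0_norm // exprn_ge0 // ltW.
    rewrite ler_wsqrtr // -exprM -mulrA.
    apply: le_trans (_ : H%:R ^+ 7 * 1 <= _).
      by rewrite mulr1; apply: ler_weXn2l.
    rewrite ler_pM2l ?exprn_gt0 // -natrM ler1n muln_gt0 S0 A0 //.
  have -> : 64 * u * (eta * H%:R) * H%:R ^+ 2 / t%:R =
     eta * (H%:R ^+ 3 * (128 * u) / t%:R) / 2 by field; rewrite gt_eqF.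
  rewrite ler_pM2r ?invr_gt0 // ler_pM2l // ler_pM2r ?invr_gt0 //.
  apply: ler_pM => //; rewrite ?exprn_ge0 ?(ltW HR0) //; lra.
(* Below u H^3 visits, half the Hoeffding bonus already exceeds the trivial bound 2 eta H. Beyond
   that, [W <= (eta * H) ^+ 2] lets it dominate both terms of the noise bound. *)
have [tb|tb] := lerP (u * H%:R ^+ 3) t%:R; last first.
  suff hz : 4 * H%:R <= Num.sqrt (H%:R ^+ 3 * ell / t%:R).
    by have := ler_wpM2l (ltW e0) hz; lra.
  have -> : 4 * H%:R = Num.sqrt ((4 * H%:R) ^+ 2) :> R.
    by rewrite sqrtr_sqr ger0_norm // mulr_ge0 // ltW.
  rewrite ler_wsqrtr // ler_pdivlMr //.
  apply: le_trans (_ : (4 * H%:R) ^+ 2 * (u * H%:R ^+ 3) <= _).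
    by rewrite ler_wpM2l ?sqr_ge0 // ltW.
  have -> : (4 * H%:R) ^+ 2 * (u * H%:R ^+ 3) = H%:R ^+ 3 * (16 * (H%:R ^+ 2 * u)) :> R by ring.
  by rewrite ler_pM2l ?exprn_gt0 //; lra.
apply: le_trans N2 _; rewrite lerD2r.
set Z := Num.sqrt (H%:R ^+ 3 * ell / t%:R).
have Z0 : 0 <= Z by exact: sqrtr_ge0.
have h1 : 16 * Num.sqrt (u * H%:R ^+ 2 * (W + eta * H%:R) / t%:R) <= eta * Z / 4.
  have -> : eta * Z / 4 = Num.sqrt ((eta / 4) ^+ 2 * (H%:R ^+ 3 * ell / t%:R)).
    rewrite sqrtrM ?sqr_ge0 // sqrtr_sqr ger0_norm ?divr_ge0 ?(ltW e0) // -/Z; ring.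
  have -> : 16 * Num.sqrt (u * H%:R ^+ 2 * (W + eta * H%:R) / t%:R) =
        Num.sqrt (16 ^+ 2 * (u * H%:R ^+ 2 * (W + eta * H%:R) / t%:R)).
    by rewrite [in RHS]sqrtrM ?sqr_ge0 // sqrtr_sqr ger0_norm.
  rewrite ler_wsqrtr //.
  have W2 : W + eta * H%:R <= 2 * (eta * H%:R) ^+ 2.
    have : eta * H%:R <= (eta * H%:R) ^+ 2.
      have e1 : 1 <= eta * H%:R by apply: mulr_ege1.
      by rewrite expr2; apply: ler_peMr => //; lra.
    by lra.
  apply: le_trans (_ : 16 ^+ 2 * (u * H%:R ^+ 2 * (2 * (eta * H%:R) ^+ 2) / t%:R) <= _).
    rewrite ler_pM2l ?exprn_gt0 // ler_pM2r ?invr_gt0 // ler_wpM2l //.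
    by rewrite mulrC.
  have -> : 16 ^+ 2 * (u * H%:R ^+ 2 * (2 * (eta * H%:R) ^+ 2) / t%:R) =
    (eta / 4) ^+ 2 * (H%:R ^+ 3 * ((32 * 256) * (H%:R * u)) / t%:R) by field; rewrite gt_eqF.
  rewrite ler_wpM2l ?sqr_ge0 // ler_pM2r ?invr_gt0 // ler_pM2l ?exprn_gt0 //; lra.
have h2 : 64 * u * (eta * H%:R) * H%:R ^+ 2 / t%:R <= eta * Z / 4.
  have -> : 64 * u * (eta * H%:R) * H%:R ^+ 2 / t%:R =
    eta * (256 * u * H%:R ^+ 3 / t%:R) / 4 by field; rewrite gt_eqF.
  rewrite ler_pM2r ?invr_gt0 // ler_pM2l //.
  have x0 : 0 <= 256 * u * H%:R ^+ 3 / t%:R.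
    by rewrite divr_ge0 ?(ltW tR) // mulr_ge0 ?exprn_ge0 ?(ltW HR0) // mulr_ge0 // ltW.
  rewrite -(ger0_norm x0) -sqrtr_sqr ler_wsqrtr //.
  have -> : (256 * u * H%:R ^+ 3 / t%:R) ^+ 2 =
     (H%:R ^+ 3 / t%:R) * ((256 * 256) * u * (u * H%:R ^+ 3 / t%:R)) by field; rewrite gt_eqF.
  have -> : H%:R ^+ 3 * ell / t%:R = H%:R ^+ 3 / t%:R * ell by ring.
  rewrite ler_pM2l ?divr_gt0 ?exprn_gt0 //.
  apply: le_trans (_ : (256 * 256) * u * 1 <= _); last by lra.
  by rewrite ler_pM2l ?mulr_gt0 // ler_pdivrMr // mul1r.
lra.
Qed.

(** * Sums along histories and over visits *)

Section Psum.
Variables (R : realType) (O : finType).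
Implicit Types F G : seq O -> O -> R.

(** Here [P] will say that no bad event has occurred so far. It passes to earlier histories, so the
    increments need to be compared only where it holds. *)
Lemma psum_le (P : seq O -> Prop) F G p :
  (forall o q, P (o :: q) -> P q) ->
  (forall o q, P (o :: q) -> F q o <= G q o) -> P p -> psum F p <= psum G p.
Proof.
move=> Pc FG; elim: p => [|o p IH] //= Pp.
by apply: lerD; [apply/IH/(Pc o)|apply: FG].
Qed.

Lemma psumD F G p : psum (fun q o => F q o + G q o) p = psum F p + psum G p.
Proof. by elim: p => [|o p IH] /=; rewrite ?addr0 // IH; ring. Qed.

Lemma psumZ c F p : psum (fun q o => c * F q o) p = c * psum F p.
Proof. by elim: p => [|o p IH] /=; rewrite ?mulr0 // IH; ring. Qed.

Lemma psum_sum (J : finType) (F : J -> seq O -> O -> R) p :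
  psum (fun q o => \sum_j F j q o) p = \sum_j psum (F j) p.
Proof. by elim: p => [|o p IH] /=; [rewrite big1|rewrite IH -big_split]. Qed.

Lemma psum_cst (c : R) p : psum (fun _ (_ : O) => c) p = (size p)%:R * c.
Proof. by elim: p => [|o p IH] /=; rewrite ?mul0r // IH -natr1; ring. Qed.

Lemma psum_ge0 F p : (forall q o, 0 <= F q o) -> 0 <= psum F p.
Proof. by move=> F0; elim: p => //= o p IH; rewrite addr_ge0. Qed.

Lemma psum_le_all F G p : (forall q o, F q o <= G q o) -> psum F p <= psum G p.
Proof. by move=> FG; apply: (psum_le (P := fun=> True)). Qed.

Lemma psum_rev F n (w : n.-tuple O) :
  psum F (rev w) = \sum_(k < n) F (rev (take k w)) (tnth w k).
Proof.
have key (o : O) (s : seq O) : psum F (rev s) =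
    \sum_(0 <= k < size s) F (rev (take k s)) (nth o s k).
  elim/last_ind: s => [|s x IH]; first by rewrite /= big_nil.
  rewrite rev_rcons /= IH size_rcons big_nat_recr //=.
  rewrite nth_rcons ltnn eqxx -cats1 take_size_cat //; congr (_ + _).
  rewrite big_nat [RHS]big_nat; apply: eq_bigr => k /andP[_ kn].
  by rewrite takel_cat 1?ltnW // nth_cat kn.
case: n w => [|n] w; first by rewrite (tuple0 w) big_ord0.
rewrite (key (thead w)) size_tuple big_mkord; apply: eq_bigr => k _.
by rewrite (tnth_nth (thead w)).
Qed.

End Psum.

Section PartialSums.
Variable R : realType.

(** The index 0 contributes nothing, as the inverse of 0 is 0; this matches the bonus, which is 0
    before the first visit. *)
Lemma sum_inv_sqrt_le n :
  \sum_(0 <= t < n) (Num.sqrt t%:R)^-1 <= 2 * Num.sqrt n%:R :> R.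
Proof.
suff key m : \sum_(0 <= t < m.+1) (Num.sqrt t%:R)^-1 <= 2 * Num.sqrt m%:R :> R.
  case: n => [|n]; first by rewrite big_nil mulr_ge0 ?sqrtr_ge0.
  by apply: le_trans (key n) _; rewrite ler_pM2l // ler_wsqrtr // ler_nat.
elim: m => [|m IH]; first by rewrite big_nat1 sqrtr0 invr0 mulr0.
rewrite big_nat_recr //=; set a := Num.sqrt m%:R in IH; set b := Num.sqrt _.
have a0 : 0 <= a by exact: sqrtr_ge0.
have b0 : 0 < b by rewrite sqrtr_gt0 ltr0n.
have ab : b ^+ 2 = a ^+ 2 + 1 by rewrite !sqr_sqrtr // -natr1.
have leab : a <= b by rewrite ler_wsqrtr // ler_nat.
have : b^-1 <= 2 * (b - a).
  rewrite -[leLHS]mul1r ler_pdivrMr //.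
  by have := sqr_ge0 (b - a); lra.
by clearbody a b; lra.
Qed.

Lemma sum_inv_le n k : (n <= k)%N -> (0 < k)%N ->
  \sum_(0 <= t < n) (t%:R)^-1 <= 1 + ln k%:R :> R.
Proof.
move=> nk k0.
have key m : \sum_(0 <= t < m.+2) (t%:R)^-1 <= 1 + ln m.+1%:R :> R.
  elim: m => [|m IH].
    by rewrite !big_nat_recr //= big_nil invr0 invr1 ln1; lra.
  rewrite big_nat_recr //=.
  have : (m.+2%:R)^-1 <= ln m.+2%:R - ln m.+1%:R :> R.
    have m1 : 0 < m.+1%:R :> R by rewrite ltr0n.
    have m2 : 0 < m.+2%:R :> R by rewrite ltr0n.
    have h : m.+1%:R / m.+2%:R = 1 + - (m.+2%:R)^-1 :> R.
      rewrite -[m.+2%:R]natr1; field; rewrite gt_eqF //; lra.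
    have : ln (m.+1%:R / m.+2%:R) <= - (m.+2%:R)^-1 :> R.
      rewrite h; apply: le_ln1Dx; rewrite ltrN2 invf_lt1 // ltr1n //.
    by rewrite ln_div ?posrE // => hh; rewrite -lerN2 opprB.
  by move: IH; move: (ln _) (ln _) (_^-1) => x y z; lra.
case: n nk => [|[|n]] nk; rewrite ?big_nil.
- have := ln_ge0 (_ : 1 <= k%:R :> R); rewrite ler1n => /(_ k0); move: (ln _) => x; lra.
- rewrite big_nat1 invr0.
  by have := ln_ge0 (_ : 1 <= k%:R :> R); rewrite ler1n => /(_ k0); move: (ln _) => x; lra.
apply: le_trans (key n) _; rewrite lerD2l ler_ln ?posrE ?ltr0n // ler_nat.
exact: ltnW.
Qed.

End PartialSums.

Section Visits.
Variables (R : realType) (S A : finType) (H I : nat) (M : pcmdp R S A H I).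
Variables (xi eta ell c1 c2 : R).
Variable tie : seq (obs S H) -> 'I_H -> S -> (A -> R) -> A.

Local Notation visit := (visit M xi eta ell c1 c2 tie).
Local Notation visits := (visits M xi eta ell c1 c2 tie).
Local Notation grd := (greedy M xi eta ell c1 c2 tie).
Local Notation X := (seq (obs S H) * obs S H)%type.

Lemma size_visits_le p h s a : (size (visits p h s a) <= size p)%N.
Proof.
elim: p => //= o p IH; case: ifP => _ //=; exact: leq_trans IH _.
Qed.

(** An episode visits exactly one state-action pair at epoch [h], so sums over episodes regroup by
    pairs. All counting arguments rest on this. *)
Lemma psum_visits (F : seq (obs S H) -> obs S H -> R) p h :
  psum F p = \sum_s \sum_a \sum_(x <- visits p h s a) F x.1 x.2.
Proof.
elim: p => [|o p IH] /=.
  by rewrite big1 // => s _; rewrite big1 // => a _; rewrite big_nil.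
rewrite IH; set s0 := state_at M o h; set a0 := grd p h s0.
transitivity (\sum_s \sum_a (\sum_(x <- visits p h s a) F x.1 x.2 +
    (if (s == s0) && (a == a0) then F p o else 0))).
  under [RHS]eq_bigr do rewrite big_split /=.
  rewrite big_split /=; congr (_ + _).
  rewrite (bigD1 s0) //= (bigD1 a0) //= !eqxx /= big1 => [|a /negbTE -> //].
  by rewrite addr0 big1 ?addr0 // => s /negbTE ->; rewrite big1.
apply: eq_bigr => s _; apply: eq_bigr => a _.
rewrite -[_ && _]xpair_eqE visitE; case: ifP => _; last by rewrite addr0.
by rewrite big_cons addrC.
Qed.

Lemma psum_visit (f : seq (obs S H) -> obs S H -> R) p h s a :
  psum (fun q o => if visit q o h s a then f q o else 0) p =
  \sum_(x <- visits p h s a) f x.1 x.2.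
Proof.
elim: p => [|o p IH] /=; first by rewrite big_nil.
by rewrite IH; case: ifP => _; rewrite ?big_cons ?addr0 // addrC.
Qed.

Lemma sum_before (F : seq X -> R) p h s a :
  \sum_(x <- visits p h s a) F (visits x.1 h s a) = tsum F (visits p h s a).
Proof.
elim: p => [|o p IH] /=; first by rewrite big_nil.
by case: ifP => _ //=; rewrite big_cons IH addrC.
Qed.

End Visits.

(** * Optimism and the sum of the bonuses *)

Section Optimism.
Variables (R : realType) (S A : finType) (H I : nat) (M : pcmdp R S A H I).
Variables (eta ell u : R) (a0 : A) (gridsize K : nat).
Variable tie : seq (obs S H) -> 'I_H -> S -> (A -> R) -> A.

Local Notation rho := (mod_reward M 0 eta).
Local Notation after := (tables_after M 0 eta ell 1 1 tie).
Local Notation grd := (greedy M 0 eta ell 1 1 tie).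
Local Notation visit := (visit M 0 eta ell 1 1 tie).
Local Notation visits := (visits M 0 eta ell 1 1 tie).
Local Notation bonus := (bonus M 0 eta ell 1 1 tie).
Local Notation next_value := (next_value M 0 eta ell 1 1 tie).
Local Notation next := (@next_epoch H).
Local Notation this := (@this_epoch H).
Local Notation optV := (optV M rho a0).
Local Notation optQ := (optQ M rho a0).
Local Notation meanV := (meanV M rho a0).
Local Notation X := (seq (obs S H) * obs S H)%type.

Hypothesis tieP : argmax_rule tie.
Hypothesis H_gt0 : (0 < H)%N.
Hypothesis rhoB : forall s a, `|rho s a| <= eta.
Hypothesis eta1 : 1 <= eta.
Hypothesis u1 : 1 <= u.
Hypothesis ell_large : 256 * 256 * H%:R ^+ 2 * u <= ell.
Hypothesis K_gt0 : (0 < K)%N.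
Hypothesis grid_fine :
  2^-1 ^+ gridsize <= (K%:R ^+ H.+1)^-1 / (16 * (eta * H%:R) * H%:R ^+ 2) :> R.

Definition dev h s a (x : X) : R := optV (next h) (x.2 h) - meanV h s a.

Definition excess h (x : X) : R := next_value h x - optV (next h) (x.2 h).

(* The cut-off keeps the increments within the range of [self_normalized_tail].
   As the weights increase, it is inactive at every visit up to the present one
   as soon as it is inactive at the present one. *)
Definition noise_incr (j : nat) (neg : bool) h s a p (o : obs S H) : R :=
  let w := 2^-1 ^+ j * weight R H (size (visits p h s a)).+1 in
  if visit p o h s a && (w * (8 * (eta * H%:R)) <= 1) then
    (-1) ^+ neg * (w * dev h s a (p, o))
  else 0.

(** Stated through [hit], so that it passes to all earlier histories, as the inductions over
    episodes require. *)
Definition in_range (X : seq (obs S H) -> obs S H -> R) p :=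
  ~~ hit (fun q => u <= psum X q - psum (fun q o => X q o ^+ 2) q) p.

Definition noise_good p : Prop :=
  forall j neg h s a, (j <= gridsize)%N -> in_range (noise_incr j neg h s a) p.

Definition optimistic p : Prop := forall j s, optV j s <= tabW (after p) j s.

Let B0 : 0 < eta * H%:R.
Proof.
by apply: mulr_gt0; [exact: lt_le_trans ltr01 eta1|rewrite ltr0n].
Qed.

Let B1 : 1 <= eta * H%:R.
Proof. by apply: mulr_ege1; rewrite ?ler1n. Qed.

Lemma in_range_cons Y o p : in_range Y (o :: p) -> in_range Y p.
Proof. by rewrite /in_range /= negb_or => /andP[]. Qed.

Lemma in_range_lt Y p : in_range Y p ->
  psum Y p - psum (fun q o => Y q o ^+ 2) p <= u.
Proof. by case: p => [|o p]; rewrite /in_range /= negb_or -ltNge => /andP[/ltW]. Qed.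

Lemma dev_abs_le h s a x : `|dev h s a x| <= 2 * (eta * H%:R).
Proof.
apply: le_trans (ler_normB _ _) _.
have := optV_norm_le M a0 rhoB (next h) (x.2 h).
by have := meanV_norm_le M a0 rhoB h s a; rewrite /mod_reward; lra.
Qed.

Lemma noise_incr_mean j neg h s a p :
  \sum_o ep_prob M (grd p) o * noise_incr j neg h s a p o = 0.
Proof.
pose w := 2^-1 ^+ j * weight R H (size (visits p h s a)).+1.
apply: (ep_mean_eq0 (c := fun s1 s2 =>
  if (s1 == s) && (grd p h s == a) && (w * (8 * (eta * H%:R)) <= 1) then
    (-1) ^+ neg * (w * (optV (next h) s2 - meanV h s a)) else 0)) => s1.
case: (boolP (_ && _ && _)) => [/andP[/andP[/eqP-> /eqP ->] _]|_]; last first.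
  by apply: big1 => s2 _; rewrite mulr0.
have [P0 P1] := transP M h s a.
transitivity ((-1) ^+ neg * (w * \sum_s2 trans M h s a s2 *
    (optV (next h) s2 - meanV h s a))).
  by rewrite !mulr_sumr; apply: eq_bigr => s2 _; ring.
under eq_bigr do rewrite mulrBr.
by rewrite sumrB -mulr_suml P1 mul1r /meanV subrr !mulr0.
Qed.

Lemma noise_incr_le j neg h s a p o : `|noise_incr j neg h s a p o| <= 4^-1.
Proof.
rewrite /noise_incr; set w := _ * weight _ _ _.
have w0 : 0 <= w.
  by apply: mulr_ge0; [rewrite exprn_ge0 ?invr_ge0|exact/ltW/weight_gt0].
case: ifPn => [/andP[_ wB]|_]; last by rewrite normr0 invr_ge0.
rewrite normrM normrX normrN1 expr1n mul1r normrM (ger0_norm w0).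
apply: le_trans (_ : w * (2 * (eta * H%:R)) <= _).
  by rewrite ler_wpM2l // dev_abs_le.
by clearbody w; lra.
Qed.

Lemma psum_noise_incr j neg h s a p :
  (forall t, (0 < t <= size (visits p h s a))%N ->
     2^-1 ^+ j * weight R H t * (8 * (eta * H%:R)) <= 1) ->
  psum (noise_incr j neg h s a) p = (-1) ^+ neg * (2^-1 ^+ j *
     isum (fun t x => weight R H t * dev h s a x) (visits p h s a)) /\
  psum (fun q o => noise_incr j neg h s a q o ^+ 2) p = (2^-1 ^+ j) ^+ 2 *
     isum (fun t x => weight R H t ^+ 2 * dev h s a x ^+ 2) (visits p h s a).
Proof.
elim: p => [|o p IH] /= hw; first by rewrite !mulr0.
rewrite /noise_incr; case: ifP hw => v hw /=; last first.
  have [-> ->] := IH hw.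
  by rewrite expr0n !addr0.
have hw' t : (0 < t <= size (visits p h s a))%N ->
    2^-1 ^+ j * weight R H t * (8 * (eta * H%:R)) <= 1.
  by case/andP=> t0 tl; apply: hw; rewrite t0 leqW.
have [-> ->] := IH hw'.
rewrite (hw _) ?ltn0Sn ?leqnn //=.
split; first by ring.
by rewrite exprMn sqrr_sign; ring.
Qed.

Lemma tabW_le p j s : tabW (after p) j s <= eta * H%:R.
Proof.
case: (unliftP ord_max j) => [h ->|->]; last by rewrite after_tabW_max ltW.
have -> : lift ord_max h = this h by apply: ord_inj; rewrite lift_max.
by rewrite tabW_after // ge_min lexx.
Qed.

Lemma optV_abs_le j s : `|optV j s| <= eta * H%:R.
Proof. exact: optV_norm_le. Qed.

Section OneRow.
Variables (p : seq (obs S H)) (h : 'I_H) (s : S) (a : A).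
Local Notation xs := (visits p h s a).
Hypothesis xs_opt : {in xs, forall x, optimistic x.1}.
Hypothesis p_good : noise_good p.
Hypothesis p_size : (size p <= K)%N.

Lemma excess_bounds : {in xs, forall x, 0 <= excess h x <= 2 * (eta * H%:R)}.
Proof.
move=> x /xs_opt xo; rewrite /excess /next_value; apply/andP; split.
  by rewrite subr_ge0.
have := tabW_le x.1 (next h) (x.2 h); have := optV_abs_le (next h) (x.2 h).
by rewrite ler_norml => /andP[]; lra.
Qed.

Lemma next_valueE : {in xs, forall x,
  next_value h x = meanV h s a + dev h s a x + excess h x}.
Proof. by move=> x _; rewrite /excess /dev; ring. Qed.

Lemma next_value_abs_le : {in xs, forall x, `|next_value h x| <= eta * H%:R}.
Proof.
move=> x xx; have /andP[e0 _] := excess_bounds xx.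
rewrite ler_norml; apply/andP; split; last exact: tabW_le.
have := optV_abs_le (next h) (x.2 h); rewrite ler_norml => /andP[? _].
by move: e0; rewrite /excess; lra.
Qed.

Lemma emp_var_next_le : (0 < size xs)%N ->
  emp_var (next_value h) xs <= (eta * H%:R) ^+ 2.
Proof.
move=> n0; apply: le_trans (emp_var_le _ 0 n0) _.
rewrite ler_pdivrMr ?ltr0n //; apply: le_trans (_ : \sum_(x <- xs) (eta * H%:R) ^+ 2 <= _).
  rewrite big_seq [leRHS]big_seq; apply: ler_sum => x xx.
  rewrite subr0 -real_normK ?num_real // lerXn2r ?nnegrE ?(ltW B0) //.
  exact: next_value_abs_le.
by rewrite big_const_seq count_predT iter_addr addr0 [leRHS]mulr_natr.
Qed.

(** [noise_bound] with [e] the eta H of the bonus. The noise is not controlled by the bonus alone: a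
    1/H part of the average excess is left over, and the excess in the table entry itself pays for
    it. *)
Lemma avg_dev_le : (0 < size xs)%N ->
  `|avg H (dev h s a) xs| <= bonus p h s a / 2 + avg H (excess h) xs / H%:R.
Proof.
move=> n0.
have K0 : (size xs <= K)%N by apply: leq_trans p_size; exact: size_visits_le.
rewrite bonusE n0 tabN_after tabmu_after tabsigma_after.
have S0 : (0 < #|S|)%N by apply/card_gt0P; exists (start M).
have A0 : (0 < #|A|)%N by apply/card_gt0P; exists a0.
have devB : {in xs, forall x, `|dev h s a x| <= 2 * (eta * H%:R)}.
  by move=> x _; exact: dev_abs_le.
apply: (noise_le_bonus (u := u)) => //.
- apply: divr_ge0 => //; apply: avg_ge0 => // x /excess_bounds /andP[] //.
- by rewrite (emp_var_ge0 _ n0) emp_var_next_le.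
- exact: avg_abs_le.
rewrite -/(emp_var _ _).
apply: (@noise_bound _ _ _ H_gt0 _ _ _ _ _ _ _ n0 next_valueE excess_bounds devB gridsize) => //.
- have := emp_var_next_le n0.
  have : eta * H%:R <= (eta * H%:R) ^+ 2 by rewrite expr2; apply: ler_peMr => //; exact: ltW.
  by lra.
- apply: le_trans grid_fine _; rewrite ler_pM2r ?invr_gt0; last first.
    by apply: mulr_gt0; [apply: mulr_gt0|rewrite exprn_gt0 ?ltr0n].
  by rewrite lef_pV2 ?posrE ?exprn_gt0 ?ltr0n // lerXn2r ?nnegrE // ler_nat.
move=> j jm wB.
have hw t : (0 < t <= size xs)%N -> 2^-1 ^+ j * weight R H t * (8 * (eta * H%:R)) <= 1.
  case/andP=> t0 tl; apply: le_trans wB.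
  apply: ler_wpM2r; first by rewrite mulr_ge0 // ltW.
  by rewrite ler_pM2l ?exprn_gt0 ?invr_gt0 // weight_le.
set L := isum _ _; set Q := isum _ _.
have key (neg : bool) : (-1) ^+ neg * (2^-1 ^+ j * L) - (2^-1 ^+ j) ^+ 2 * Q <= u.
  have := in_range_lt (p_good neg h s a jm).
  by have [-> ->] := psum_noise_incr neg hw.
have := key false; have := key true; rewrite expr0 expr1 mul1r mulN1r.
by case: (lerP 0 L) => [L0|L0]; [rewrite ger0_norm|rewrite ltr0_norm // mulrN].
Qed.

Lemma tabQ_diff : (0 < size xs)%N -> tabQ (after p) h s a - optQ h s a =
  avg H (dev h s a) xs + avg H (excess h) xs + bonus p h s a / 2.
Proof.
move=> n0; rewrite tabQ_after // n0 /optQ.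
rewrite (avg_eq H_gt0 next_valueE) avgD avgD avg_cst //; ring.
Qed.

(** The noise can take away half the bonus and 1/H of the average excess, and [tabQ_diff] contains
    half the bonus and the whole average, which is nonnegative. *)
Lemma optQ_le_tabQ : optQ h s a <= tabQ (after p) h s a.
Proof.
case: (posnP (size xs)) => [n0|n0].
  rewrite tabQ_after // n0.
  by have := optQ_norm_le M a0 rhoB h s a; rewrite ler_norml => /andP[].
rewrite -subr_ge0 tabQ_diff //.
have := avg_dev_le n0; rewrite ler_norml => /andP[].
have e0 : 0 <= avg H (excess h) xs.
  by apply: avg_ge0 => // x /excess_bounds /andP[].
have : avg H (excess h) xs / H%:R <= avg H (excess h) xs.
  by rewrite ler_pdivrMr ?ltr0n // ler_peMr // ler1n.
lra.
Qed.

Lemma tabQ_le : tabQ (after p) h s a <= optQ h s a +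
  (if size xs == 0%N then 2 * (eta * H%:R) else 0) +
  (1 + H%:R^-1) * avg H (excess h) xs + bonus p h s a.
Proof.
case: (posnP (size xs)) => [n0|n0].
  rewrite tabQ_after // bonusE n0 /= (size0nil n0) /=.
  by have := optQ_norm_le M a0 rhoB h s a; rewrite ler_norml => /andP[]; lra.
have := avg_dev_le n0; rewrite ler_norml => /andP[_].
have := tabQ_diff n0; lra.
Qed.

End OneRow.

Lemma optimistic_of_rows p :
  (forall h s a, {in visits p h s a, forall x, optimistic x.1}) ->
  noise_good p -> (size p <= K)%N -> optimistic p.
Proof.
move=> po pg pK j s.
case: (unliftP ord_max j) => [h ->|->]; last by rewrite after_tabW_max optV_max.
have -> : lift ord_max h = this h by apply: ord_inj; rewrite lift_max.
rewrite tabW_after // le_min; apply/andP; split.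
  by have := optV_abs_le (this h) s; rewrite ler_norml => /andP[].
apply: optV_le => a; apply: le_trans (tabQ_greedy _ _ _ _ _ _ tieP p h s a).
exact: optQ_le_tabQ.
Qed.

Lemma noise_good_cons o p : noise_good (o :: p) -> noise_good p.
Proof. by move=> g j neg h s a jm; apply: in_range_cons (g j neg h s a jm). Qed.

(** The tables after [p] are built from values read at strictly earlier histories, where optimism is
    already known; hence the visits are carried along in the induction. *)
Lemma optimism p : noise_good p -> (size p <= K)%N ->
  optimistic p /\ (forall h s a, {in visits p h s a, forall x, optimistic x.1}).
Proof.
elim: p => [|o p IH] pg pK.
  have h0 : forall h s a, {in visits [::] h s a, forall x, optimistic x.1} by [].
  by split=> //; apply: optimistic_of_rows.
have [po px] := IH (noise_good_cons pg) (ltnW pK).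
have h0 : forall h s a, {in visits (o :: p) h s a, forall x, optimistic x.1}.
  move=> h s a x /=; case: ifP => _; last exact: px.
  by rewrite inE => /orP[/eqP->|/px].
by split=> //; apply: optimistic_of_rows.
Qed.

(** * The recursion for gaps and slacks, and a first bound *)

Definition ep_gap h q (o : obs S H) : R :=
  gap M rho a0 h (state_at M o h) (grd q h (state_at M o h)).

Definition ep_slack j q (o : obs S H) : R :=
  tabW (after q) j (path_at M o j) - optV j (path_at M o j).

(** At a first visit the entry still has its initial value, which may exceed the optimal one by 2
    eta H; this is paid once per epoch and pair. *)
Definition ep_cost h q (o : obs S H) : R :=
  let s := state_at M o h in let a := grd q h s in
  (if size (visits q h s a) == 0%N then 2 * (eta * H%:R) else 0) +
  bonus q h s a.

Definition ep_avg h q (o : obs S H) : R :=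
  avg H (excess h)
    (visits q h (state_at M o h) (grd q h (state_at M o h))).

Definition noise_ok q : Prop := noise_good q /\ (size q <= K)%N.

Lemma noise_ok_cons o q : noise_ok (o :: q) -> noise_ok q.
Proof. by case=> /noise_good_cons g /ltnW. Qed.

Lemma visits_mem p h s a x : x \in visits p h s a ->
  state_at M x.2 h = s /\ grd x.1 h s = a.
Proof.
elim: p => //= o p IH; case: ifP => [v|_]; last exact: IH.
by rewrite inE => /orP[/eqP->|/IH//]; case/andP: v => /eqP ? /eqP.
Qed.

Lemma visits_closed (P : seq (obs S H) -> Prop) p h s a :
  (forall o q, P (o :: q) -> P q) -> P p ->
  {in visits p h s a, forall x, P x.1}.
Proof.
move=> Pc; elim: p => //= o p IH Pp x; have Pq := Pc _ _ Pp.
case: ifP => _; last exact: IH.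
by rewrite inE => /orP[/eqP->|/IH]; [|apply].
Qed.

Lemma tsum_size (g : nat -> R) (xs : seq X) :
  tsum (fun ys => g (size ys)) xs = \sum_(0 <= t < size xs) g t.
Proof.
by elim: xs => [|x xs IH]; rewrite /= ?big_nil // IH big_nat_recr.
Qed.

Let ell0 : 0 < ell.
Proof.
apply: lt_le_trans ell_large; apply: mulr_gt0; last exact: lt_le_trans ltr01 u1.
by apply: mulr_gt0; [rewrite mulr_gt0 ?ltr0n|rewrite exprn_gt0 ?ltr0n].
Qed.

Let eta0 : 0 < eta. Proof. exact: lt_le_trans ltr01 eta1. Qed.

Lemma bonus_ge0 p h s a : 0 <= bonus p h s a.
Proof.
rewrite bonusE; case: ifP => // _; rewrite /bonus_beta !mul1r.
have l0 := ltW ell0; have e0 := ltW eta0.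
rewrite le_min; apply/andP; split; last by rewrite mulr_ge0 ?sqrtr_ge0.
apply: addr_ge0; first exact: sqrtr_ge0.
by apply: mulr_ge0 => //; apply: divr_ge0 => //; apply: mulr_ge0 => //; apply: sqrtr_ge0.
Qed.

Lemma ep_cost_ge0 h q o : 0 <= ep_cost h q o.
Proof.
apply: addr_ge0; last exact: bonus_ge0.
by case: ifP => // _; rewrite mulr_ge0 // ltW.
Qed.

Lemma ep_slack_ge0 j q o : noise_ok q -> 0 <= ep_slack j q o.
Proof. by case=> g k; rewrite subr_ge0; have [po _] := optimism g k; apply: po. Qed.

(** The table value is at most the entry of the played action, and [tabQ_le] compares that entry
    with [optQ], which is [optV] minus the gap. *)
Lemma ep_step h q o : noise_ok q ->
  ep_gap h q o + ep_slack (this h) q o <=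
  ep_cost h q o + (1 + H%:R^-1) * ep_avg h q o.
Proof.
case=> g k; have [_ px] := optimism g k.
rewrite /ep_gap /ep_slack /ep_cost /ep_avg path_at_this.
set s := state_at M o h; set a := grd q h s.
have := tabQ_le (px h s a) g k.
have : tabW (after q) (this h) s <= tabQ (after q) h s a.
  by rewrite tabW_after // ge_min lexx orbT.
by rewrite /gap; lra.
Qed.

Lemma excess_slack h q o : excess h (q, o) = ep_slack (next h) q o.
Proof. by rewrite /ep_slack path_at_next. Qed.

(** Regrouped by pairs, each excess enters the averages at the later visits with total weight at
    most 1 + 1/H, the identity of [tsum_avg]. *)
Lemma psum_avg_le p h : noise_ok p ->
  psum (ep_avg h) p <= (1 + H%:R^-1) * psum (ep_slack (next h)) p.
Proof.
move=> pok; have [g k] := pok; have [_ px] := optimism g k.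
rewrite !(psum_visits M 0 eta ell 1 1 tie _ p h) mulr_sumr; apply: ler_sum => s _.
rewrite mulr_sumr; apply: ler_sum => a _.
rewrite (eq_big_seq (fun x => avg H (excess h) (visits x.1 h s a))) => [|x xx].
  rewrite (sum_before _ _ _ _ _ _ _ (avg H (excess h))).
  apply: le_trans (tsum_avg_le H_gt0 _) _.
    by move=> x xx; have /andP[] := excess_bounds (px h s a) xx.
  rewrite ler_wpM2l // ?addr_ge0 ?invr_ge0 //.
  by apply: ler_sum => -[q o] _; rewrite excess_slack.
by rewrite /ep_avg; have [-> ->] := visits_mem xx.
Qed.

Lemma sum_slack_telescope (f : 'I_H.+1 -> R) :
  \sum_(h < H) f (this h) = \sum_j f j - f ord_max /\
  \sum_(h < H) f (next h) = \sum_j f j - f ord0.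
Proof.
split; [rewrite big_ord_recr /= addrK|rewrite big_ord_recl /= addrC addKr] => //.
Qed.

(* The recursion [ep_step] only needs the weights r^(2h), r = 1 + 1/H; the
   larger weights r^(3h) leave the multiple 1/(H+1) of the slacks on the left. *)
Lemma psum_gap_slack_le p : noise_ok p ->
  \sum_(h < H) psum (ep_gap h) p +
    (H.+1%:R)^-1 * \sum_j psum (ep_slack j) p <=
  expR 3 * \sum_(h < H) psum (ep_cost h) p.
Proof.
move=> pok.
have HR0 : 0 < H%:R :> R by rewrite ltr0n.
set r : R := 1 + H%:R^-1.
have r1 : 1 <= r by rewrite lerDl invr_ge0 ltW.
have r0 : 0 < r by lra.
pose w (j : nat) := r ^+ (3 * j).
have w1 j : 1 <= w j by exact: exprn_ege1.
have w0 j : 0 < w j by rewrite exprn_gt0.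
have wH (h : 'I_H) : w h <= expR 3.
  rewrite /w; apply: le_trans (_ : expR (H%:R^-1) ^+ (3 * h) <= _).
    by rewrite lerXn2r ?nnegrE ?expR_ge0 ?(ltW r0) // expR_ge1Dx.
  rewrite -expRM_natl ler_expR -[leRHS]mulr1 natrM -mulrA ler_wpM2l //.
  by rewrite ler_pdivrMr // mul1r ler_nat ltnW.
pose f (j : 'I_H.+1) := w j * psum (ep_slack j) p.
have sl0 (j : 'I_H.+1) : 0 <= psum (ep_slack j) p.
  have <- : psum (fun _ (_ : obs S H) => 0) p = 0 :> R by rewrite psum_cst mulr0.
  apply: (psum_le (P := noise_ok)) => // o q; first exact: noise_ok_cons.
  by move/noise_ok_cons; exact: ep_slack_ge0.
have f0 j : 0 <= f j by rewrite mulr_ge0 // ltW.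
have stepw (h : 'I_H) : w h * psum (ep_gap h) p + f (this h) <=
    w h * psum (ep_cost h) p + r^-1 * f (next h).
  have -> : r^-1 * f (next h) = w h * (r * (r * psum (ep_slack (next h)) p)).
    rewrite /f /w /= /bump leq0n add1n mulnS exprD.
    by field; rewrite gt_eqF.
  rewrite /f -!mulrDr ler_pM2l //.
  apply: le_trans (_ : psum (ep_cost h) p + r * psum (ep_avg h) p <= _); last first.
    by rewrite lerD2l ler_pM2l // psum_avg_le.
  rewrite -psumD -psumZ -psumD.
  apply: (psum_le (P := noise_ok)) => // o q; first exact: noise_ok_cons.
  by move/noise_ok_cons; exact: ep_step.
have [t1 t2] := sum_slack_telescope f.
have fmax : f ord_max = 0.
  rewrite /f (_ : psum _ p = 0) ?mulr0 //.
  rewrite -[RHS](mulr0 (size p)%:R) -psum_cst; elim: (p) => //= o q ->.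
  by rewrite /ep_slack after_tabW_max optV_max subrr.
have : \sum_(h < H) (w h * psum (ep_gap h) p + f (this h)) <=
   \sum_(h < H) (w h * psum (ep_cost h) p + r^-1 * f (next h)).
  by apply: ler_sum => h _; exact: stepw.
rewrite !big_split /= t1 fmax subr0 -mulr_sumr t2 => main.
have ri : r^-1 = 1 - (H.+1%:R)^-1.
  have h1 : H%:R + 1 != 0 :> R by rewrite gt_eqF // addr_gt0.
  have -> : r = (H%:R + 1) / H%:R by rewrite /r; field; rewrite gt_eqF.
  by rewrite invf_div -natr1; field.
have g1 : \sum_(h < H) psum (ep_gap h) p <= \sum_(h < H) w h * psum (ep_gap h) p.
  apply: ler_sum => h _; rewrite ler_peMl // psum_ge0 // => q o; exact: gap_ge0.
have g2 : (H.+1%:R)^-1 * \sum_j psum (ep_slack j) p <= (H.+1%:R)^-1 * \sum_j f j.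
  by rewrite ler_pM2l ?invr_gt0 // ler_sum // => j _; rewrite ler_peMl.
have g3 : \sum_(h < H) w h * psum (ep_cost h) p <= expR 3 * \sum_(h < H) psum (ep_cost h) p.
  rewrite mulr_sumr; apply: ler_sum => h _; rewrite ler_wpM2r // psum_ge0 // => q o.
  exact: ep_cost_ge0.
have g4 : 0 <= r^-1 * f ord0 by rewrite mulr_ge0 ?invr_ge0 // ltW.
move: main g1 g2 g3 g4; rewrite ri.
set k := H.+1%:R^-1; set e := expR 3 * _; set L := \sum_j psum (ep_slack j) p.
set F := \sum_j f j; set G := \sum_(h < H) psum (ep_gap h) p.
set x := \sum_(h < H) w h * psum (ep_cost h) p.
set y := \sum_(h < H) w h * psum (ep_gap h) p.
move: (f ord0) => f1; clearbody k e L F G x y.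
by lra.
Qed.

Lemma psum_cost_le (g : 'I_H -> S -> A -> nat -> R) p h : noise_ok p ->
  (forall s a, {in visits p h s a, forall x,
     bonus x.1 h s a <= g h s a (size (visits x.1 h s a))}) ->
  psum (ep_cost h) p <= \sum_s \sum_a (2 * (eta * H%:R) +
     \sum_(0 <= t < size (visits p h s a)) g h s a t).
Proof.
move=> pok hg; rewrite (psum_visits M 0 eta ell 1 1 tie _ p h).
apply: ler_sum => s _; apply: ler_sum => a _.
pose F (ys : seq X) := (if size ys == 0%N then 2 * (eta * H%:R) else 0) + g h s a (size ys).
apply: le_trans (_ : \sum_(x <- visits p h s a) F (visits x.1 h s a) <= _).
  rewrite big_seq [leRHS]big_seq; apply: ler_sum => x xx.
  by rewrite /ep_cost; have [-> ->] := visits_mem xx; rewrite lerD2l hg.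
rewrite sum_before (tsum_size (fun n => (if n == 0%N then 2 * (eta * H%:R) else 0) + g h s a n)).
rewrite big_split /= lerD2r; case: (size _) => [|n].
  by rewrite big_nil mulr_ge0 // ltW.
rewrite big_nat_recl // big1 ?addr0 // => i _.
Qed.

(** The outcome of the first pass, with the Hoeffding part alone. It is wasteful in H, S and A but
    of order sqrt K, and it will only enter terms of lower order. *)
Definition coarse_cost : R :=
  H%:R * (#|S|%:R * #|A|%:R) *
    (2 * (eta * H%:R) + 2 * eta * Num.sqrt (H%:R ^+ 3 * ell * K%:R)).

Lemma bonus_le_coarse p h s a : bonus p h s a <=
  eta * Num.sqrt (H%:R ^+ 3 * ell) * (Num.sqrt (size (visits p h s a))%:R)^-1.
Proof.
rewrite bonusE; case: ifP => n0; last first.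
  by rewrite !mulr_ge0 ?invr_ge0 ?sqrtr_ge0 // ltW.
rewrite ge_min; apply/orP; right.
rewrite mul1r tabN_after sqrtrM; last by rewrite mulr_ge0 ?exprn_ge0 // ltW.
by rewrite sqrtrV ?mulrA.
Qed.

Lemma psum_cost_le_coarse p : noise_ok p ->
  \sum_(h < H) psum (ep_cost h) p <= coarse_cost.
Proof.
move=> pok; rewrite /coarse_cost.
set c := 2 * (eta * H%:R) + _.
have hc (h : 'I_H) : psum (ep_cost h) p <= #|S|%:R * #|A|%:R * c.
  apply: le_trans (psum_cost_le (g := fun _ _ _ t =>
    eta * Num.sqrt (H%:R ^+ 3 * ell) * (Num.sqrt t%:R)^-1) pok _) _.
    by move=> s a x _; exact: bonus_le_coarse.
  apply: le_trans (_ : \sum_(s : S) \sum_(a : A) c <= _); last first.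
    rewrite (eq_bigr (fun=> #|A|%:R * c)) => [|s _]; last first.
      by rewrite sumr_const mulr_natl.
    by rewrite sumr_const mulr_natl -mulrA mulr_natl mulr_natl.
  apply: ler_sum => s _; apply: ler_sum => a _; rewrite lerD2l -mulr_sumr.
  have -> : 2 * eta * Num.sqrt (H%:R ^+ 3 * ell * K%:R) =
     eta * Num.sqrt (H%:R ^+ 3 * ell) * (2 * Num.sqrt K%:R).
    rewrite [in LHS]sqrtrM; last by rewrite mulr_ge0 ?exprn_ge0 // ltW.
    by ring.
  apply: ler_wpM2l; first by rewrite mulr_ge0 ?sqrtr_ge0 // ltW.
  apply: le_trans (sum_inv_sqrt_le _ _) _; rewrite ler_pM2l // ler_wsqrtr // ler_nat.
  by apply: leq_trans (pok.2); exact: size_visits_le.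
apply: le_trans (_ : \sum_(h < H) #|S|%:R * #|A|%:R * c <= _).
  by apply: ler_sum => h _; exact: hc.
by rewrite sumr_const card_ord -[leRHS]mulrA [leRHS]mulr_natl.
Qed.

(** * Variances of the optimal values, and the second pass *)

Definition varV h s a : R :=
  \sum_s' trans M h s a s' * (optV (next h) s' - meanV h s a) ^+ 2.

Definition meanSqV h s a : R := \sum_s' trans M h s a s' * optV (next h) s' ^+ 2.

(** Both terms of the numerator lie between 0 and 4 (eta H)^2, so the divisor brings the increments
    into the range of [self_normalized_tail]. *)
Definition var_incr h s a p (o : obs S H) : R :=
  if visit p o h s a then
    (dev h s a (p, o) ^+ 2 - varV h s a) / (16 * (eta * H%:R) ^+ 2)
  else 0.

Let Bsq : 0 < (eta * H%:R) ^+ 2. Proof. by rewrite exprn_gt0. Qed.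

Lemma mean_le h s a (f : S -> R) c : (forall s', f s' <= c) ->
  \sum_s' trans M h s a s' * f s' <= c.
Proof.
have [P0 P1] := transP M h s a => fc.
rewrite -[leRHS]mul1r -[X in _ <= X * _]P1 mulr_suml; apply: ler_sum => s' _.
by rewrite ler_wpM2l.
Qed.

Lemma mean_ge0 h s a (f : S -> R) : (forall s', 0 <= f s') ->
  0 <= \sum_s' trans M h s a s' * f s'.
Proof.
have [P0 _] := transP M h s a => f0.
by apply: sumr_ge0 => s' _; rewrite mulr_ge0.
Qed.

Lemma dev_sqr_le h s a x : dev h s a x ^+ 2 <= 4 * (eta * H%:R) ^+ 2.
Proof.
rewrite -[leLHS]real_normK ?num_real //.
have -> : 4 * (eta * H%:R) ^+ 2 = (2 * (eta * H%:R)) ^+ 2 by ring.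
by rewrite lerXn2r ?nnegrE ?dev_abs_le // mulr_ge0 // ltW.
Qed.

Lemma varV_bounds h s a : 0 <= varV h s a <= 4 * (eta * H%:R) ^+ 2.
Proof.
apply/andP; split; first by apply: mean_ge0 => s'; exact: sqr_ge0.
apply: mean_le => s'.
by have := dev_sqr_le h s a ([::], [ffun=> s']); rewrite /dev ffunE.
Qed.

Lemma varVE h s a : varV h s a = meanSqV h s a - meanV h s a ^+ 2.
Proof.
have [P0 P1] := transP M h s a.
transitivity (\sum_s' (trans M h s a s' * optV (next h) s' ^+ 2 -
   2 * meanV h s a * (trans M h s a s' * optV (next h) s') +
   trans M h s a s' * meanV h s a ^+ 2)).
  by apply: eq_bigr => s' _; ring.
rewrite big_split /= sumrB -mulr_sumr -mulr_suml P1 -/(meanV h s a).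
by rewrite -/(meanSqV h s a); ring.
Qed.

Lemma var_incr_mean h s a p :
  \sum_o ep_prob M (grd p) o * var_incr h s a p o = 0.
Proof.
apply: (ep_mean_eq0 (c := fun s1 s2 =>
  if (s1 == s) && (grd p h s == a) then
    ((optV (next h) s2 - meanV h s a) ^+ 2 - varV h s a) /
      (16 * (eta * H%:R) ^+ 2) else 0)) => s1.
case: (boolP (_ && _)) => [/andP[/eqP-> /eqP ->]|_]; last first.
  by apply: big1 => s2 _; rewrite mulr0.
have [P0 P1] := transP M h s a.
under eq_bigr do rewrite mulrA mulrBr.
by rewrite -mulr_suml sumrB -[X in _ - X]mulr_suml P1 mul1r subrr mul0r.
Qed.

Lemma var_incr_le h s a p o : `|var_incr h s a p o| <= 4^-1.
Proof.
rewrite /var_incr; case: ifP => _; last by rewrite normr0 invr_ge0.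
have /andP[v0 v1] := varV_bounds h s a.
have d1 := dev_sqr_le h s a (p, o); have d0 := sqr_ge0 (dev h s a (p, o)).
have B16 : 0 < 16 * (eta * H%:R) ^+ 2 by rewrite mulr_gt0.
rewrite normrM [X in _ * X]ger0_norm ?invr_ge0 ?(ltW B16) //.
rewrite ler_pdivrMr // ler_norml; apply/andP; split; lra.
Qed.

(** Numbers d, v in [0, 4Q] satisfy (d - v)^2 <= 4Q (d + v), so the quadratic part of the tail bound
    is absorbed into first powers. What remains is 3 D <= 5 V + 64 Q u. *)
Lemma sum_dev_sqr_le p h s a : in_range (var_incr h s a) p ->
  \sum_(x <- visits p h s a) dev h s a x ^+ 2 <=
  2 * ((size (visits p h s a))%:R * varV h s a) + 24 * (eta * H%:R) ^+ 2 * u.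
Proof.
move=> /in_range_lt; set Q := (eta * H%:R) ^+ 2.
have Q0 : 0 < Q by exact: Bsq.
have /andP[v0 v1] := varV_bounds h s a.
have -> : psum (var_incr h s a) p =
    (\sum_(x <- visits p h s a) dev h s a x ^+ 2 -
      (size (visits p h s a))%:R * varV h s a) / (16 * Q).
  rewrite (psum_visit _ _ _ _ _ _ _ (fun q o =>
    (dev h s a (q, o) ^+ 2 - varV h s a) / (16 * Q))).
  by rewrite -mulr_suml sumrB big_const_seq count_predT iter_addr addr0
    -[varV h s a *+ _]mulr_natl.
have : psum (fun q o => var_incr h s a q o ^+ 2) p <=
    (\sum_(x <- visits p h s a) dev h s a x ^+ 2 +
      (size (visits p h s a))%:R * varV h s a) / (64 * Q).
  pose F q (o : obs S H) : R := (dev h s a (q, o) ^+ 2 + varV h s a) / (64 * Q).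
  apply: le_trans (_ : psum (fun q o => if visit q o h s a then F q o else 0) p <= _).
    apply: psum_le_all => q o; rewrite /var_incr /F; case: ifP => _; last by rewrite expr0n.
    have d1 := dev_sqr_le h s a (q, o); have d0 := sqr_ge0 (dev h s a (q, o)).
    rewrite -/Q in d1 v1 *; set d := dev _ _ _ _ ^+ 2 in d1 d0 *.
    set v := varV h s a in v0 v1 *.
    have alg (y : R) : 0 < y ->
        ((d - v) / (16 * y)) ^+ 2 = (d - v) ^+ 2 / (256 * y ^+ 2) /\
        (d + v) / (64 * y) = (4 * y * (d + v)) / (256 * y ^+ 2).
      by move=> y0; split; field; rewrite gt_eqF.
    have [-> ->] := alg Q Q0.
    have Q2 : 0 < 256 * Q ^+ 2 by apply: mulr_gt0 => //; exact: exprn_gt0 Q0.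
    rewrite ler_pM2r ?invr_gt0 //.
    have h1 : 0 <= (4 * Q - d) * d by rewrite mulr_ge0 // subr_ge0.
    have h2 : 0 <= (4 * Q - v) * v by rewrite mulr_ge0 // subr_ge0.
    have h3 : 0 <= d * v by rewrite mulr_ge0.
    lra.
  rewrite (psum_visit M 0 eta ell 1 1 tie F p h s a) /F.
  by rewrite -mulr_suml big_split /= big_const_seq count_predT iter_addr addr0
    -[varV h s a *+ _]mulr_natl.
set D := \sum_(x <- _) _; set V := _ * varV h s a; set Z := psum _ _ => hZ hD.
have : (D - V) / (16 * Q) - (D + V) / (64 * Q) <= u by lra.
have alg (y : R) : 0 < y ->
    (D - V) / (16 * y) - (D + V) / (64 * y) = (3 * D - 5 * V) / (64 * y).
  by move=> y0; field; rewrite gt_eqF.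
rewrite (alg Q Q0).
have Q64 : 0 < 64 * Q by apply: mulr_gt0.
rewrite ler_pdivrMr // => hh.
have V0 : 0 <= V by rewrite mulr_ge0.
have Qu : 0 <= Q * u by rewrite mulr_ge0 ?(ltW Q0) //; apply: le_trans u1.
by clearbody D V; lra.
Qed.

(** With [c] a bound on [Y], at most K squared increments add up to 1/16 or less, and the
    self-normalized bound becomes one of Azuma-Hoeffding type. *)
Definition scaled (Y : seq (obs S H) -> obs S H -> R) (c : R) p o : R :=
  Y p o / (4 * c * Num.sqrt K%:R).

Let sqrtK1 : 1 <= Num.sqrt K%:R :> R.
Proof. by rewrite -[leLHS]sqrtr1 ler_wsqrtr // ler1n. Qed.

Lemma scaled_le Y c p o : 0 < c -> `|Y p o| <= c ->
  `|scaled Y c p o| <= (4 * Num.sqrt K%:R)^-1.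
Proof.
move=> c0 Yc; have K0 : 0 < Num.sqrt K%:R :> R := lt_le_trans ltr01 sqrtK1.
have d0 : 0 < 4 * c * Num.sqrt K%:R by rewrite !mulr_gt0.
rewrite /scaled normrM [X in _ * X]ger0_norm ?invr_ge0 ?(ltW d0) //.
rewrite ler_pdivrMr //.
have -> : (4 * Num.sqrt K%:R)^-1 * (4 * c * Num.sqrt K%:R) = c.
  by field; rewrite gt_eqF.
exact: Yc.
Qed.

Lemma scaled_le4 Y c p o : 0 < c -> `|Y p o| <= c -> `|scaled Y c p o| <= 4^-1.
Proof.
move=> c0 Yc; apply: le_trans (scaled_le c0 Yc) _.
rewrite lef_pV2 ?posrE ?mulr_gt0 // ?(lt_le_trans ltr01 sqrtK1) //.
by rewrite -[leLHS]mulr1 ler_pM2l.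
Qed.

Lemma psum_scaled_le Y c p : 0 < c -> (forall q o, `|Y q o| <= c) ->
  (size p <= K)%N -> in_range (scaled Y c) p ->
  psum Y p <= 5 * c * Num.sqrt K%:R * u.
Proof.
move=> c0 Yc pK /in_range_lt.
have K0 : 0 < Num.sqrt K%:R :> R := lt_le_trans ltr01 sqrtK1.
have KR : 0 < K%:R :> R by rewrite ltr0n.
have d0 : 0 < 4 * c * Num.sqrt K%:R by rewrite !mulr_gt0.
have -> : psum (scaled Y c) p = psum Y p / (4 * c * Num.sqrt K%:R).
  rewrite [RHS]mulrC -psumZ; elim: (p) => //= o q ->.
  by congr (_ + _); exact: mulrC.
have : psum (fun q o => scaled Y c q o ^+ 2) p <= 16^-1.
  apply: le_trans (_ : psum (fun _ (_ : obs S H) => (16 * K%:R)^-1) p <= _).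
    apply: psum_le_all => q o.
    rewrite -[leLHS]real_normK ?num_real //.
    have -> : (16 * K%:R)^-1 = ((4 * Num.sqrt K%:R)^-1) ^+ 2 :> R.
      rewrite exprVn exprMn sqr_sqrtr ?ler0n //; congr (_^-1); ring.
    have sc := scaled_le c0 (Yc q o).
    by rewrite lerXn2r ?nnegrE // invr_ge0 mulr_ge0 // ltW.
  rewrite psum_cst invfM mulrCA ler_piMr ?invr_ge0 //.
  by rewrite ler_pdivrMr // mul1r ler_nat.
set Z := psum _ p => hZ hY.
have : psum Y p / (4 * c * Num.sqrt K%:R) <= u + 16^-1 by lra.
rewrite ler_pdivrMr // => hh; apply: le_trans hh _.
have -> : 5 * c * Num.sqrt K%:R * u = (5 / 4 * u) * (4 * c * Num.sqrt K%:R) by field.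
by rewrite ler_pM2r //; have := u1; lra.
Qed.

Definition ep_total p o : R := \sum_(h < H) ep_gap h p o.

Definition mean_total p : R := \sum_o ep_prob M (grd p) o * ep_total p o.

Definition regret_dev p o : R := mean_total p - ep_total p o.

Definition sqV_dev p (o : obs S H) : R :=
  \sum_(h < H) (meanSqV h (state_at M o h) (grd p h (state_at M o h)) -
     optV (next h) (o h) ^+ 2).

Lemma ep_total_bounds p o : 0 <= ep_total p o <= 2 * (eta * H%:R) * H%:R.
Proof.
apply/andP; split; first by apply: sumr_ge0 => h _; exact: gap_ge0.
apply: le_trans (_ : \sum_(h < H) 2 * (eta * H%:R) <= _).
  by apply: ler_sum => h _; exact: gap_le.
by rewrite sumr_const card_ord [leRHS]mulr_natr.
Qed.

Lemma regret_dev_le p o : `|regret_dev p o| <= 2 * (eta * H%:R) * H%:R.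
Proof.
have /andP[t0 t1] := ep_total_bounds p o.
have [P0 P1] := ep_prob_dist M (grd p).
have m0 : 0 <= mean_total p.
  apply: sumr_ge0 => o' _; rewrite mulr_ge0 //.
  by have /andP[] := ep_total_bounds p o'.
have m1 : mean_total p <= 2 * (eta * H%:R) * H%:R.
  rewrite -[leRHS]mul1r -[X in _ <= X * _]P1 mulr_suml; apply: ler_sum => o' _.
  by rewrite ler_wpM2l //; have /andP[] := ep_total_bounds p o'.
by rewrite ler_norml /regret_dev; apply/andP; split; lra.
Qed.

Lemma regret_dev_mean p : \sum_o ep_prob M (grd p) o * regret_dev p o = 0.
Proof.
have [P0 P1] := ep_prob_dist M (grd p).
under eq_bigr do rewrite mulrBr.
by rewrite sumrB -mulr_suml P1 mul1r subrr.
Qed.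

Lemma sqV_bounds j s : 0 <= optV j s ^+ 2 <= (eta * H%:R) ^+ 2.
Proof.
rewrite sqr_ge0 /= -[leLHS]real_normK ?num_real //.
by rewrite lerXn2r ?nnegrE ?optV_abs_le // ltW.
Qed.

Lemma sqV_dev_le p o : `|sqV_dev p o| <= (eta * H%:R) ^+ 2 * H%:R.
Proof.
apply: le_trans (ler_norm_sum _ _ _) _.
apply: le_trans (_ : \sum_(h < H) (eta * H%:R) ^+ 2 <= _); last first.
  by rewrite sumr_const card_ord [leRHS]mulr_natr.
apply: ler_sum => h _.
set s := state_at M o h; set a := grd p h s.
have m0 : 0 <= meanSqV h s a by apply: mean_ge0 => s'; exact: sqr_ge0.
have m1 : meanSqV h s a <= (eta * H%:R) ^+ 2.
  by apply: mean_le => s'; have /andP[] := sqV_bounds (next h) s'.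
have /andP[v0 v1] := sqV_bounds (next h) (o h).
by rewrite ler_norml; apply/andP; split; lra.
Qed.

Lemma sqV_dev_mean p : \sum_o ep_prob M (grd p) o * sqV_dev p o = 0.
Proof.
under eq_bigr do rewrite mulr_sumr.
rewrite exchange_big /=; apply: big1 => h _.
apply: (ep_mean_eq0 (c := fun s s' => meanSqV h s (grd p h s) - optV (next h) s' ^+ 2)) => s.
have [P0 P1] := transP M h s (grd p h s).
under eq_bigr do rewrite mulrBr.
by rewrite sumrB -mulr_suml P1 mul1r /meanSqV subrr.
Qed.

(** A pathwise law of total variance. With [meanV] written as [optV] minus gap and reward, the
    squares of [optV] telescope up to [sqV_dev]. The cross term is at most 2 eta H times the gap
    plus eta, and the etas over the epochs give 2 (eta H)^2. *)
Lemma sum_varV_le q o :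
  \sum_(h < H) varV h (state_at M o h) (grd q h (state_at M o h)) <=
  sqV_dev q o + 2 * (eta * H%:R) * ep_total q o + 2 * (eta * H%:R) ^+ 2.
Proof.
have := telescope_path M (fun j s => optV j s ^+ 2) o.
rewrite optV_max expr0n sub0r => tel.
have v0 := sqr_ge0 (optV ord0 (start M)).
suff : \sum_(h < H) varV h (state_at M o h) (grd q h (state_at M o h)) <=
   sqV_dev q o + \sum_(h < H) (optV (next h) (o h) ^+ 2 - optV (this h) (state_at M o h) ^+ 2)
   + (2 * (eta * H%:R) * ep_total q o + \sum_(h < H) (2 * (eta * H%:R) * eta)).
  have -> : \sum_(h < H) (2 * (eta * H%:R) * eta) = 2 * (eta * H%:R) ^+ 2.
    by rewrite sumr_const card_ord -[LHS]mulr_natr; ring.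
  by rewrite tel; lra.
rewrite mulr_sumr -!big_split /=; apply: ler_sum => h _.
rewrite varVE /ep_gap; set s := state_at M o h; set a := grd q h s.
have g0 := gap_ge0 M rho a0 h s a.
have -> : meanV h s a = optV (this h) s - (gap M rho a0 h s a + rho s a).
  by rewrite /gap /optQ; ring.
set g := gap _ _ _ _ _ _ in g0 *; set V := optV (this h) s.
have V1 : `|V| <= eta * H%:R by exact: optV_abs_le.
have key : V * (g + rho s a) <= eta * H%:R * (g + eta).
  apply: le_trans (ler_norm _) _; rewrite normrM; apply: ler_pM => //.
  by apply: le_trans (ler_normD _ _) _; rewrite ger0_norm // lerD2l rhoB.
have := sqr_ge0 (g + rho s a).
by clearbody V g; lra.
Qed.

Definition run_ok p : Prop :=
  [/\ noise_ok p, (forall h s a, in_range (var_incr h s a) p),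
      in_range (scaled regret_dev (2 * (eta * H%:R) * H%:R)) p &
      in_range (scaled sqV_dev ((eta * H%:R) ^+ 2 * H%:R)) p].

Lemma run_ok_cons o p : run_ok (o :: p) -> run_ok p.
Proof.
case=> n v r s; split; first exact: noise_ok_cons n.
- by move=> h s' a; apply: in_range_cons (v h s' a).
- exact: in_range_cons r.
- exact: in_range_cons s.
Qed.

Definition slack_bound : R := H.+1%:R * (expR 3 * coarse_cost).

Definition var_slop : R :=
  48 * (eta * H%:R) ^+ 2 * u + 4 * (eta * H%:R) * slack_bound.

Lemma psum_slack_ge0 p j : noise_ok p -> 0 <= psum (ep_slack j) p.
Proof.
move=> pok; rewrite -(mulr0 (size p)%:R) -(psum_cst 0 p).
apply: (psum_le (P := noise_ok)) => // o q; first exact: noise_ok_cons.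
by move/noise_ok_cons; exact: ep_slack_ge0.
Qed.

Lemma coarse_bounds p : noise_ok p ->
  \sum_(h < H) psum (ep_gap h) p <= expR 3 * coarse_cost /\
  (forall j, psum (ep_slack j) p <= slack_bound).
Proof.
move=> pok; have main := psum_gap_slack_le pok.
have hc : expR 3 * \sum_(h < H) psum (ep_cost h) p <= expR 3 * coarse_cost.
  by rewrite ler_pM2l ?expR_gt0 // psum_cost_le_coarse.
have g0 : 0 <= \sum_(h < H) psum (ep_gap h) p.
  by apply: sumr_ge0 => h _; apply: psum_ge0 => q o; exact: gap_ge0.
have s0 : 0 <= \sum_j psum (ep_slack j) p.
  by apply: sumr_ge0 => j _; exact: psum_slack_ge0.
split=> [|j].
  apply: le_trans hc; apply: le_trans main.
  by rewrite lerDl mulr_ge0 // invr_ge0.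
rewrite /slack_bound -ler_pdivrMl ?ltr0n //.
apply: le_trans hc; apply: le_trans main.
apply: le_trans (_ : (H.+1%:R)^-1 * \sum_j psum (ep_slack j) p <= _); last first.
  by rewrite lerDr.
rewrite ler_pM2l ?invr_gt0 ?ltr0n // (bigD1 j) //= lerDl.
by apply: sumr_ge0 => i _; exact: psum_slack_ge0.
Qed.

Lemma sum_excess_le p h s a : noise_ok p ->
  \sum_(x <- visits p h s a) excess h x <= slack_bound.
Proof.
move=> pok; have [_ /(_ (next h))] := coarse_bounds pok; apply: le_trans.
have [_ px] := optimism pok.1 pok.2.
rewrite (psum_visits M 0 eta ell 1 1 tie _ p h).
have ex0 s' a' : 0 <= \sum_(x <- visits p h s' a') excess h x.
  by rewrite big_seq; apply: sumr_ge0 => x xx; have /andP[] := excess_bounds (px h s' a') xx.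
have E s' a' : \sum_(x <- visits p h s' a') ep_slack (next h) x.1 x.2 =
    \sum_(x <- visits p h s' a') excess h x.
  by apply: eq_bigr => -[q o] _; rewrite excess_slack.
rewrite (bigD1 s) //= (bigD1 a) //= E -addrA lerDl addr_ge0 //.
  by apply: sumr_ge0 => a' _; rewrite E.
by apply: sumr_ge0 => s' _; apply: sumr_ge0 => a' _; rewrite E.
Qed.

(** The square of [dev + excess] is at most [2 * dev ^+ 2 + 4 * eta * H * excess]. The total excess
    is bounded by the first pass whatever the number of visits, so dividing by that number leaves a
    correction of order 1/n. *)
Lemma emp_var_next_le_var p h s a : run_ok p -> (0 < size (visits p h s a))%N ->
  emp_var (next_value h) (visits p h s a) <=
  4 * varV h s a + var_slop / (size (visits p h s a))%:R.
Proof.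
case=> pok pv _ _ n0.
have [_ px] := optimism pok.1 pok.2.
have nR : 0 < (size (visits p h s a))%:R :> R by rewrite ltr0n.
apply: le_trans (emp_var_le _ (meanV h s a) n0) _.
rewrite ler_pdivrMr // mulrDl divfK ?gt_eqF //.
apply: le_trans (_ : 2 * \sum_(x <- visits p h s a) dev h s a x ^+ 2 +
    4 * (eta * H%:R) * \sum_(x <- visits p h s a) excess h x <= _).
  rewrite !mulr_sumr -big_split /= big_seq [leRHS]big_seq; apply: ler_sum => x xx.
  have /andP[e0 e1] := excess_bounds (px h s a) xx.
  have -> : next_value h x - meanV h s a = dev h s a x + excess h x.
    by rewrite (next_valueE xx); ring.
  have := sqr_ge0 (dev h s a x - excess h x).
  have : 0 <= excess h x * (2 * (eta * H%:R) - excess h x) by rewrite mulr_ge0 // subr_ge0.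
  by lra.
have h1 := sum_dev_sqr_le (pv h s a).
have h2 : 4 * (eta * H%:R) * \sum_(x <- visits p h s a) excess h x <=
   4 * (eta * H%:R) * slack_bound.
  by rewrite ler_wpM2l ?sum_excess_le // mulr_ge0 // ltW.
by rewrite /var_slop; move: h1 h2; lra.
Qed.

(** The root is split so that everything except the true variance decays like 1/t and sums to a
    logarithm. *)
Definition fine_bonus h s a (t : nat) : R :=
  Num.sqrt (H%:R * ell) * (Num.sqrt (4 * varV h s a + eta * H%:R) * (Num.sqrt t%:R)^-1
    + Num.sqrt var_slop * t%:R^-1)
  + eta * (Num.sqrt (H%:R ^+ 7 * #|S|%:R * #|A|%:R) * ell) * t%:R^-1.

Let slop0 : 0 <= var_slop.
Proof.
have u0 := le_trans ler01 u1.
have c0 : 0 <= coarse_cost.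
  rewrite /coarse_cost; apply: mulr_ge0; first by rewrite !mulr_ge0.
  apply: addr_ge0; first by rewrite mulr_ge0 // ltW.
  by rewrite !mulr_ge0 ?sqrtr_ge0 // ltW.
apply: addr_ge0; first by rewrite mulr_ge0 // mulr_ge0 // ltW.
by apply: mulr_ge0; [rewrite mulr_ge0 // ltW|rewrite /slack_bound mulr_ge0 // mulr_ge0 ?expR_ge0].
Qed.

Lemma bonus_le_fine p h s a : run_ok p ->
  bonus p h s a <= fine_bonus h s a (size (visits p h s a)).
Proof.
move=> pok; have /andP[v0 _] := varV_bounds h s a.
have x0 : 0 <= 4 * varV h s a + eta * H%:R by rewrite addr_ge0 ?mulr_ge0 // ltW.
rewrite bonusE; case: ifP => n0; last first.
  rewrite /fine_bonus addr_ge0 // mulr_ge0 ?sqrtr_ge0 ?invr_ge0 //.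
    by rewrite addr_ge0 // mulr_ge0 ?sqrtr_ge0 ?invr_ge0 ?sqrtr_ge0.
  by rewrite !mulr_ge0 ?sqrtr_ge0 // ltW.
have nR : 0 < (size (visits p h s a))%:R :> R by rewrite ltr0n.
have := emp_var_next_le_var pok n0; rewrite /bonus_beta !mul1r.
rewrite tabN_after tabmu_after tabsigma_after -/(emp_var _ _).
set t := size _ in n0 nR *; set W := emp_var _ _ => hW.
rewrite ge_min; apply/orP; left.
have -> : eta * (Num.sqrt (H%:R ^+ 7 * #|S|%:R * #|A|%:R) * ell / t%:R) =
   eta * (Num.sqrt (H%:R ^+ 7 * #|S|%:R * #|A|%:R) * ell) * t%:R^-1 by ring.
rewrite lerD2r.
have -> : H%:R / t%:R * (W + eta * H%:R) * ell = H%:R * ell * ((W + eta * H%:R) / t%:R) by ring.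
rewrite sqrtrM; last by rewrite mulr_ge0 // ltW.
apply: ler_wpM2l; first exact: sqrtr_ge0.
have tV : (Num.sqrt t%:R)^-1 = Num.sqrt (t%:R^-1) :> R by rewrite sqrtrV.
have tV2 : t%:R^-1 = Num.sqrt (t%:R^-1 ^+ 2) :> R.
  by rewrite sqrtr_sqr ger0_norm // invr_ge0 ltW.
have -> : Num.sqrt (4 * varV h s a + eta * H%:R) * (Num.sqrt t%:R)^-1 =
    Num.sqrt ((4 * varV h s a + eta * H%:R) * t%:R^-1) by rewrite tV -sqrtrM.
have -> : Num.sqrt var_slop * t%:R^-1 = Num.sqrt (var_slop * t%:R^-1 ^+ 2).
  by rewrite {1}tV2 -sqrtrM.
have sub (x y : R) : 0 <= x -> 0 <= y -> Num.sqrt (x + y) <= Num.sqrt x + Num.sqrt y.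
  move=> hx hy; rewrite -[leRHS]ger0_norm ?addr_ge0 ?sqrtr_ge0 // -sqrtr_sqr.
  rewrite ler_wsqrtr // sqrrD !sqr_sqrtr //.
  by have := mulr_ge0 (sqrtr_ge0 x) (sqrtr_ge0 y); lra.
have s1 : 0 <= (4 * varV h s a + eta * H%:R) * t%:R^-1.
  by rewrite mulr_ge0 // invr_ge0 ltW.
have s2 : 0 <= var_slop * t%:R^-1 ^+ 2 by rewrite mulr_ge0 // sqr_ge0.
apply: le_trans (sub _ _ s1 s2); rewrite ler_wsqrtr //.
have -> : (4 * varV h s a + eta * H%:R) * t%:R^-1 + var_slop * t%:R^-1 ^+ 2 =
  (4 * varV h s a + var_slop / t%:R + eta * H%:R) / t%:R by ring.
by rewrite ler_pM2r ?invr_gt0 // lerD2r.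
Qed.

(** Cauchy-Schwarz by the inequality of means, with the common comparison value [c] that each root
    would have if all terms were equal to Y / #|J|. *)
Lemma sum_sqrt_le (J : finType) (x : J -> R) (Y : R) :
  (forall j, 0 <= x j) -> 0 < Y -> \sum_j x j <= Y ->
  \sum_j Num.sqrt (x j) <= Num.sqrt (#|J|%:R * Y).
Proof.
move=> x0 Y0 xY; case: (posnP #|J|) => [J0|J0].
  rewrite big_pred0 ?sqrtr_ge0 // => j.
  by have := card0_eq J0 j; rewrite inE.
have JR : 0 < #|J|%:R :> R by rewrite ltr0n.
pose c := Num.sqrt (Y / #|J|%:R).
have c0 : 0 < c by rewrite sqrtr_gt0 divr_gt0.
have c2 : c ^+ 2 = Y / #|J|%:R by rewrite sqr_sqrtr // divr_ge0 ?ltW.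
have amgm j : Num.sqrt (x j) <= (x j / c + c) / 2.
  have -> : (x j / c + c) / 2 = (x j + c ^+ 2) / (2 * c) by field; rewrite gt_eqF.
  rewrite ler_pdivlMr ?mulr_gt0 // -{2}(sqr_sqrtr (x0 j)).
  by have := sqr_ge0 (Num.sqrt (x j) - c); lra.
apply: le_trans (_ : \sum_j (x j / c + c) / 2 <= _).
  by apply: ler_sum => j _; exact: amgm.
rewrite -mulr_suml big_split /= -mulr_suml sumr_const -[c *+ _]mulr_natl.
have -> : Num.sqrt (#|J|%:R * Y) = #|J|%:R * c.
  have -> : #|J|%:R * Y = #|J|%:R ^+ 2 * (Y / #|J|%:R) by field; rewrite gt_eqF.
  by rewrite sqrtrM ?sqr_ge0 // sqrtr_sqr ger0_norm.
have : (\sum_j x j) / c <= #|J|%:R * c.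
  rewrite ler_pdivrMr // -mulrA -expr2 c2 mulrCA mulfV ?gt_eqF //.
  by rewrite mulr1.
by lra.
Qed.

(** [Y] is a budget for [4 * varV + eta * H] summed over all epochs of all episodes. Since summing
    1/sqrt t over the visits gives a root of the count, Cauchy-Schwarz over the H S A triples turns
    it into sqrt (H S A Y). *)
Lemma psum_regret_le p (Y : R) : run_ok p -> 0 < Y ->
  4 * (5 * ((eta * H%:R) ^+ 2 * H%:R) * Num.sqrt K%:R * u) +
    8 * (eta * H%:R) * (expR 3 * coarse_cost) +
    K%:R * (8 * (eta * H%:R) ^+ 2 + eta * H%:R * H%:R) <= Y ->
  psum (fun q _ => mean_total q) p <=
  expR 3 * (H%:R * #|S|%:R * #|A|%:R * (2 * (eta * H%:R)) +
    2 * Num.sqrt (H%:R * ell) * Num.sqrt (H%:R * #|S|%:R * #|A|%:R * Y) +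
    H%:R * #|S|%:R * #|A|%:R * (1 + ln K%:R) *
      (Num.sqrt (H%:R * ell) * Num.sqrt var_slop +
       eta * (Num.sqrt (H%:R ^+ 7 * #|S|%:R * #|A|%:R) * ell))) +
  10 * (eta * H%:R) * H%:R * Num.sqrt K%:R * u.
Proof.
move=> pok Y0 hY; have [nok _ pr ps] := pok.
have HR0 : 0 < H%:R :> R by rewrite ltr0n.
have [gapc _] := coarse_bounds nok.
have main := psum_gap_slack_le nok.
have s0 : 0 <= (H.+1%:R)^-1 * \sum_j psum (ep_slack j) p.
  rewrite mulr_ge0 ?invr_ge0 //.
  by apply: sumr_ge0 => j _; exact: psum_slack_ge0.
have regE : psum (fun q _ => mean_total q) p =
    psum regret_dev p + \sum_(h < H) psum (ep_gap h) p.
  rewrite -psum_sum -psumD; congr psum; apply/funext => q; apply/funext => o.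
  by rewrite /regret_dev /ep_total; ring.
have reg1 : psum regret_dev p <= 10 * (eta * H%:R) * H%:R * Num.sqrt K%:R * u.
  have c0 : 0 < 2 * (eta * H%:R) * H%:R by rewrite mulr_gt0 // mulr_gt0.
  by have := psum_scaled_le c0 regret_dev_le nok.2 pr; lra.
pose n h s a := size (visits p h s a).
pose x (j : 'I_H * S * A) : R :=
  (n j.1.1 j.1.2 j.2)%:R * (4 * varV j.1.1 j.1.2 j.2 + eta * H%:R).
have x0 j : 0 <= x j.
  have /andP[v0 _] := varV_bounds j.1.1 j.1.2 j.2.
  by rewrite mulr_ge0 // addr_ge0 ?mulr_ge0 // ltW.
have sumx : \sum_j x j <= Y.
  apply: le_trans hY.
  have -> : \sum_j x j = psum (fun q o => \sum_(h < H)
      (4 * varV h (state_at M o h) (grd q h (state_at M o h)) + eta * H%:R)) p.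
    rewrite psum_sum.
    under [RHS]eq_bigr => h _ do rewrite (psum_visits M 0 eta ell 1 1 tie _ p h).
    rewrite pair_big pair_big /=; apply: eq_bigr => -[[h s] a] _ /=.
    rewrite (eq_big_seq (fun=> 4 * varV h s a + eta * H%:R)) => [|y yx].
      by rewrite big_const_seq count_predT iter_addr addr0 /x /= mulr_natl.
    by have [-> ->] := visits_mem yx.
  apply: le_trans (_ : psum (fun q o => 4 * sqV_dev q o +
     8 * (eta * H%:R) * ep_total q o +
     (8 * (eta * H%:R) ^+ 2 + eta * H%:R * H%:R)) p <= _).
    apply: psum_le_all => q o; rewrite big_split /= -mulr_sumr sumr_const card_ord.
    rewrite -[_ *+ _]mulr_natr; have := sum_varV_le q o.
    by move: (\sum_(h < H) _) => z; lra.
  rewrite psumD psum_cst psumD !psumZ.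
  have c0 : 0 < (eta * H%:R) ^+ 2 * H%:R by rewrite mulr_gt0.
  have t1 := psum_scaled_le c0 sqV_dev_le nok.2 ps.
  have t2 : 8 * (eta * H%:R) * psum ep_total p <=
      8 * (eta * H%:R) * (expR 3 * coarse_cost).
    apply: ler_wpM2l; first by rewrite mulr_ge0 // ltW.
    by have -> : psum ep_total p = \sum_(h < H) psum (ep_gap h) p by exact: psum_sum.
  have t3 : (size p)%:R * (8 * (eta * H%:R) ^+ 2 + eta * H%:R * H%:R) <=
     K%:R * (8 * (eta * H%:R) ^+ 2 + eta * H%:R * H%:R).
    rewrite ler_wpM2r ?ler_nat ?nok.2 // addr_ge0 // mulr_ge0 // ltW //.
  by apply: lerD => //; apply: lerD => //; rewrite ler_pM2l.
have sq : \sum_j Num.sqrt (x j) <= Num.sqrt (H%:R * #|S|%:R * #|A|%:R * Y).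
  have := sum_sqrt_le x0 Y0 sumx.
  by rewrite !card_prod card_ord !natrM.
have cost : \sum_(h < H) psum (ep_cost h) p <=
    H%:R * #|S|%:R * #|A|%:R * (2 * (eta * H%:R)) +
    2 * Num.sqrt (H%:R * ell) * \sum_j Num.sqrt (x j) +
    H%:R * #|S|%:R * #|A|%:R * (1 + ln K%:R) *
      (Num.sqrt (H%:R * ell) * Num.sqrt var_slop +
       eta * (Num.sqrt (H%:R ^+ 7 * #|S|%:R * #|A|%:R) * ell)).
  pose c1 : R := 2 * (eta * H%:R).
  pose c2 : R := (1 + ln K%:R) * (Num.sqrt (H%:R * ell) * Num.sqrt var_slop +
       eta * (Num.sqrt (H%:R ^+ 7 * #|S|%:R * #|A|%:R) * ell)).
  apply: le_trans (_ : \sum_(j : 'I_H * S * A)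
     (c1 + 2 * Num.sqrt (H%:R * ell) * Num.sqrt (x j) + c2) <= _); last first.
    rewrite -(mulrA (H%:R * #|S|%:R * #|A|%:R) (1 + ln K%:R)) -/c1 -/c2.
    rewrite !big_split /= !sumr_const -mulr_sumr -[c1 *+ _]mulr_natl.
    rewrite -[c2 *+ _]mulr_natl.
    by rewrite !card_prod card_ord !natrM.
  apply: le_trans (_ : \sum_(h < H) \sum_s \sum_a (c1 +
     \sum_(0 <= t < n h s a) fine_bonus h s a t) <= _).
    apply: ler_sum => h _; apply: (psum_cost_le (g := fine_bonus)) => // s a y yx.
    apply: bonus_le_fine; exact: (visits_closed run_ok_cons pok) yx.
  rewrite pair_big pair_big /=; apply: ler_sum => -[[h s] a] _ /=.
  rewrite -addrA lerD2l /fine_bonus big_split /= -mulr_sumr big_split /= -!mulr_sumr.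
  have nK : (n h s a <= K)%N by apply: leq_trans nok.2; exact: size_visits_le.
  have /andP[v0 _] := varV_bounds h s a.
  set V := 4 * varV h s a + eta * H%:R.
  have V0 : 0 <= V by rewrite addr_ge0 ?mulr_ge0 // ltW.
  have i1 := sum_inv_sqrt_le R (n h s a).
  have i2 := sum_inv_le R nK K_gt0.
  have -> : Num.sqrt (x (h, s, a)) = Num.sqrt V * Num.sqrt (n h s a)%:R.
    by rewrite mulrC -sqrtrM.
  have j1 := ler_wpM2l (sqrtr_ge0 V) i1.
  have j2 := ler_wpM2l (sqrtr_ge0 var_slop) i2.
  have j3 := ler_wpM2l (sqrtr_ge0 (H%:R * ell)) (lerD j1 j2).
  have k0 : 0 <= eta * (Num.sqrt (H%:R ^+ 7 * #|S|%:R * #|A|%:R) * ell).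
    by rewrite !mulr_ge0 ?sqrtr_ge0 // ltW.
  have j4 := ler_wpM2l k0 i2.
  by rewrite /c2; move: j3 j4; lra.
rewrite regE addrC; apply: lerD => //.
apply: le_trans (_ : expR 3 * \sum_(h < H) psum (ep_cost h) p <= _).
  by apply: le_trans main; rewrite lerDl.
rewrite ler_pM2l ?expR_gt0 //; apply: le_trans cost _.
rewrite lerD2r lerD2l ler_wpM2l // mulr_ge0 ?sqrtr_ge0 //.
Qed.

End Optimism.

(** * The probability of a good run *)

Section GoodRuns.
Variables (R : realType) (S A : finType) (H I : nat) (M : pcmdp R S A H I).
Variables (eta ell u : R) (a0 : A) (gridsize K : nat).
Variable tie : seq (obs S H) -> 'I_H -> S -> (A -> R) -> A.

Local Notation rho := (mod_reward M 0 eta).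
Local Notation grd := (greedy M 0 eta ell 1 1 tie).

Hypothesis H_gt0 : (0 < H)%N.
Hypothesis K_gt0 : (0 < K)%N.
Hypothesis eta1 : 1 <= eta.
Hypothesis rhoB : forall s a, `|rho s a| <= eta.

(** In order: a scale and a sign for the noise of each triple, the squared noise of each triple, and
    the two martingales over whole episodes. A single type allows a single union bound. *)
Definition bad_index : finType :=
  ('I_gridsize.+1 * bool * ('I_H * S * A) + ('I_H * S * A) + bool)%type.

Definition incr (j : bad_index) : seq (obs S H) -> obs S H -> R :=
  match j with
  | inl (inl (g, neg, (h, s, a))) => noise_incr M eta ell a0 tie g neg h s a
  | inl (inr (h, s, a)) => var_incr M eta ell a0 tie h s a
  | inr true => scaled K (regret_dev M eta ell a0 tie) (2 * (eta * H%:R) * H%:R)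
  | inr false => scaled K (sqV_dev M eta ell a0 tie) ((eta * H%:R) ^+ 2 * H%:R)
  end.

Lemma card_bad_index : #|bad_index| =
  (gridsize.+1 * 2 * (H * #|S| * #|A|) + H * #|S| * #|A| + 2)%N.
Proof. by rewrite !card_sum !card_prod card_bool !card_ord. Qed.

Let B0 : 0 < eta * H%:R.
Proof. by rewrite mulr_gt0 ?ltr0n // (lt_le_trans ltr01 eta1). Qed.

Lemma scaled_mean Y c p : \sum_o ep_prob M (grd p) o * Y p o = 0 ->
  \sum_o ep_prob M (grd p) o * scaled K Y c p o = 0.
Proof.
move=> Y0; rewrite /scaled; under eq_bigr do rewrite mulrA.
by rewrite -mulr_suml Y0 mul0r.
Qed.

Lemma incr_mean j p : \sum_o ep_prob M (grd p) o * incr j p o = 0.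
Proof.
case: j => [[[[g neg] [[h s] a]]|[[h s] a]]|[]] /=.
- exact: noise_incr_mean.
- exact: var_incr_mean.
- by apply: scaled_mean; exact: regret_dev_mean.
- by apply: scaled_mean; exact: sqV_dev_mean.
Qed.

Lemma incr_le j p o : `|incr j p o| <= 4^-1.
Proof.
have H0 : 0 < H%:R :> R by rewrite ltr0n.
case: j => [[[[g neg] [[h s] a]]|[[h s] a]]|[]] /=.
- exact: noise_incr_le.
- exact: var_incr_le.
- apply: scaled_le4 => //; first by rewrite !mulr_gt0 // (lt_le_trans ltr01 eta1).
  exact: regret_dev_le.
- apply: scaled_le4 => //; first by rewrite mulr_gt0 // exprn_gt0.
  exact: sqV_dev_le.
Qed.

Lemma run_ok_prob :
  1 - #|bad_index|%:R * expR (- u) <=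
  run_mean (fun p => ep_prob M (grd p)) K [::]
    (fun p => [forall j, in_range u (incr j) p]%:R).
Proof.
apply: union_hit_le => [p|j]; first exact: ep_prob_dist.
apply: self_normalized_tail => [p|p|p o]; first exact: ep_prob_dist.
  exact: incr_mean.
exact: incr_le.
Qed.

Lemma run_okP p : (size p <= K)%N -> [forall j, in_range u (incr j) p] ->
  run_ok M eta ell u a0 gridsize K tie p.
Proof.
move=> pK /forallP ok; split; first split=> //.
- move=> j neg h s a jm.
  have jlt : (j < gridsize.+1)%N by [].
  exact: (ok (inl (inl (Ordinal jlt, neg, (h, s, a))))).
- by move=> h s a; exact: (ok (inl (inr (h, s, a)))).
- exact: (ok (inr true)).
- exact: (ok (inr false)).
Qed.

Lemma Prun_ge (good : pred (seq (obs S H))) (E : pred (K.-tuple (obs S H))) :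
  (forall w : K.-tuple (obs S H), good (rev w) -> E w) ->
  run_mean (fun p => ep_prob M (grd p)) K [::] (fun p => (good p)%:R) <=
  Prun M 0 eta ell 1 1 tie E.
Proof.
move=> gE; rewrite -run_mean_tuple /Prun [leRHS]big_mkcond /=.
apply: ler_sum => w _; rewrite cats0.
have -> : \prod_(k < K) ep_prob M (grd (rev (take k w) ++ [::])) (tnth w k) =
    run_prob M 0 eta ell 1 1 tie w.
  by apply: eq_bigr => k _; rewrite cats0.
have r0 : 0 <= run_prob M 0 eta ell 1 1 tie w.
  by apply: prodr_ge0 => k _; apply: prodr_ge0 => h _; apply: (transP _ _ _ _).1.
case: (boolP (good (rev w))) => [/gE ->|_]; first by rewrite mulr1.
by rewrite mulr0; case: ifP.
Qed.

Lemma mean_totalE p :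
  mean_total M eta ell a0 tie p =
  optV M rho a0 ord0 (start M) -
    Etraj M (det_policy R (grd p)) (fun w => \sum_(h < H) at_epoch M rho h w).
Proof. by rewrite perf_diff. Qed.

End GoodRuns.

(** * Penalized values against constrained values *)

Section Values.
Variables (R : realType) (S A : finType) (H I : nat) (M : pcmdp R S A H I).
Variables (eta : R) (a0 : A).
Hypothesis eta1 : 1 <= eta.
Hypothesis I_gt0 : (0 < I)%N.
Hypothesis bounded : bounded_pcmdp M.
Hypothesis nonneg : nonneg_reward M.

Local Notation rho := (mod_reward M 0 eta).

Definition violation pi : R := \sum_(h < H) \sum_(i < I)
  Etraj M pi (at_epoch M (fun s a => `|negpart (gfun M 0 i s a)|) h).

Lemma negpart_gfun i s a :
  negpart (gfun M 0 i s a) = negpart (constr M i s a) /\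
  -1 <= negpart (constr M i s a) <= 0.
Proof.
have [_ /(_ i s a)] := bounded; rewrite ltr_norml => /andP[c1 c2].
rewrite /gfun /negpart addr0; split.
  by rewrite minEle; case: (lerP (constr M i s a) 0) => h;
    rewrite ?(ifT _ _ h) // /Num.min; case: ltP => //; lra.
rewrite le_min ge_min lexx orbT andbT lerN10 andbT; lra.
Qed.

Lemma mod_reward_le s a : `|rho s a| <= eta.
Proof.
have IR : 0 < I%:R :> R by rewrite ltr0n.
have /andP[r0 r1] := nonneg s a.
have e0 : 0 < eta by have := eta1; lra.
rewrite /mod_reward; set N := \sum_(i < I) _.
have N0 : N <= 0.
  by apply: sumr_le0 => i _; have [-> /andP[]] := negpart_gfun i s a.
have N1 : - I%:R <= N.
  rewrite -[X in - X%:R](card_ord I) -sumr_const -sumrN; apply: ler_sum => i _.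
  by have [-> /andP[]] := negpart_gfun i s a.
have m0 : eta / I%:R * N <= 0 by rewrite mulr_ge0_le0 // divr_ge0 // ltW.
have m1 : - eta <= eta / I%:R * N.
  have -> : - eta = eta / I%:R * - I%:R by field; rewrite gt_eqF.
  by rewrite ler_pM2l // divr_gt0.
by rewrite ler_norml; apply/andP; split; have := eta1; lra.
Qed.

Lemma Etraj_mod_reward pi :
  Etraj M pi (fun w => \sum_(h < H) at_epoch M rho h w) =
  value M pi - eta / I%:R * violation pi.
Proof.
rewrite /value /violation !Etraj_sum mulr_sumr -sumrB; apply: eq_bigr => h _.
rewrite -Etraj_sum -Etraj_scale -mulN1r -Etraj_scale -EtrajD; congr Etraj.
apply/funext => w; rewrite /at_epoch /mod_reward; congr (_ + _).
rewrite mulN1r -mulrN -sumrN; congr (_ * _); apply: eq_bigr => i _.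
have [-> /andP[_ n0]] := negpart_gfun i (state_at M w.2 h) (w.1 h).
by rewrite ler0_norm // opprK.
Qed.

Lemma violation_ge0 pi : is_policy pi -> 0 <= violation pi.
Proof.
move=> piP; apply: sumr_ge0 => h _; apply: sumr_ge0 => i _.
rewrite -[leLHS](Etraj_cst M 0 piP); apply: Etraj_le => // w; exact: normr_ge0.
Qed.

Lemma value_le pi : is_policy pi -> value M pi <= H%:R.
Proof.
move=> piP; rewrite /value -(Etraj_cst M H%:R piP); apply: Etraj_le => // w.
rewrite -[X in _ <= X%:R](card_ord H) -sumr_const; apply: ler_sum => h _.
by have /andP[] := nonneg (state_at M w.2 h) (w.1 h).
Qed.

Lemma value_ge0 pi : is_policy pi -> 0 <= value M pi.
Proof.
move=> piP; rewrite /value -[leLHS](Etraj_cst M 0 piP); apply: Etraj_le => // w /=.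
by apply: sumr_ge0 => h _; have /andP[] := nonneg (state_at M w.2 h) (w.1 h).
Qed.

(** The clipped constraints are nonpositive, so a nonnegative expectation forces the violation to
    vanish, and the penalized value of a feasible policy is its value. *)
Lemma feasible_value_le pi : feasible_policies M pi ->
  value M pi <= optV M rho a0 ord0 (start M).
Proof.
case=> piP fe; have := Etraj_reward_le M rho a0 piP.
rewrite Etraj_mod_reward; suff -> : violation pi = 0 by rewrite mulr0 subr0.
apply: le_anti; rewrite violation_ge0 // andbT.
apply: sumr_le0 => h _; apply: sumr_le0 => i _.
have := fe h i; rewrite -oppr_le0 -mulN1r -Etraj_scale; congr (_ <= _); congr Etraj.
apply/funext => w; rewrite /at_epoch.
have [-> /andP[_ n0]] := negpart_gfun i (state_at M w.2 h) (w.1 h).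
by rewrite ler0_norm // mulN1r.
Qed.

Hypothesis feasible : feasible_pcmdp M.

Lemma opt_value_le : opt_value M <= optV M rho a0 ord0 (start M).
Proof.
have [pi fe] := feasible; apply: ge_sup; first by exists (value M pi), pi.
by move=> _ [pi' fe' <-]; exact: feasible_value_le.
Qed.

(** Together with [value_le] this limits how negative the regret of an episode can be, namely -H,
    which is the source of the additive T in the violation bound. *)
Lemma opt_value_ge0 : 0 <= opt_value M.
Proof.
have [pi fe] := feasible; apply: le_trans (value_ge0 fe.1) _.
apply: ub_le_sup; last by exists pi.
by exists (optV M rho a0 ord0 (start M)) => _ [pi' fe' <-]; exact: feasible_value_le.
Qed.

End Values.

(** * Large horizons *)

Lemma log_growth (R : realType) (q c e : R) : 0 < q -> 0 < e ->
  exists X : R, forall x : R, X <= x ->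
    [/\ 1 <= x, c <= ln (q * x) & c * ln (q * x) ^+ 3 <= x `^ e].
Proof.
move=> q0 e0; pose c1 := Num.max c 1.
have c11 : 1 <= c1 by rewrite le_max lexx orbT.
have cc1 : c <= c1 by rewrite le_max lexx.
pose D := `|ln q| + 4 / e.
have e4 : 0 < 4 / e by rewrite divr_gt0.
have D0 : 0 < D by rewrite ltr_wpDl.
pose Y := 1 + c1 * D ^+ 3.
have Y1 : 1 <= Y by rewrite lerDl mulr_ge0 ?exprn_ge0 ?(ltW D0) // (le_trans ler01 c11).
exists (1 + expR c1 / q + Y `^ (4 / e)) => x hx.
have q1 : 0 <= expR c1 / q by rewrite divr_ge0 ?expR_ge0 // ltW.
have p0 : 0 <= Y `^ (4 / e) by exact: powR_ge0.
have x1 : 1 <= x by lra.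
have x0 : 0 < x by lra.
have lc : c1 <= ln (q * x).
  rewrite -[leLHS]expRK ler_ln ?posrE ?expR_gt0 ?mulr_gt0 //.
  by rewrite mulrC -ler_pdivrMr //; lra.
pose y := x `^ (e / 4).
have yY : Y <= y.
  have -> : Y = (Y `^ (4 / e)) `^ (e / 4).
    by rewrite -powRrM (_ : 4 / e * (e / 4) = 1) ?powRr1 //; [lra|field; rewrite gt_eqF].
  by apply: ge0_ler_powR; rewrite ?nnegrE ?divr_ge0 ?(ltW e0) ?(ltW x0) //; lra.
have y1 : 1 <= y by lra.
have lx : ln x <= 4 / e * y.
  have : ln y < y by apply: ln_sublinear; lra.
  rewrite /y ln_powR => h.
  rewrite -ler_pdivrMl // invf_div; exact: ltW.
have lq : ln (q * x) <= D * y.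
  rewrite lnM ?posrE // /D mulrDl; apply: lerD => //.
  apply: le_trans (ler_norm _) _; rewrite ler_peMr //.
split=> //; first exact: le_trans cc1 lc.
have -> : x `^ e = y ^+ 4.
  rewrite /y -powR_mulrn ?powR_ge0 // -powRrM; congr (_ `^ _); by field.
have l0 : 0 <= ln (q * x) by lra.
apply: le_trans (_ : c1 * (D * y) ^+ 3 <= _).
  apply: le_trans (_ : c1 * ln (q * x) ^+ 3 <= _).
    by rewrite ler_wpM2r // exprn_ge0.
  by rewrite ler_wpM2l ?(le_trans ler01 c11) // lerXn2r ?nnegrE // mulr_ge0 ?(ltW D0) //; lra.
have y0 : 0 <= y by lra.
have -> : c1 * (D * y) ^+ 3 = c1 * D ^+ 3 * y ^+ 3 by ring.
rewrite exprS; apply: ler_wpM2r; first exact: exprn_ge0.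
by apply: le_trans yY; rewrite /Y; lra.
Qed.

(** * Arithmetic of the budgets *)

Section Numeric.
Variable R : realType.
(** In use these are H, S A, K, eta, ell, K^(1/4) and e^3. The quarter power is the natural unit:
    first-pass quantities have order [z ^+ 2], and [var_slop], which contains them, appears under a
    root. *)
Variables (h m k eta l z E : R).
Hypothesis h1 : 1 <= h.
Hypothesis m1 : 1 <= m.
Hypothesis eta1 : 1 <= eta.
Hypothesis l1 : 1 <= l.
Hypothesis z0 : 0 <= z.
Hypothesis E1 : 1 <= E.
Hypothesis zk : k = z ^+ 4.
Hypothesis zl : 100 * E * h ^+ 3 * m ^+ 2 * l ^+ 3 <= z.

Let h0 : 0 < h. Proof. exact: lt_le_trans ltr01 h1. Qed.
Let m0 : 0 < m. Proof. exact: lt_le_trans ltr01 m1. Qed.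
Let eta0 : 0 < eta. Proof. exact: lt_le_trans ltr01 eta1. Qed.
Let l0 : 0 < l. Proof. exact: lt_le_trans ltr01 l1. Qed.
Let E0 : 0 < E. Proof. exact: lt_le_trans ltr01 E1. Qed.

Lemma sqrt_le_sqr (x y : R) : 0 <= y -> x <= y ^+ 2 -> Num.sqrt x <= y.
Proof.
move=> y0 xy; rewrite -[leRHS]ger0_norm // -sqrtr_sqr; exact: ler_wsqrtr.
Qed.

Definition coarse : R := h * m * (2 * (eta * h) + 2 * eta * Num.sqrt (h ^+ 3 * l * k)).

Let z1 : 1 <= z.
Proof.
apply: le_trans zl; rewrite -!mulrA; apply: mulr_ege1 => //; first by rewrite ler1n.
by do !(apply: mulr_ege1 => //; rewrite ?exprn_ege1).
Qed.

Let zpos : 0 < z. Proof. exact: lt_le_trans ltr01 z1. Qed.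

Lemma sqrt_kE : Num.sqrt k = z ^+ 2.
Proof. by rewrite zk (exprM z 2 2) sqrtr_sqr ger0_norm // exprn_ge0. Qed.

Lemma coarse_le : coarse <= eta * (4 * h ^+ 3 * m * l * z ^+ 2).
Proof.
have s : Num.sqrt (h ^+ 3 * l * k) <= h ^+ 2 * l * z ^+ 2.
  apply: sqrt_le_sqr; first by rewrite !mulr_ge0 ?exprn_ge0 // ltW.
  have -> : (h ^+ 2 * l * z ^+ 2) ^+ 2 = h ^+ 4 * l ^+ 2 * z ^+ 4 by ring.
  rewrite -zk; apply: ler_pM => //.
  - by rewrite mulr_ge0 ?exprn_ge0 // ltW.
  - by rewrite zk exprn_ge0.
  apply: ler_pM; rewrite ?exprn_ge0 ?(ltW h0) ?(ltW l0) //.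
    by apply: ler_weXn2l.
  by rewrite expr2 ler_peMr // ltW.
have t : h <= h ^+ 2 * l * z ^+ 2.
  rewrite -mulrA expr2 -mulrA ler_peMr ?(ltW h0) //.
  by do !(apply: mulr_ege1 => //; rewrite ?exprn_ege1).
apply: le_trans (_ : h * m * (4 * eta * (h ^+ 2 * l * z ^+ 2)) <= _); last first.
  by rewrite le_eqVlt; apply/orP; left; apply/eqP; ring.
rewrite ler_pM2l ?mulr_gt0 //.
have := ler_wpM2l (ltW eta0) s; have := ler_wpM2l (ltW eta0) t; lra.
Qed.

Lemma sqrt_l_le : Num.sqrt l <= l.
Proof. by apply: sqrt_le_sqr; rewrite ?(ltW l0) // expr2 ler_peMr // ltW. Qed.

(** The telescoped variances and the added eta H account for 8 + 1. The martingale and first-pass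
    terms have only order [z ^+ 2] against [k = z ^+ 4], and the last unit covers them. *)
Lemma variance_budget :
  4 * (5 * ((eta * h) ^+ 2 * h) * Num.sqrt k * Num.sqrt l) +
    8 * (eta * h) * (E * coarse) + k * (8 * (eta * h) ^+ 2 + eta * h * h) <=
  10 * eta ^+ 2 * h ^+ 2 * k.
Proof.
have e2 : 0 <= eta ^+ 2 * h ^+ 2 by rewrite mulr_ge0 ?exprn_ge0 // ltW.
have a1 : 4 * (5 * ((eta * h) ^+ 2 * h) * Num.sqrt k * Num.sqrt l) <=
    eta ^+ 2 * h ^+ 2 * (20 * (E * h ^+ 2 * m * l)) * z ^+ 2.
  rewrite sqrt_kE.
  have -> : 4 * (5 * ((eta * h) ^+ 2 * h) * z ^+ 2 * Num.sqrt l) =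
    eta ^+ 2 * h ^+ 2 * (20 * (h * Num.sqrt l)) * z ^+ 2 by ring.
  rewrite ler_wpM2r ?exprn_ge0 // ler_wpM2l // ler_pM2l //.
  rewrite [E * _ * _]mulrAC; apply: ler_pM; rewrite ?sqrtr_ge0 ?(ltW h0) ?sqrt_l_le //.
  have -> : E * m * h ^+ 2 = h * (E * m * h) by ring.
  by rewrite ler_peMr ?(ltW h0) //; do !(apply: mulr_ege1 => //).
have a2 : 8 * (eta * h) * (E * coarse) <=
    eta ^+ 2 * h ^+ 2 * (32 * (E * h ^+ 2 * m * l)) * z ^+ 2.
  apply: le_trans (_ : 8 * (eta * h) * (E * (eta * (4 * h ^+ 3 * m * l * z ^+ 2))) <= _).
    by rewrite ler_pM2l ?mulr_gt0 // ler_pM2l // coarse_le.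
  by rewrite le_eqVlt; apply/orP; left; apply/eqP; ring.
have a3 : k * (8 * (eta * h) ^+ 2 + eta * h * h) <= 9 * (eta ^+ 2 * h ^+ 2) * k.
  rewrite mulrC ler_wpM2r //; first by rewrite zk exprn_ge0.
  have -> : (eta * h) ^+ 2 = eta ^+ 2 * h ^+ 2 by ring.
  have : eta * h * h <= eta ^+ 2 * h ^+ 2.
    by rewrite -mulrA -expr2 ler_wpM2r ?exprn_ge0 ?(ltW h0) // expr2 ler_peMr // ltW.
  by lra.
have a4 : eta ^+ 2 * h ^+ 2 * (52 * (E * h ^+ 2 * m * l)) * z ^+ 2 <=
    eta ^+ 2 * h ^+ 2 * k.
  rewrite zk -mulrA ler_wpM2l // -[4%N]/(2 + 2)%N exprD ler_wpM2r ?exprn_ge0 //.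
  apply: le_trans (_ : z <= _); last by rewrite expr2 ler_peMr.
  apply: le_trans zl.
  have -> : 100 * E * h ^+ 3 * m ^+ 2 * l ^+ 3 =
     (E * h ^+ 2 * m * l) * (100 * (h * m * l ^+ 2)) by ring.
  rewrite mulrC; apply: ler_wpM2l.
    by rewrite !mulr_ge0 ?exprn_ge0 // ltW.
  have : 1 <= h * m * l ^+ 2 by do !(apply: mulr_ege1 => //; rewrite ?exprn_ege1).
  by lra.
by move: a1 a2 a3 a4; lra.
Qed.

Lemma regret_budget (slop lnk : R) :
  slop = 48 * (eta * h) ^+ 2 * Num.sqrt l + 4 * (eta * h) * ((h + 1) * (E * coarse)) ->
  0 <= lnk <= l ->
  E * (h * m * (2 * (eta * h)) +
    2 * Num.sqrt (h * l) * Num.sqrt (h * m * (10 * eta ^+ 2 * h ^+ 2 * k)) +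
    h * m * (1 + lnk) * (Num.sqrt (h * l) * Num.sqrt slop +
       eta * (Num.sqrt (h ^+ 7 * m) * l))) +
  10 * (eta * h) * h * Num.sqrt k * Num.sqrt l <=
  (8 * E + 10) * (eta * (h ^+ 2 * Num.sqrt (m * k * l))).
Proof.
move=> slopE /andP[k0 kl].
pose D := h ^+ 2 * Num.sqrt (m * k * l).
have kz : 0 <= k by rewrite zk exprn_ge0.
have zD : z ^+ 2 * Num.sqrt l <= Num.sqrt (m * k * l).
  rewrite -sqrt_kE -sqrtrM // ler_wsqrtr // ler_wpM2r ?(ltW l0) //.
  by rewrite ler_peMl.
have hD : h ^+ 2 * z ^+ 2 <= D.
  rewrite /D ler_wpM2l ?exprn_ge0 ?(ltW h0) //; apply: le_trans zD.
  by rewrite ler_peMr ?exprn_ge0 // -[leLHS]sqrtr1 ler_wsqrtr.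
(* The leading term: 2 sqrt 10 <= 7, checked as 10 <= 49/4. *)
have b1 : 2 * Num.sqrt (h * l) * Num.sqrt (h * m * (10 * eta ^+ 2 * h ^+ 2 * k)) <=
    7 * (eta * D).
  rewrite -mulrA -sqrtrM ?mulr_ge0 ?(ltW h0) ?(ltW l0) //.
  have : Num.sqrt (h * l * (h * m * (10 * eta ^+ 2 * h ^+ 2 * k))) <= 7 / 2 * (eta * D).
    apply: sqrt_le_sqr.
      by rewrite !mulr_ge0 ?invr_ge0 ?exprn_ge0 ?sqrtr_ge0 // ltW.
    have -> : (7 / 2 * (eta * D)) ^+ 2 = 49 / 4 * (eta ^+ 2 * h ^+ 4 * (Num.sqrt (m * k * l)) ^+ 2).
      by rewrite /D; field.
    rewrite sqr_sqrtr; last by rewrite !mulr_ge0 // ltW.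
    have -> : h * l * (h * m * (10 * eta ^+ 2 * h ^+ 2 * k)) =
       10 * (eta ^+ 2 * h ^+ 4 * (m * k * l)) by ring.
    rewrite ler_wpM2r //; last by lra.
    by rewrite !mulr_ge0 ?exprn_ge0 // ltW.
  by lra.
have b2 : 10 * (eta * h) * h * Num.sqrt k * Num.sqrt l <= 10 * (eta * D).
  have -> : 10 * (eta * h) * h * Num.sqrt k * Num.sqrt l =
    10 * (eta * (h ^+ 2 * (z ^+ 2 * Num.sqrt l))) by rewrite sqrt_kE; ring.
  by rewrite ler_pM2l // ler_pM2l // ler_wpM2l // exprn_ge0 // ltW.
(* One power of [z], where the target [D] has two; the spare [z] pays for all factors in [zl]. *)
have ss : Num.sqrt slop <= 10 * E * eta * h ^+ 3 * m * l * z.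
  apply: sqrt_le_sqr; first by rewrite !mulr_ge0 ?exprn_ge0 // ltW.
  have c1 : 48 * (eta * h) ^+ 2 * Num.sqrt l <= 48 * (E * eta ^+ 2 * h ^+ 5 * m * l * z ^+ 2).
    have -> : 48 * (eta * h) ^+ 2 * Num.sqrt l = 48 * (eta ^+ 2 * h ^+ 2) * Num.sqrt l by ring.
    have -> : 48 * (E * eta ^+ 2 * h ^+ 5 * m * l * z ^+ 2) =
       48 * (eta ^+ 2 * h ^+ 2) * (l * (E * h ^+ 3 * m * z ^+ 2)) by ring.
    rewrite ler_wpM2l ?mulr_ge0 ?exprn_ge0 ?(ltW eta0) ?(ltW h0) //.
    apply: le_trans sqrt_l_le _; rewrite ler_peMr ?(ltW l0) //.
    by do !(apply: mulr_ege1 => //; rewrite ?exprn_ege1).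
  have c2 : 4 * (eta * h) * ((h + 1) * (E * coarse)) <=
     32 * (E * eta ^+ 2 * h ^+ 5 * m * l * z ^+ 2).
    have -> : 32 * (E * eta ^+ 2 * h ^+ 5 * m * l * z ^+ 2) =
       4 * (eta * h) * ((2 * h) * (E * (eta * (4 * h ^+ 3 * m * l * z ^+ 2)))) by ring.
    rewrite ler_pM2l ?mulr_gt0 //; apply: ler_pM.
    - by rewrite addr_ge0 // ltW.
    - rewrite mulr_ge0 ?(ltW E0) // /coarse !mulr_ge0 ?addr_ge0 ?(ltW h0) ?(ltW m0) //.
        by rewrite !mulr_ge0 // ltW.
      by rewrite !mulr_ge0 ?sqrtr_ge0 // ltW.
    - by have := h1; lra.
    - by rewrite ler_pM2l // coarse_le.
  rewrite slopE; apply: le_trans (lerD c1 c2) _; rewrite -mulrDl.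
  have -> : (10 * E * eta * h ^+ 3 * m * l * z) ^+ 2 =
     (100 * (E * eta ^+ 2 * h ^+ 5 * m * l * z ^+ 2)) * (E * h * m * l) by ring.
  apply: le_trans (_ : 100 * (E * eta ^+ 2 * h ^+ 5 * m * l * z ^+ 2) <= _).
    rewrite ler_wpM2r //; last by lra.
    by rewrite !mulr_ge0 ?exprn_ge0 // ltW.
  rewrite ler_peMr ?mulr_ge0 ?exprn_ge0 ?(ltW E0) ?(ltW eta0) ?(ltW h0) ?(ltW m0) ?(ltW l0) //.
  by do !(apply: mulr_ege1 => //).
have shl : Num.sqrt (h * l) <= h * l.
  apply: sqrt_le_sqr; first by rewrite mulr_ge0 // ltW.
  by rewrite expr2 ler_peMr ?mulr_ege1 // mulr_ge0 // ltW.
have sh7 : Num.sqrt (h ^+ 7 * m) <= h ^+ 4 * m.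
  apply: sqrt_le_sqr; first by rewrite mulr_ge0 ?exprn_ge0 // ltW.
  have -> : (h ^+ 4 * m) ^+ 2 = h ^+ 8 * m ^+ 2 by ring.
  apply: ler_pM; rewrite ?exprn_ge0 ?(ltW h0) ?(ltW m0) //.
    exact: ler_weXn2l.
  by rewrite expr2 ler_peMr // ltW.
have b3 : h * m * (2 * (eta * h)) + h * m * (1 + lnk) * (Num.sqrt (h * l) * Num.sqrt slop +
       eta * (Num.sqrt (h ^+ 7 * m) * l)) <= eta * D.
  pose P := E * h ^+ 5 * m ^+ 2 * l ^+ 3 * z.
  apply: le_trans (_ : eta * (24 * P) <= _); last first.
    rewrite ler_pM2l //; apply: le_trans hD; rewrite /P.
    have -> : 24 * (E * h ^+ 5 * m ^+ 2 * l ^+ 3 * z) =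
       h ^+ 2 * (24 * (E * h ^+ 3 * m ^+ 2 * l ^+ 3) * z) by ring.
    rewrite ler_wpM2l ?exprn_ge0 ?(ltW h0) // [leRHS]expr2 ler_wpM2r //.
    apply: le_trans zl.
    have -> : 100 * E * h ^+ 3 * m ^+ 2 * l ^+ 3 = 100 * (E * h ^+ 3 * m ^+ 2 * l ^+ 3) by ring.
    rewrite ler_wpM2r //; last by lra.
    by rewrite !mulr_ge0 ?exprn_ge0 // ltW.
  have c1 : h * m * (2 * (eta * h)) <= eta * (2 * P).
    have -> : h * m * (2 * (eta * h)) = eta * (2 * (h ^+ 2 * m)) by ring.
    rewrite ler_pM2l // ler_pM2l // /P.
    have -> : E * h ^+ 5 * m ^+ 2 * l ^+ 3 * z = h ^+ 2 * m * (E * h ^+ 3 * m * l ^+ 3 * z) by ring.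
    rewrite ler_peMr ?mulr_ge0 ?exprn_ge0 ?(ltW h0) ?(ltW m0) //.
    by do !(apply: mulr_ege1 => //; rewrite ?exprn_ege1).
  have c2 : Num.sqrt (h * l) * Num.sqrt slop <= (h * l) * (10 * E * eta * h ^+ 3 * m * l * z).
    by apply: ler_pM; rewrite ?sqrtr_ge0.
  have c3 : eta * (Num.sqrt (h ^+ 7 * m) * l) <= eta * ((h ^+ 4 * m) * l).
    by rewrite ler_pM2l // ler_pM2r.
  have c4 : (h * l) * (10 * E * eta * h ^+ 3 * m * l * z) + eta * ((h ^+ 4 * m) * l) <=
     11 * (eta * (E * h ^+ 4 * m * l ^+ 2 * z)).
    have -> : (h * l) * (10 * E * eta * h ^+ 3 * m * l * z) =
      10 * (eta * (E * h ^+ 4 * m * l ^+ 2 * z)) by ring.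
    have : eta * ((h ^+ 4 * m) * l) <= eta * (E * h ^+ 4 * m * l ^+ 2 * z).
      rewrite ler_pM2l //.
      have -> : E * h ^+ 4 * m * l ^+ 2 * z = h ^+ 4 * m * l * (E * l * z) by ring.
      rewrite ler_peMr ?mulr_ge0 ?exprn_ge0 ?(ltW h0) ?(ltW m0) ?(ltW l0) //.
      by do !(apply: mulr_ege1 => //).
    by lra.
  have c5 : h * m * (1 + lnk) * (Num.sqrt (h * l) * Num.sqrt slop +
       eta * (Num.sqrt (h ^+ 7 * m) * l)) <= (h * m * (2 * l)) *
      (11 * (eta * (E * h ^+ 4 * m * l ^+ 2 * z))).
    apply: ler_pM.
    - by rewrite !mulr_ge0 ?addr_ge0 // ltW.
    - by rewrite addr_ge0 // ?mulr_ge0 ?sqrtr_ge0 ?mulr_ge0 ?sqrtr_ge0 // ltW.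
    - by rewrite ler_pM2l ?mulr_gt0 //; have := l1; lra.
    - by apply: le_trans (lerD c2 c3) c4.
  apply: le_trans (lerD c1 c5) _.
  by rewrite le_eqVlt; apply/orP; left; apply/eqP; rewrite /P; ring.
have : E * (h * m * (2 * (eta * h)) +
    2 * Num.sqrt (h * l) * Num.sqrt (h * m * (10 * eta ^+ 2 * h ^+ 2 * k)) +
    h * m * (1 + lnk) * (Num.sqrt (h * l) * Num.sqrt slop +
       eta * (Num.sqrt (h ^+ 7 * m) * l))) <= E * (8 * (eta * D)).
  by rewrite ler_pM2l //; move: b1 b3; lra.
by move: b2; rewrite /D; lra.
Qed.

End Numeric.

(** The reciprocal of the required precision is at most [expR (l * (H + 6))], hence at most
    [expR (l ^+ 2 / 2)]. As 2 is at least [expR (1/2)], about [l ^+ 2] halvings suffice. *)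
Lemma grid_exists (R : realType) (l T eta : R) (H K : nat) :
  (0 < H)%N -> (0 < K)%N -> 1 <= l -> 2 * (H%:R + 6) <= l -> 16 <= l ->
  T <= expR l -> K%:R <= T -> H%:R <= T -> 0 < eta -> eta <= T ->
  exists2 g : nat, g%:R <= l ^+ 2 + 1 &
    2^-1 ^+ g <= (K%:R ^+ H.+1)^-1 / (16 * (eta * H%:R) * H%:R ^+ 2).
Proof.
move=> H0 K0 l1 lH l16 Tl KT HT eta0 etaT.
have HR0 : 0 < H%:R :> R by rewrite ltr0n.
have KR0 : 0 < K%:R :> R by rewrite ltr0n.
have T0 : 0 < T by apply: lt_le_trans KT.
have l2 : 0 <= l ^+ 2 by exact: sqr_ge0.
exists (Num.truncn (l ^+ 2)).+1; first by rewrite -natr1 lerD2r truncn_le.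
have gl := truncnS_gt (l ^+ 2).
set g := (Num.truncn _).+1 in gl *.
rewrite exprVn -invfM lef_pV2 ?posrE ?exprn_gt0 ?mulr_gt0 ?exprn_gt0 //.
apply: le_trans (_ : expR l * (expR l) ^+ (H + 5) <= _).
  apply: le_trans (_ : 16 * T ^+ (H + 5) <= _).
    have -> : 16 * (eta * H%:R) * H%:R ^+ 2 = 16 * (eta * H%:R ^+ 3) by ring.
    rewrite mulrCA ler_pM2l // mulrC -mulrA.
    have -> : T ^+ (H + 5) = T * (T ^+ 3 * T ^+ H.+1).
      by rewrite -exprD -exprS; congr (_ ^+ _); rewrite addnC addSnnS.
    apply: ler_pM => //; rewrite ?(ltW eta0) ?mulr_ge0 ?exprn_ge0 ?(ltW HR0) ?(ltW KR0) //.
    by apply: ler_pM; rewrite ?exprn_ge0 ?(ltW HR0) ?(ltW KR0) //;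
      rewrite lerXn2r ?nnegrE // ltW.
  apply: ler_pM => //; rewrite ?exprn_ge0 ?(ltW T0) //.
    by have := expR_ge1Dx l; lra.
  by rewrite lerXn2r ?nnegrE ?expR_ge0 // ltW.
rewrite -exprS -expRM_natl.
apply: le_trans (_ : expR (g%:R * 2^-1) <= _).
  rewrite ler_expR; apply: le_trans (_ : l ^+ 2 / 2 <= _); last first.
    by rewrite ler_pM2r ?invr_gt0 // ltW.
  have -> : l ^+ 2 / 2 = (l / 2) * l by field.
  rewrite ler_wpM2r //; first by lra.
  rewrite -natr1 natrD; lra.
rewrite expRM_natl lerXn2r ?nnegrE ?expR_ge0 //.
have := expR_ge1Dx (- 2^-1 : R); rewrite expRN => h.
rewrite -[leLHS]invrK -[leRHS]invrK lef_pV2 ?posrE ?invr_gt0 ?expR_gt0 //.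
by lra.
Qed.

(** The cubic term of the series at [sqrt l / 2], with 48 = 3! 2^3, is squared to give l^3 / 48^2 as
    a lower bound for exp (sqrt l); one power of [l] is then left to beat [c / p]. *)
Lemma exp_sqrt_small (R : realType) (l c p : R) :
  1 <= l -> 0 < p -> 0 <= c -> 48 ^+ 2 * c <= p * l ->
  c * l ^+ 2 * expR (- Num.sqrt l) <= p.
Proof.
move=> l1 p0 c0 hl.
have l0 : 0 < l := lt_le_trans ltr01 l1.
have s0 : 0 <= Num.sqrt l / 2 by rewrite divr_ge0 ?sqrtr_ge0.
have cube : Num.sqrt l ^+ 3 / 48 <= expR (Num.sqrt l / 2).
  apply: le_trans (_ : 1 + (Num.sqrt l / 2) ^+ 3 / 3`!%:R <= _); last exact: expR_ge1Dxn.
  have -> : (Num.sqrt l / 2) ^+ 3 / 3`!%:R = Num.sqrt l ^+ 3 / 48.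
    by rewrite !factS fact0; field.
  by rewrite lerDr.
have sqrE : expR (Num.sqrt l) = expR (Num.sqrt l / 2) ^+ 2.
  by rewrite -expRM_natl; congr expR; field.
have sE : (Num.sqrt l ^+ 3) ^+ 2 = l ^+ 3.
  by rewrite -exprM (exprM _ 2 3) sqr_sqrtr // ltW.
rewrite expRN ler_pdivrMr ?expR_gt0 // sqrE.
apply: le_trans (_ : p * (Num.sqrt l ^+ 3 / 48) ^+ 2 <= _); last first.
  by rewrite ler_pM2l // lerXn2r ?nnegrE ?expR_ge0 // divr_ge0 ?exprn_ge0 ?sqrtr_ge0.
rewrite expr_div_n sE [leRHS]mulrA ler_pdivlMr ?exprn_gt0 //.
have -> : p * l ^+ 3 = (p * l) * l ^+ 2 by ring.
by rewrite mulrAC ler_wpM2r ?sqr_ge0 // mulrC.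
Qed.

Lemma sum_bounds (R : realType) (a b c d e : R) :
  0 <= a -> 0 <= b -> 0 <= c -> 0 <= d -> 0 <= e ->
  let s := 16 + (a + b + c + d + e) in
  [/\ 16 <= s, a <= s, b <= s & c <= s] /\ d <= s /\ e <= s.
Proof. by move=> /= *; do !split; lra. Qed.

Lemma card_events_le (R : realType) (g n L : R) :
  g <= L + 1 -> 1 <= n -> 1 <= L -> (g + 1) * 2 * n + n + 2 <= 9 * n * L.
Proof.
move=> gL n1 L1.
have h1 : 0 <= (L + 1 - g) * n by rewrite mulr_ge0 ?subr_ge0 // (le_trans ler01).
have h2 : 0 <= (L - 1) * n by rewrite mulr_ge0 ?subr_ge0 // (le_trans ler01).
lra.
Qed.

Lemma large_horizon (R : realType) (nS nA H : nat) (p phi C : R) :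
  (0 < nS)%N -> (0 < nA)%N -> (0 < H)%N -> 0 < p < 1 -> 0 < phi < 2^-1 -> 0 <= C ->
  exists K0 : nat, forall K : nat, (K0 <= K)%N ->
    let T : R := (K * H)%:R in
    let ell := ln (nS%:R * nA%:R * T / p) in
    let eta := T `^ phi in
    let E : R := expR 3 in
    let m : R := nS%:R * nA%:R in
    [/\ (0 < K)%N, 1 <= T, 1 <= eta, 1 <= ell & ln K%:R <= ell] /\
    [/\ 256 * 256 * H%:R ^+ 2 * Num.sqrt ell <= ell,
        exists2 g : nat,
          ((g.+1 * 2 * (H * nS * nA) + H * nS * nA + 2)%N)%:R *
            expR (- Num.sqrt ell) <= p &
          2^-1 ^+ g <= (K%:R ^+ H.+1)^-1 / (16 * (eta * H%:R) * H%:R ^+ 2),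
        exists z : R, [/\ 0 <= z, K%:R = z ^+ 4 &
          100 * E * H%:R ^+ 3 * m ^+ 2 * ell ^+ 3 <= z] &
        C * (Num.sqrt T * (H%:R ^+ 2 * m * ell)) <= T `^ (1 - phi)].
Proof.
move=> S0 A0 H0 /andP[p0 p1] /andP[phi0 phi1] C0.
set E : R := expR 3; set m : R := nS%:R * nA%:R.
have E0 : 0 < E by exact: expR_gt0.
have HR1 : 1 <= H%:R :> R by rewrite ler1n.
have HR0 : 0 < H%:R :> R by rewrite ltr0n.
have m1 : 1 <= m by rewrite /m -natrM ler1n muln_gt0 S0.
have m0 : 0 < m by lra.
have q1 : 1 <= m / p by rewrite ler_pdivlMr // mul1r; lra.
have q0 : 0 < m / p by rewrite divr_gt0.
(* 1/4 serves the comparison with K^(1/4), and 1/2 - phi the one between sqrt T and T^(1 - phi). *)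
pose e : R := Num.min (4^-1) (2^-1 - phi).
have e0 : 0 < e by rewrite lt_min invr_gt0 ltr0n /=; lra.
pose N : nat := (H * nS * nA)%N.
have N1 : 1 <= N%:R :> R by rewrite ler1n !muln_gt0 H0 S0.
pose cA : R := (256 * 256 * H%:R ^+ 2) ^+ 2.
pose cB : R := 2 * (H%:R + 6).
pose cC : R := 48 ^+ 2 * (9 * N%:R) / p.
pose cD : R := 100 * E * H%:R ^+ 3 * m ^+ 2 * H%:R.
pose cF : R := C * (H%:R ^+ 2 * m).
have cA0 : 0 <= cA by exact: sqr_ge0.
have cB0 : 0 <= cB by rewrite mulr_ge0 // addr_ge0.
have cC0 : 0 <= cC by rewrite divr_ge0 ?(ltW p0) // mulr_ge0 ?sqr_ge0 // mulr_ge0.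
have cD0 : 0 <= cD by rewrite !mulr_ge0 ?exprn_ge0 // ltW.
have cF0 : 0 <= cF by rewrite !mulr_ge0 ?exprn_ge0 // ltW.
pose cS := 16 + (cA + cB + cC + cD + cF).
have [[S16 SA SB SC] [SD SF]] : [/\ 16 <= cS, cA <= cS, cB <= cS & cC <= cS] /\
  cD <= cS /\ cF <= cS by exact: sum_bounds.
clearbody cS.
have [X hX] := log_growth cS q0 e0.
exists (Num.bound `|X|) => K hK /=.
have KX : X <= K%:R.
  apply: le_trans (ler_norm X) _; apply: ltW.
  by apply: lt_le_trans (archi_boundP (normr_ge0 X)) _; rewrite ler_nat.
have K0 : (0 < K)%N.
  have : 0 < (Num.bound `|X|)%:R :> R by apply: le_lt_trans (archi_boundP (normr_ge0 X)).
  by rewrite ltr0n => h; apply: leq_trans hK.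
have KT : (K%:R : R) <= (K * H)%:R by rewrite ler_nat leq_pmulr.
set T : R := (K * H)%:R in KT *.
have [T1] := hX T (le_trans KX KT).
have -> : m / p * T = m * T / p by rewrite mulrAC.
set ell := ln _ => lc lT.
have T0 : 0 < T := lt_le_trans ltr01 T1.
have l16 : 16 <= ell := le_trans S16 lc.
have l1 : 1 <= ell by apply: le_trans l16; rewrite ler1n.
have l0 : 0 <= ell := le_trans ler01 l1.
have l3 : 0 <= ell ^+ 3 by rewrite exprn_ge0.
have eta1 : 1 <= T `^ phi.
  by rewrite -(powRr0 T); apply: ler_powR => //; exact: ltW.
have KR0 : 0 < K%:R :> R by rewrite ltr0n.
have hlnT : ln T <= ell.
  have Tp : 0 < m * T / p by apply: divr_gt0 => //; exact: mulr_gt0.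
  by rewrite /ell ler_ln ?posrE // mulrAC ler_peMl // ltW.
have hlnK : ln K%:R <= ell by apply: le_trans hlnT; rewrite ler_ln ?posrE.
have lT' c : c <= cS -> c * ell ^+ 3 <= T `^ e.
  by move=> hc; apply: le_trans lT; rewrite ler_wpM2r.
split; first by split.
split.
- have s0 := sqrtr_ge0 ell.
  rewrite -[leRHS](sqr_sqrtr l0) expr2 ler_wpM2r //.
  have c0 : 0 <= 256 * 256 * H%:R ^+ 2 :> R by rewrite !mulr_ge0 ?exprn_ge0 // ltW.
  by rewrite -[leLHS](ger0_norm c0) -sqrtr_sqr ler_wsqrtr // (le_trans SA).
- have TE : T <= expR ell by rewrite -[leLHS](lnK (x := T)) ?posrE // ler_expR.
  have HT : H%:R <= T by rewrite ler_nat leq_pmull.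
  have etaT : T `^ phi <= T.
    apply: ler1_powR => //; apply/ltW/(lt_trans phi1).
    by rewrite invf_lt1 // ltr1n.
  have lH : 2 * (H%:R + 6) <= ell := le_trans SB lc.
  have eta0 : 0 < T `^ phi := lt_le_trans ltr01 eta1.
  have [g gl gh] := grid_exists H0 K0 l1 lH l16 TE KT HT eta0 etaT.
  exists g => //.
  have hC : 48 ^+ 2 * (9 * N%:R) <= p * ell.
    by rewrite [leRHS]mulrC -ler_pdivrMr // (le_trans SC).
  apply: le_trans (exp_sqrt_small l1 p0 _ hC); last by rewrite mulr_ge0.
  rewrite ler_wpM2r ?expR_ge0 // 2!natrD 2!natrM -/N -natr1.
  by apply: card_events_le => //; exact: exprn_ege1.
- exists (K%:R `^ (4^-1)); split; first exact: powR_ge0.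
    by rewrite -powR_mulrn ?powR_ge0 // -powRrM mulVf ?powRr1 // pnatr_eq0.
  have hD : cD * ell ^+ 3 <= T `^ e by exact: lT'.
  (* Growth is known in terms of T = K H, whereas [z] is a power of K. The further factor H in [cD]
     covers the H^(1/4) between them. *)
  rewrite -(ler_pM2r HR0); apply: le_trans (_ : T `^ e <= _).
    apply: le_trans hD; rewrite le_eqVlt; apply/orP; left; apply/eqP.
    by rewrite /cD mulrAC.
  apply: le_trans (_ : T `^ (4^-1) <= _).
    by apply: ler_powR => //; rewrite ge_min lexx.
  rewrite /T natrM powRM // ler_wpM2l ?powR_ge0 //.
  by apply: ler1_powR => //; rewrite invf_le1 // ler1n.
have hF : cF * ell ^+ 3 <= T `^ e by exact: lT'.
apply: le_trans (_ : Num.sqrt T * T `^ (2^-1 - phi) <= _).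
  rewrite mulrCA ler_wpM2l ?sqrtr_ge0 //.
  apply: le_trans (_ : T `^ e <= _); last first.
    by apply: ler_powR => //; rewrite ge_min lexx orbT.
  apply: le_trans hF; rewrite mulrA -/cF ler_wpM2l //.
  by rewrite exprS ler_peMr // exprn_ege1.
rewrite -powR12_sqrt ?(ltW T0) // -powRD; last by rewrite (gt_eqF T0) implybT.
by rewrite addrA (_ : 2^-1 + 2^-1 = 1) //; field.
Qed.

Theorem theorem2 (R : realType) :
  exists C c1 c2 : R, [/\ 0 < C, 0 < c1, 0 < c2 &
  forall (nS nA H I : nat) (p phi : R),
    (1 < nA)%N -> (0 < H)%N -> (0 < I)%N ->
    0 < p < 1 -> 0 < phi < 2^-1 ->
  exists K0 : nat,
  forall (S A : finType) (M : pcmdp R S A H I)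
         (tie : seq (obs S H) -> 'I_H -> S -> (A -> R) -> A) (K : nat),
    #|S| = nS -> #|A| = nA ->
    bounded_pcmdp M -> nonneg_reward M -> feasible_pcmdp M ->
    argmax_rule tie ->
    (K0 <= K)%N ->
    let T : R := (K * H)%:R in
    let ell := ln (nS%:R * nA%:R * T / p) in
    let eta := T `^ phi in
    let pi (w : K.-tuple (obs S H)) (k : 'I_K) : policy R S A H :=
      det_policy R (greedy_at M 0 eta ell c1 c2 tie w k) in
    1 - p <= Prun M 0 eta ell c1 c2 tie (fun w : K.-tuple (obs S H) =>
      (\sum_(k < K) (opt_value M - value M (pi w k))
         <= C * T `^ (2^-1 + phi) * Num.sqrt (H%:R ^+ 3 * nS%:R * nA%:R * ell))
      && (\sum_(k < K) \sum_(h < H) \sum_(i < I)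
            Etraj M (pi w k)
              (at_epoch M (fun s a => `|negpart (gfun M 0 i s a)|) h)
         <= C * I%:R * T `^ (1 - phi)))].
Proof.
pose C : R := 8 * expR 3 + 10.
have C0 : 0 < C by rewrite addr_gt0 // mulr_gt0 // expR_gt0.
exists C, 1, 1; split=> // nS nA H I p phi A1 H0 I0 p01 phi01.
(* The threshold is chosen before the instance; for [nS = 0] any choice will do, since an instance
   has an initial state. *)
case: (posnP nS) => [S0|S0].
  exists 0%N => S A M tie K hS; exfalso.
  have : (0 < #|S|)%N by apply/card_gt0P; exists (start M).
  by rewrite hS S0.
have A0 : (0 < nA)%N by exact: ltnW.
have [K0 hK0] := large_horizon S0 A0 H0 p01 phi01 (ltW C0).
exists K0 => S A M tie K hS hA bnd nng fea tieP KK.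
pose T : R := (K * H)%:R; pose ell := ln (nS%:R * nA%:R * T / p).
pose eta := T `^ phi.
pose pi (w : K.-tuple (obs S H)) (k : 'I_K) : policy R S A H :=
  det_policy R (greedy_at M 0 eta ell 1 1 tie w k).
cbv zeta; rewrite -/T -/ell -/eta.
have := hK0 K KK; rewrite /= -/T -/ell -/eta.
case=> -[Kpos T1 eta1 ell1 lnK] [ell_large [g hJ grid_fine] [z [z0 Kz hz]] hC].
subst nS nA.
have /card_gt0P[a0 _] := A0.
set m : R := #|S|%:R * #|A|%:R in hz hC.
have m1 : 1 <= m by rewrite /m -natrM ler1n muln_gt0 S0.
have m0 : 0 < m := lt_le_trans ltr01 m1.
have u1 : 1 <= Num.sqrt ell by rewrite -[leLHS]sqrtr1 ler_wsqrtr.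
have l0 : 0 < ell := lt_le_trans ltr01 ell1.
have T0 : 0 < T := lt_le_trans ltr01 T1.
have eta0 : 0 < eta := lt_le_trans ltr01 eta1.
have HR0 : 0 < H%:R :> R by rewrite ltr0n.
have HR1 : 1 <= H%:R :> R by rewrite ler1n.
have KR0 : 0 < K%:R :> R by rewrite ltr0n.
have IR0 : 0 < I%:R :> R by rewrite ltr0n.
have rhoB := mod_reward_le eta1 I0 bnd nng.
have rp := @run_ok_prob R S A H I M eta ell (Num.sqrt ell) a0 g K tie H0 Kpos eta1 rhoB.
apply: le_trans (le_trans _ rp) _.
  by rewrite lerD2l lerN2 card_bad_index.
apply: Prun_ge => w good; rewrite -/(pi w).
have wK : (size (rev w) <= K)%N by rewrite size_rev size_tuple.
have ok := run_okP wK good.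
pose D : R := H%:R ^+ 2 * Num.sqrt (m * K%:R * ell).
have reg : psum (fun q _ => mean_total M eta ell a0 tie q) (rev w) <= C * (eta * D).
  have E1 : 1 <= expR 3 :> R by rewrite -[leLHS]expR0 ler_expR.
  have coarseE : coarse_cost S A H eta ell K = coarse H%:R m K%:R eta ell by [].
  have Y0 : 0 < 10 * eta ^+ 2 * H%:R ^+ 2 * K%:R :> R by rewrite !mulr_gt0 ?exprn_gt0.
  apply: le_trans (psum_regret_le tieP H0 rhoB eta1 u1 ell_large Kpos grid_fine ok Y0 _) _.
    by rewrite coarseE; exact: (variance_budget HR1 m1 eta1 ell1 z0 E1 Kz hz).
  have NE : H%:R * #|S|%:R * #|A|%:R = H%:R * m :> R by rewrite /m mulrA.
  have N7 : H%:R ^+ 7 * #|S|%:R * #|A|%:R = H%:R ^+ 7 * m :> R by rewrite /m mulrA.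
  rewrite NE N7; apply: (regret_budget HR1 m1 eta1 ell1 z0 E1 Kz hz).
    by rewrite /var_slop /slack_bound coarseE -[H.+1%:R]natr1.
  by rewrite lnK ln_ge0 // ler1n.
clear z z0 Kz hz ell_large g hJ grid_fine rp good ok.
have sumE : psum (fun q _ => mean_total M eta ell a0 tie q) (rev w) =
    \sum_(k < K) (optV M (mod_reward M 0 eta) a0 ord0 (start M) - value M (pi w k) +
      eta / I%:R * violation M (pi w k)).
  rewrite psum_rev; apply: eq_bigr => k _.
  by rewrite mean_totalE Etraj_mod_reward // opprB addrA addrAC.
rewrite {}sumE in reg.
have vio0 k : 0 <= eta / I%:R * violation M (pi w k).
  rewrite mulr_ge0 ?divr_ge0 ?(ltW eta0) //.
  by apply: violation_ge0; exact: det_policyP.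
have optL := opt_value_le eta a0 bnd fea.
have opt0 := opt_value_ge0 eta a0 bnd nng fea.
have TE : T = K%:R * H%:R by rewrite /T natrM.
apply/andP; split.
  apply: le_trans (_ : C * (eta * D) <= _).
    apply: le_trans reg; apply: ler_sum => k _.
    apply: le_trans (_ : optV M (mod_reward M 0 eta) a0 ord0 (start M) - value M (pi w k) <= _).
      by rewrite lerD2r.
    by rewrite lerDl.
  rewrite powRD; last by rewrite (gt_eqF T0) implybT.
  rewrite powR12_sqrt ?(ltW T0) // -/eta.
  have -> : C * (Num.sqrt T * eta) * Num.sqrt (H%:R ^+ 3 * #|S|%:R * #|A|%:R * ell) =
    C * (eta * (Num.sqrt T * Num.sqrt (H%:R ^+ 3 * #|S|%:R * #|A|%:R * ell))) by ring.
  rewrite -sqrtrM ?(ltW T0) //.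
  (* As T = K H, the target sqrt T sqrt (H^3 S A ell) is exactly [D]. *)
  have -> : T * (H%:R ^+ 3 * #|S|%:R * #|A|%:R * ell) = (H%:R ^+ 2) ^+ 2 * (m * K%:R * ell).
    by rewrite TE /m; ring.
  by rewrite sqrtrM ?sqr_ge0 // sqrtr_sqr ger0_norm ?exprn_ge0 // ltW.
pose V := \sum_(k < K) violation M (pi w k).
(* The penalized optimum is nonnegative and a value is at most H, so adding H per episode, T in all,
   makes each unpenalized difference nonnegative. *)
have Vreg : eta / I%:R * V <= C * (eta * D) + T.
  rewrite /V mulr_sumr.
  have : \sum_(k < K) (eta / I%:R * violation M (pi w k)) <=
    \sum_(k < K) ((optV M (mod_reward M 0 eta) a0 ord0 (start M) - value M (pi w k) +
      eta / I%:R * violation M (pi w k)) + H%:R).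
    apply: ler_sum => k _.
    have := value_le nng (@det_policyP R S A H (greedy_at M 0 eta ell 1 1 tie w k)).
    rewrite -/(pi w k); lra.
  rewrite big_split /= sumr_const card_ord -[H%:R *+ K]mulr_natl -TE.
  by move: reg; lra.
(* [D] has order sqrt T up to logarithms, so phi < 1/2 and large T suffice. The violation bound thus
   keeps no trace of S and A. *)
have DT : C * D <= T `^ (1 - phi).
  apply: le_trans hC; rewrite ler_pM2l // /D.
  have -> : Num.sqrt T * (H%:R ^+ 2 * m * ell) = H%:R ^+ 2 * (Num.sqrt T * (m * ell)).
    by ring.
  rewrite ler_pM2l ?exprn_gt0 //.
  have -> : Num.sqrt (m * K%:R * ell) = Num.sqrt K%:R * Num.sqrt (m * ell).
    by rewrite -sqrtrM //; congr Num.sqrt; ring.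
  have ml1 : 1 <= m * ell by apply: mulr_ege1.
  apply: ler_pM; rewrite ?sqrtr_ge0 //.
    by rewrite ler_wsqrtr // TE ler_peMr // ltW.
  have ml0 := le_trans ler01 ml1.
  by apply: sqrt_le_sqr => //; rewrite expr2 ler_peMr.
have TEta : T = eta * T `^ (1 - phi).
  rewrite /eta -powRD; last by rewrite (gt_eqF T0) implybT.
  by rewrite addrC subrK powRr1 // ltW.
have V2 : eta / I%:R * V <= eta * (2 * T `^ (1 - phi)).
  apply: le_trans Vreg _; rewrite {1}TEta.
  by have := ler_wpM2l (ltW eta0) DT; lra.
have -> : \sum_(k < K) \sum_(h < H) \sum_(i < I)
    Etraj M (pi w k) (at_epoch M (fun s a => `|negpart (gfun M 0 i s a)|) h) = V by [].
have V3 : V <= 2 * I%:R * T `^ (1 - phi).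
  rewrite -(ler_pM2l (divr_gt0 eta0 IR0)); apply: le_trans V2 _.
  by rewrite le_eqVlt; apply/orP; left; apply/eqP; field; rewrite gt_eqF.
apply: le_trans V3 _; rewrite ler_wpM2r ?powR_ge0 // ler_wpM2r //.
by rewrite /C; have := expR_gt0 (3 : R); lra.
Qed.
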